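(* For every graph $G\in\mathcal G$, we have $rc(G)=rc^\ell(G)\in\{3,4\}$.
   Context: A degree $2$ vertex duplication on a graph $G$ creates a new graph by taking a vertex $v$ with $d_G(v)=2$ and adding a new vertex $v'$ adjacent to exactly the two neighbours of $v$. Let $G_7$ be the graph obtained from $K_4$ by subdividing once each of the three edges incident to one fixed vertex. $\mathcal G$ is the family of graphs obtained from $C_5$, $G_7$, or the Petersen graph by a finite (possibly empty) sequence of degree $2$ vertex duplications (i.e. the smallest family containing $C_5$, $G_7$, the Petersen graph and closed under degree $2$ vertex duplications). An edge-coloured path is rainbow if all its edges have distinct colours. An (not necessarily proper) edge-colouring of a connected graph $G$ is rainbow connected if any two vertices are joined by a rainbow path; $rc(G)$ is the minimum number of colours in such a colouring. An $r$-edge-list assignment of $G$ assigns to each edge $e$ a set $L(e)\subset\mathbb N$ with $|L(e)|\ge r$; an $L$-edge-colouring is an edge-colouring $c$ with $c(e)\in L(e)$ for all $e$. $rc^\ell(G)$ is the minimum integer $r$ such that for every $r$-edge-list assignment $L$ of $G$ there exists a rainbow connected $L$-edge-colouring of $G$. *)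

(* Defs.v *)
From HB Require Import structures.
From mathcomp Require Import all_boot.
Set Implicit Arguments. Unset Strict Implicit. Unset Printing Implicit Defensive.

Record sgraph := SGraph {
  vertex :> finType;
  adj : rel vertex;
  adj_sym : symmetric adj;
  adj_irr : irreflexive adj
}.
Arguments adj {s}.

Section Graphs.
Variable G : sgraph.

Definition edges : {set {set G}} :=
  [set e | [exists x : G, exists y : G, adj x y && (e == [set x; y])]].

Definition deg (v : G) : nat := #|[set y | adj v y]|.

End Graphs.

Definition isomorphic (G H : sgraph) : Prop :=
  exists f : G -> H, bijective f /\ forall x y, adj (f x) (f y) = adj x y.

Definition C5_adj : rel 'I_5 := [rel i j | (j == ordS i) || (i == ordS j)].
Lemma C5_sym : symmetric C5_adj.
Proof. by move=> i j; rewrite /C5_adj /= orbC. Qed.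
Lemma C5_irr : irreflexive C5_adj.
Proof. by move=> i; rewrite /C5_adj /= orbb; case: i => [[|[|[|[|[|i]]]]] hi]. Qed.
Definition C5 : sgraph := SGraph C5_sym C5_irr.

Definition K4_adj : rel 'I_4 := [rel i j | i != j].
Lemma K4_sym : symmetric K4_adj.
Proof. by move=> i j; rewrite /K4_adj /= eq_sym. Qed.
Lemma K4_irr : irreflexive K4_adj.
Proof. by move=> i; rewrite /K4_adj /= eqxx. Qed.
Definition K4 : sgraph := SGraph K4_sym K4_irr.

Section Subdivision.
Variables (G : sgraph) (F : {set {set G}}).

(* Every edge e in F is replaced by a path of length 2 whose middle vertex is
   inr e; F is meant to be a subset of edges G. *)
Definition subdiv_vertex : finType := (G + {e : {set G} | e \in F})%type.

Definition subdiv_adj : rel subdiv_vertex := fun u v =>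
  match u, v with
  | inl x, inl y => adj x y && ([set x; y] \notin F)
  | inl x, inr e => x \in val e
  | inr e, inl y => y \in val e
  | inr _, inr _ => false
  end.

Lemma subdiv_sym : symmetric subdiv_adj.
Proof. by case=> [x|e] [y|f] //=; rewrite adj_sym setUC. Qed.
Lemma subdiv_irr : irreflexive subdiv_adj.
Proof. by case=> [x|e] //=; rewrite adj_irr. Qed.
Definition subdivide : sgraph := SGraph subdiv_sym subdiv_irr.

End Subdivision.

Definition G7 : sgraph :=
  @subdivide K4 [set e in edges K4 | (ord0 : 'I_4) \in e].

(* The Petersen graph as the Kneser graph KG(5,2). *)
Definition petersen_vertex : finType := {A : {set 'I_5} | #|A| == 2}.
Definition petersen_adj : rel petersen_vertex :=
  fun A B => [disjoint val A & val B].
Lemma petersen_sym : symmetric petersen_adj.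
Proof. by move=> A B; rewrite /petersen_adj /= disjoint_sym. Qed.
Lemma petersen_irr : irreflexive petersen_adj.
Proof.
move=> A; apply/negP; rewrite /petersen_adj /= -setI_eq0 setIid => /eqP A0.
by have := valP A; rewrite /= A0 cards0.
Qed.
Definition petersen : sgraph := SGraph petersen_sym petersen_irr.

Section Duplication.
Variables (G : sgraph) (v : G).

(* None is the new copy of v. *)
Definition dup_adj : rel (option G) := fun a b =>
  match a, b with
  | Some x, Some y => adj x y
  | None, Some y => adj v y
  | Some x, None => adj v x
  | None, None => false
  end.

Lemma dup_sym : symmetric dup_adj.
Proof. by case=> [x|] [y|] //=; rewrite adj_sym. Qed.
Lemma dup_irr : irreflexive dup_adj.
Proof. by case=> [x|] //=; rewrite adj_irr. Qed.
Definition duplicate : sgraph := SGraph dup_sym dup_irr.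

End Duplication.

(* Graphs are taken up to isomorphism, hence the last constructor. *)
Inductive calG : sgraph -> Prop :=
| calG_C5 : calG C5
| calG_G7 : calG G7
| calG_petersen : calG petersen
| calG_dup (G : sgraph) (v : G) : calG G -> deg v = 2 -> calG (duplicate v)
| calG_iso (G H : sgraph) : calG G -> isomorphic G H -> calG H.

Section RainbowConnection.
Variable G : sgraph.

(* An edge-colouring is a function on all sets of vertices of which only the
   values on edges G are ever used; likewise for list assignments below. *)
Implicit Types (c : {set G} -> nat) (L : {set G} -> nat -> Prop).

Definition path_edges (x : G) (p : seq G) : seq {set G} :=
  pairmap (fun a b => [set a; b]) x p.

Definition rainbow_path c (x y : G) (p : seq G) : Prop :=
  [/\ path adj x p, last x p = y, uniq (x :: p)
    & uniq [seq c e | e <- path_edges x p]].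

Definition rainbow_connected c : Prop :=
  forall x y : G, exists p : seq G, rainbow_path c x y p.

Definition num_colours c : nat :=
  size (undup [seq c e | e <- enum (edges G)]).

(* L e is an arbitrary, possibly infinite, set of at least r naturals. *)
Definition edge_list_assignment (r : nat) L : Prop :=
  forall e, e \in edges G ->
    exists f : 'I_r -> nat, injective f /\ forall i, L e (f i).

Definition list_edge_colouring L c : Prop :=
  forall e, e \in edges G -> L e (c e).

Definition is_min (P : nat -> Prop) (k : nat) : Prop :=
  P k /\ forall m, P m -> k <= m.

(* is_rc k says rc(G) = k, and is_rcl k says rc^l(G) = k. *)
Definition is_rc : nat -> Prop :=
  is_min (fun k => exists c, rainbow_connected c /\ num_colours c = k).

Definition is_rcl : nat -> Prop :=
  is_min (fun r => forall L, edge_list_assignment r L ->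
    exists c, list_edge_colouring L c /\ rainbow_connected c).

End RainbowConnection.

(* Main.v *)
(** Degree 2 duplications of [C5] and [G7] only enlarge the classes of twin vertices of degree 2,
    so the graphs in question are "spiders": a hub, two or three pairwise adjacent tips, and for
    each tip a class of legs joined to it and to the hub.  The Petersen graph has no vertex of
    degree 2.

    Two colours never suffice, as all vertices would be joined by paths of length at most 2.  With
    lists of size 4, one distinguished leg per class receives colours that make all paths through it
    rainbow, and the remaining edges are coloured greedily.  So it remains to see that a spider with
    a rainbow connected colouring in three colours can be coloured from any lists of size 3.  In
    such a colouring a hub colour occurring in two classes occurs at most once in each, and any
    other occurs at most three times; for three tips this bounds the class sizes by a permutation of
    (3,3,3), (4,4,1), (5,2,2) or (7,1,1), for two tips by (6,3) or (4,4) up to order.  For each of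
    these sizes hub edges with the same property are coloured from their lists by Hall's theorem;
    the tip edges are then coloured greedily, except for a hub colour shared by three classes, where
    an octahedron has to be coloured and the Alon-Tarsi theorem applies, and for sizes (5,2,2) with
    constant hub lists, which are treated separately.

    For the Petersen graph, asking for a proper edge-colouring is too much.  Three of the thirty
    pairs at distance 2 are instead joined by paths of length 3, and the resulting system of thirty
    inequalities has a non-zero Alon-Tarsi coefficient. *)

Require Import Defs.
From HB Require Import structures.
From mathcomp Require Import all_boot all_order all_algebra.
From mathcomp Require Import ring zify.
From Stdlib Require Import Classical.
Set Implicit Arguments. Unset Strict Implicit. Unset Printing Implicit Defensive.

(** * The Alon-Tarsi theorem for lists of size three *)

(** The bounds on class sizes come from counting colours. Legs of one class with equal hub colours
    are told apart only by their tip edges, so three colours allow three of them. Legs of two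
    classes with equal hub colours must be joined through both tips; a second leg of that colour in
    one of these classes would put four different colours on two tip edges of one class, one of the
    other and the edge between the tips. A colouring from lists that obeys the same restrictions
    leaves a tip edge at most two colours to avoid, so greedy choice works. The exception is a hub
    colour present in three classes: its three legs and the three edges between tips constrain each
    other like the vertices of an octahedron, each leg being free only of the edge opposite to it,
    and just one such colour can be treated. For sizes (5,2,2) with constant hub lists this is
    fatal: 5 = 3 + 1 + 1 forces two colours present in all classes. There, either both are accepted
    and the tip edges coloured by hand, or the restrictions on hub colours are relaxed, relying on
    tip colours outside a given triple. *)

Section AlonTarsi.
Import GRing.Theory Num.Theory.
Local Open Scope ring_scope.
Variables (n : nat) (l : 'I_n -> 'I_3 -> nat).
Hypothesis l_inj : forall i, injective (l i).

(** Expanding the product of the factors [x_i - x_j] over [D] means choosing from each factor [x_i],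
    which keeps the sign, or [-x_j], which flips it. The components count the positive and the
    negative choices that yield the monomial with exponents [r]; in the recursion [r] holds the
    exponents still to be filled. A pair of naturals is cheap to evaluate. *)
Fixpoint signed_count (D : seq (nat * nat)) (r : seq nat) : nat * nat :=
  if D is (i, j) :: D' then
    let p := if nth 0%N r i is k.+1 then signed_count D' (set_nth 0%N r i k)
             else (0%N, 0%N) in
    let q := if nth 0%N r j is k.+1 then signed_count D' (set_nth 0%N r j k)
             else (0%N, 0%N) in
    ((p.1 + q.2)%N, (p.2 + q.1)%N)
  else (all (eq_op^~ 0%N) r : nat, 0%N).

Let val_at (f : {ffun 'I_n -> 'I_3}) (i : 'I_n) : rat := (l i (f i))%:R.
(** Lagrange interpolation at the three points of the list of [i]: with these weights, the weighted
    sum of the values of a polynomial of degree at most 2 is its coefficient of degree 2. *)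
Let weight (i : 'I_n) (j : 'I_3) : rat :=
  (\prod_(k | k != j) ((l i j)%:R - (l i k)%:R))^-1.

Lemma weight_moment i (e : nat) : (e <= 2)%N ->
  \sum_j weight i j * (l i j)%:R ^+ e = (e == 2)%:R.
Proof.
move=> e2.
rewrite !big_ord_recl big_ord0 /weight.
do 3! [rewrite big_mkcond !big_ord_recl big_ord0 /=].
set a := l i _; set b := l i _; set c := l i _.
have ab : a%:R - b%:R != 0 :> rat.
  by rewrite subr_eq0 eqr_nat; apply/eqP=> /l_inj.
have ac : a%:R - c%:R != 0 :> rat.
  by rewrite subr_eq0 eqr_nat; apply/eqP=> /l_inj.
have bc : b%:R - c%:R != 0 :> rat.
  by rewrite subr_eq0 eqr_nat; apply/eqP=> /l_inj.
rewrite !mulr1 !mul1r !addr0.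
have ba : b%:R - a%:R != 0 :> rat by rewrite -opprB oppr_eq0.
have ca : c%:R - a%:R != 0 :> rat by rewrite -opprB oppr_eq0.
have cb : c%:R - b%:R != 0 :> rat by rewrite -opprB oppr_eq0.
by case: e e2 => [|[|[|//]]] _ /=; field; rewrite ab ac bc ba ca cb.
Qed.

(** Weighted sum over all choices from the lists. For [e = 0] and [size D = 2n] it is the
    coefficient, in the product over [D], of the monomial with all exponents 2. If that is non-zero,
    some choice makes no factor vanish. *)
Let grid_sum (D : seq ('I_n * 'I_n)) (e : 'I_n -> nat) : rat :=
  \sum_(f : {ffun 'I_n -> 'I_3})
    (\prod_i (weight i (f i) * val_at f i ^+ e i)) *
    \prod_(p <- D) (val_at f p.1 - val_at f p.2).

Let incr (e : 'I_n -> nat) (i : 'I_n) : 'I_n -> nat := fun k => (e k + (k == i))%N.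

Lemma grid_sum_cons i j D e :
  grid_sum ((i, j) :: D) e = grid_sum D (incr e i) - grid_sum D (incr e j).
Proof.
rewrite /grid_sum -sumrB; apply: eq_bigr => f _.
rewrite big_cons /=.
have E k : \prod_i0 (weight i0 (f i0) * val_at f i0 ^+ incr e k i0) =
    val_at f k * \prod_i0 (weight i0 (f i0) * val_at f i0 ^+ e i0).
  rewrite (bigD1 k) //= [in RHS](bigD1 k) //= /incr eqxx addn1 exprS.
  rewrite (eq_bigr (fun i0 => weight i0 (f i0) * val_at f i0 ^+ e i0)); last first.
    by move=> i0 /negbTE ->; rewrite addn0.
  by rewrite !mulrA [weight _ _ * _]mulrC.
rewrite !E; ring.
Qed.

Lemma grid_sum_nil e :
  grid_sum [::] e = \prod_i \sum_j weight i j * (l i j)%:R ^+ e i.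
Proof.
rewrite bigA_distr_bigA /grid_sum; apply: eq_bigr => f _.
by rewrite big_nil mulr1.
Qed.

Lemma sum_incr e i : (\sum_k incr e i k = (\sum_k e k).+1)%N.
Proof.
rewrite /incr big_split /= -addn1; congr addn.
by rewrite (bigD1 i) //= eqxx big1 // => k /negbTE ->.
Qed.

Lemma grid_sum_nil0 e i : (e i < 2)%N -> grid_sum [::] e = 0.
Proof.
move=> ei; rewrite grid_sum_nil.
apply/eqP; rewrite prodf_seq_eq0; apply/hasP; exists i; first exact: mem_index_enum.
by rewrite /= weight_moment; [case: (e i) ei => [|[|]] | exact: ltnW].
Qed.

Lemma exists_low (e : 'I_n -> nat) : (\sum_k e k = n * 2)%N -> (exists i, e i != 2%N) ->
  exists i, (e i < 2)%N.
Proof.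
move=> se [i ei]; apply/existsP; apply: contraT; rewrite negb_exists => /forallP h.
have h2 k : (2 <= e k)%N by rewrite leqNgt h.
suff: (n * 2 < \sum_k e k)%N by rewrite se ltnn.
rewrite -[n in (n * _)%N]card_ord -sum_nat_const.
rewrite [X in (X < _)%N](bigD1 i) //= [X in (_ < X)%N](bigD1 i) //= -addSn.
by apply: leq_add; [rewrite ltn_neqAle eq_sym ei h2 | apply: leq_sum].
Qed.

(** The total degree [2n] is spread over [n] variables, so an exponent above 2 leaves another
    variable below 2 in every term of the expansion, and the weights of that variable annihilate the
    term. *)
Lemma grid_sum_high D (e : 'I_n -> nat) i : (2 < e i)%N ->
  (size D + \sum_k e k = n * 2)%N -> grid_sum D e = 0.
Proof.
elim: D e => [|[a b] D IH] e ei /= se.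
  have [|j ej] := @exists_low e se; last exact: grid_sum_nil0 ej.
  by exists i; rewrite neq_ltn ei orbT.
have h k : grid_sum D (incr e k) = 0.
  by apply: IH; [exact: ltn_addr | rewrite sum_incr -se addnS].
by rewrite grid_sum_cons !h subrr.
Qed.

(** Expanding a factor raises one exponent in [e] and lowers the same entry of [r]. Where that entry
    is already 0, [signed_count] contributes nothing, and [grid_sum_high] gives 0 on the other
    side. *)
Lemma grid_sumE (D : seq ('I_n * 'I_n)) (e : 'I_n -> nat) r : size r = n -> (forall i, e i + nth 0 r i = 2)%N ->
  (size D + \sum_k e k = n * 2)%N ->
  let c := signed_count [seq (val p.1, val p.2) | p <- D] r in
  grid_sum D e = c.1%:R - c.2%:R.
Proof.
elim: D e r => [|[a b] D IH] e r sr er se.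
  rewrite /= subr0; case: (boolP (all _ r)) => [/allP r0|/allPn[x /(nthP 0%N)[i]]].
    rewrite grid_sum_nil big1 // => i _; have := er i.
    by rewrite (eqP (r0 _ (mem_nth 0%N _))) ?sr // addn0 => e2; rewrite weight_moment e2.
  rewrite sr => lin <- ri.
  apply: (@grid_sum_nil0 _ (Ordinal lin)).
  by move: ri (er (Ordinal lin)) => /=; case: (nth 0%N r i) => // m _ <-; lia.
have step k : grid_sum D (incr e k) =
    let c := if nth 0%N r k is m.+1
             then signed_count [seq (val p.1, val p.2) | p <- D] (set_nth 0%N r k m)
             else (0%N, 0%N) in
    c.1%:R - c.2%:R.
  have := er k; case E: (nth 0%N r k) => [|m] ek.
    rewrite /= subrr (@grid_sum_high _ _ k) //; first by rewrite /incr eqxx; lia.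
    by rewrite sum_incr -se /= addnS.
  apply: IH.
  - by rewrite size_set_nth sr; apply/maxn_idPr.
  - move=> i; rewrite nth_set_nth /= /incr -val_eqE.
    case: eqP => [ik|_]; last by rewrite addn0 er.
    have -> : i = k by apply: val_inj.
    by move: ek; clear; lia.
  - by rewrite sum_incr -se /= addnS.
rewrite grid_sum_cons !step [signed_count _ _]/= /=.
set x := (if _ is _.+1 then _ else _); set y := (if _ is _.+1 then _ else _).
by rewrite !natrD; ring.
Qed.

Theorem alon_tarsi (D : seq ('I_n * 'I_n)) : size D = (n * 2)%N ->
  (let c := signed_count [seq (val p.1, val p.2) | p <- D] (nseq n 2) in c.1 != c.2) ->
  exists f : 'I_n -> 'I_3, forall p, p \in D -> l p.1 (f p.1) <> l p.2 (f p.2).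
Proof.
move=> sD /= cD.
have := @grid_sumE D (fun=> 0%N) (nseq n 2).
rewrite size_nseq big1 // addn0 => /(_ erefl) H.
have nz : grid_sum D (fun=> 0%N) != 0.
  rewrite H //; last by move=> i; rewrite nth_nseq ltn_ord.
  by rewrite subr_eq0 eqr_nat.
case: (boolP [exists f : {ffun 'I_n -> 'I_3},
         all (fun p => l p.1 (f p.1) != l p.2 (f p.2)) D]).
  by case/existsP=> f /allP h; exists f => p /h /eqP.
rewrite negb_exists => /forallP h; case/eqP: nz.
rewrite /grid_sum big1 // => f _; have /allPn[p pD] := h f.
rewrite negbK => /eqP E; apply/eqP; rewrite mulf_eq0; apply/orP; right.
by rewrite prodf_seq_eq0; apply/hasP; exists p => //=; rewrite subr_eq0 eqr_nat E eqxx.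
Qed.
End AlonTarsi.

(** With indices in [nat], the side conditions for a concrete [D] form a closed boolean term that
    can be evaluated. *)
Corollary alon_tarsi_nat n (l : 'I_n.+1 -> 'I_3 -> nat) (D : seq (nat * nat)) :
  (forall i, injective (l i)) ->
  [&& size D == n.+1 * 2, all (fun p => (p.1 < n.+1) && (p.2 < n.+1)) D &
      let c := signed_count D (nseq n.+1 2) in c.1 != c.2] ->
  exists f : 'I_n.+1 -> 'I_3, forall i j, (i, j) \in D ->
    l (inord i) (f (inord i)) <> l (inord j) (f (inord j)).
Proof.
move=> l_inj /and3P[/eqP sD /allP ltD cD].
pose D' := [seq (inord p.1 : 'I_n.+1, inord p.2 : 'I_n.+1) | p <- D].
have ED : [seq (val p.1, val p.2) | p <- D'] = D.
  rewrite -map_comp -[RHS]map_id; apply/eq_in_map => -[i j] /ltD /= /andP[li lj].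
  by rewrite !inordK.
have [||f fD] := @alon_tarsi _ _ l_inj D'; first by rewrite size_map.
  by rewrite ED.
exists f => i j ij; apply: (fD (inord i, inord j)).
by apply/mapP; exists (i, j).
Qed.

(** * Hall's theorem and greedy colourings *)

Section Hall.
Variables (S T : finType) (t0 : T).

(** Induction on the size of [X]. A tight non-empty proper subset is matched on its own, and the
    rest is matched outside its neighbourhood; if no subset is tight, any value may be given to one
    element and removed from the others. *)
Lemma hall_in (D : S -> {set T}) (X : {set S}) :
  (forall J : {set S}, J \subset X -> #|J| <= #|\bigcup_(s in J) D s|) ->
  exists f : S -> T, {in X &, injective f} /\ {in X, forall s, f s \in D s}.
Proof.
have [n] := ubnP #|X|; elim: n D X => // n IH D X Xn hX.
have [->|[x xX]] := set_0Vmem X.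
  by exists (fun=> t0); split=> [s s'|s]; rewrite inE.
case: (boolP [exists J : {set S}, [&& J \proper X, J != set0 &
    #|\bigcup_(s in J) D s| <= #|J|]]) => [/existsP[J /and3P[JX J0 Jt]]|tight].
  have [f1 [f1i f1D]] : exists f : S -> T,
      {in J &, injective f} /\ {in J, forall s, f s \in D s}.
    apply: IH => [|K KJ]; first by apply: leq_trans (proper_card JX) _.
    exact: hX (subset_trans KJ (proper_sub JX)).
  pose N := \bigcup_(s in J) D s.
  have [f2 [f2i f2D]] : exists f : S -> T,
      {in X :\: J &, injective f} /\ {in X :\: J, forall s, f s \in D s :\: N}.
    apply: IH => [|K KX].
      have := cardsID J X; rewrite (setIidPr (proper_sub JX)).
      by move: J0 Xn; rewrite -card_gt0; lia.
    have dKJ : [disjoint K & J].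
      by move: KX; rewrite subsetD => /andP[].
    have := hX (K :|: J); rewrite subUset (proper_sub JX) andbT.
    rewrite (subset_trans KX (subsetDl _ _)) => /(_ isT).
    rewrite cardsU (disjoint_setI0 dKJ) cards0 subn0 bigcup_setU -/N.
    have -> : \bigcup_(i in K) D i :|: N = \bigcup_(i in K) (D i :\: N) :|: N.
      apply/setP=> t; rewrite !inE; case: (boolP (t \in N)); rewrite ?orbT ?orbF //.
      move=> tN; apply/bigcupP/bigcupP=> -[i iK ti]; exists i => //; first by rewrite inE tN.
      by move: ti; rewrite inE => /andP[].
    set M := \bigcup_(i in K) (D i :\: N) => h; rewrite -[X in _ <= X]/(#|M|).
    by move: (leq_card_setU M N).1 Jt h; rewrite -/N; lia.
  exists (fun s => if s \in J then f1 s else f2 s); split=> [s s' sX s'X|s sX] /=.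
    have hN u : u \in X -> u \notin J -> f2 u \notin N.
      by move=> uX uJ; have /f2D : u \in X :\: J; rewrite !inE ?uJ // => /andP[].
    have h1 u : u \in J -> f1 u \in N by move=> uJ; apply/bigcupP; exists u => //; apply: f1D.
    case: ifPn => sJ; case: ifPn => s'J E.
    - exact: f1i.
    - by have := hN _ s'X s'J; rewrite -E h1.
    - by have := hN _ sX sJ; rewrite E h1.
    - by apply: f2i => //; rewrite inE ?sJ ?s'J.
  case: ifPn => sJ; first exact: f1D.
  by have /f2D : s \in X :\: J; rewrite !inE ?sJ // => /andP[].
have [t tD] : exists t, t \in D x.
  apply/set0Pn; rewrite -card_gt0; have := hX [set x].
  by rewrite cards1 big_set1 sub1set; apply.
have [f [fi fD]] : exists f : S -> T,
    {in X :\ x &, injective f} /\ {in X :\ x, forall s, f s \in D s :\ t}.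
  apply: IH => [|K KX]; first by move: Xn; rewrite (cardsD1 x) xX.
  have [->|K0] := eqVneq K set0; first by rewrite cards0.
  have KpX : K \proper X.
    by apply: sub_proper_trans KX _; rewrite properD1.
  move: tight; rewrite negb_exists => /forallP/(_ K); rewrite KpX K0 /= -ltnNge.
  have : \bigcup_(i in K) D i \subset t |: \bigcup_(i in K) (D i :\ t).
    apply/bigcupsP=> i iK; apply/subsetP=> u ui; rewrite !inE.
    by case: eqVneq => //= ut; apply/bigcupP; exists i; rewrite // !inE ut.
  set M := \bigcup_(i in K) (D i :\ t); rewrite -[X in _ -> _ -> _ <= X]/(#|M|).
  by move/subset_leq_card; rewrite cardsU1; lia.
exists (fun s => if s == x then t else f s); split=> [s s' sX s'X|s sX] /=.
  have h u : u \in X -> u != x -> f u != t.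
    by move=> uX ux; have /fD : u \in X :\ x; rewrite !inE ?ux // => /andP[].
  case: eqP => [->|/eqP sx]; case: eqP => [->|/eqP s'x] //.
  - by move/esym/eqP; rewrite (negbTE (h _ s'X s'x)).
  - by move/eqP; rewrite (negbTE (h _ sX sx)).
  - by apply: fi; rewrite !inE ?sx ?s'x.
case: eqP => [->//|/eqP sx].
by have /fD : s \in X :\ x; rewrite !inE ?sx // => /andP[].
Qed.

Lemma hall (D : S -> {set T}) :
  (forall J : {set S}, #|J| <= #|\bigcup_(s in J) D s|) ->
  exists f : S -> T, injective f /\ forall s, f s \in D s.
Proof.
move=> h; have [f [fi fD]] := @hall_in D setT (fun J _ => h J).
by exists f; split=> [s s' /fi|s]; [apply | apply: fD].
Qed.
End Hall.

Lemma card_ord_ge n : n <= 3 -> #|[set j : 'I_3 | n <= j]| + n = 3.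
Proof.
by rewrite -sum1dep_card big_mkcond !big_ord_recl big_ord0; case: n => [|[|[|[|]]]].
Qed.

(** Hall's theorem for slots: colour [x] is split into copies [(x, j)] with [j] in ['I_3] and
    [def x <= j], hence has [3 - def x] slots. The hypothesis is Hall's condition with the missing
    slots moved to the left. *)
Lemma hall_capacity (S C : finType) (c0 : C) (L : S -> {set C}) (def : C -> nat) :
  (forall x, def x <= 3) ->
  (forall J : {set S}, J != set0 -> let U := \bigcup_(s in J) L s in
    #|J| + \sum_(x in U) def x <= 3 * #|U|) ->
  exists a : S -> C, (forall s, a s \in L s) /\
    forall x, #|[set s | a s == x]| + def x <= 3.
Proof.
move=> d3 H.
have [|f [fi fD]] := @hall S (C * 'I_3)%type (c0, ord0)
    (fun s => [set p : C * 'I_3 | (p.1 \in L s) && (def p.1 <= p.2)]).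
  move=> J; have [->|J0] := eqVneq J set0; first by rewrite cards0.
  have := H J J0; set U := \bigcup_(s in J) L s => /= HJ.
  set V := \bigcup_(s in J) _.
  have EV : V = [set p : C * 'I_3 | (p.1 \in U) && (def p.1 <= p.2)].
    apply/setP=> p; rewrite inE; apply/bigcupP/andP.
      by case=> s sJ; rewrite inE => /andP[h1 h2]; split=> //; apply/bigcupP; exists s.
    by case=> /bigcupP[s sJ h1] h2; exists s; rewrite // inE h1.
  have cV : #|V| + \sum_(x in U) def x = 3 * #|U|.
    have -> : #|V| = \sum_(x in U) (3 - def x).
      rewrite -sum1_card (partition_big fst (mem U)) /=; last first.
        by move=> p; rewrite EV inE => /andP[].
      apply: eq_bigr => x xU; rewrite sum1_card.
      rewrite -[in RHS](card_ord_ge (d3 x)) addnK.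
      rewrite -(card_imset [set j : 'I_3 | def x <= j] (f := pair x)); last by move=> ? ? [].
      apply: eq_card => -[y j]; rewrite unfold_in /= EV !inE /=; apply/andP/imsetP.
        by case=> /andP[yU dj] /eqP yx; exists j; rewrite -?yx ?inE.
      by case=> i; rewrite inE => ? [-> ->]; rewrite xU eqxx.
    rewrite -big_split /= (eq_bigr (fun=> 3)) ?sum_nat_const 1?mulnC // => x _.
    by rewrite subnK.
  by rewrite -(leq_add2r (\sum_(x in U) def x)) cV.
exists (fun s => (f s).1); split=> [s|x]; first by have := fD s; rewrite inE => /andP[].
have : #|[set s | (f s).1 == x]| <= #|[set j : 'I_3 | def x <= j]|.
  rewrite -(card_in_imset (f := fun s => (f s).2)); last first.
    move=> s s'; rewrite !inE => /eqP h1 /eqP h2 h3; apply: fi.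
    by rewrite [f s]surjective_pairing [f s']surjective_pairing h1 h2 h3.
  apply/subset_leq_card/subsetP=> j /imsetP[s]; rewrite !inE => /eqP <- ->.
  by have := fD s; rewrite inE => /andP[].
by have := card_ord_ge (d3 x); lia.
Qed.

(** The bound counts all conflicting elements, coloured or not, so any order works. Elements of [D0]
    keep their colours from [b0]; conflicts inside [D0] are left to the caller. *)
Lemma greedy (S C : finType) (L F : S -> {set C}) (conf : rel S) (b0 : S -> C)
    (D0 : {set S}) : symmetric conf ->
  (forall s, s \notin D0 ->
     #|F s| + #|[set s' | conf s s' && (s' != s)]| < #|L s|) ->
  exists b : S -> C,
    [/\ {in D0, b =1 b0}, {in ~: D0, forall s, b s \in L s :\: F s} &
        forall s s', s \notin D0 -> s' != s -> conf s s' -> b s != b s'].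
Proof.
move=> csym; have [n] := ubnP #|~: D0|; elim: n b0 D0 => // n IH b0 D0 Dn h.
have [D0T|[s]] := set_0Vmem (~: D0).
  exists b0; split=> // [s|s s']; first by rewrite D0T inE.
  by rewrite -in_setC D0T inE.
rewrite inE => sD.
have [x] : exists x, x \in L s :\: (F s :|: [set b0 s' | s' in [set s' | conf s s' && (s' != s)]]).
  apply/set0Pn; rewrite -card_gt0 cardsD subn_gt0.
  apply: leq_ltn_trans (subset_leq_card (subsetIr _ _)) _.
  apply: leq_ltn_trans (leq_card_setU _ _).1 _.
  by apply: leq_ltn_trans (h s sD); rewrite leq_add2l leq_imset_card.
rewrite !inE negb_or => /andP[/andP[xF xb] xL].
have [||b [b1 b2 b3]] := IH (fun u => if u == s then x else b0 u) (s |: D0).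
- rewrite -ltnS; apply: leq_trans Dn; rewrite ltnS; apply: proper_card; rewrite setCU properE subsetIr.
  apply/subsetPn; exists s; by rewrite !inE ?eqxx.
- by move=> u; rewrite !inE negb_or => /andP[_]; apply: h.
have bs : b s = x by rewrite b1 ?eqxx // !inE eqxx.
have b0D u : u \in D0 -> b u = b0 u.
  move=> uD; rewrite b1 ?inE ?uD ?orbT //; case: eqP => // us.
  by move: sD; rewrite -us uD.
exists b; split=> [u /b0D //|u|u u'].
  rewrite inE => uD; case: (eqVneq u s) => [->|us]; first by rewrite bs !inE xF.
  by apply: b2; rewrite !inE negb_or us.
move=> uD uu' cuu'; case: (eqVneq u s) => [us|us]; last first.
  by apply: b3; rewrite ?inE ?negb_or ?us.
subst u; case: (boolP (u' \in D0)) => u'D.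
  rewrite bs b0D //; apply: contra xb => /eqP ->; apply/imsetP; exists u' => //.
  by rewrite inE cuu'.
rewrite eq_sym; apply: b3; rewrite ?inE ?negb_or ?uu' //; first by rewrite eq_sym.
by rewrite csym.
Qed.

(** Six vertices and twelve edges give the degree needed for the monomial with all exponents 2.
    Vertices [k] and [3 + k] are opposite, and the signed count is evaluated. *)
Lemma octahedron_choosable (C : finType) (A P : 'I_3 -> {set C}) :
  (forall k, #|A k| = 3) -> (forall k, #|P k| = 3) ->
  exists a p : 'I_3 -> C,
    [/\ forall k, a k \in A k, forall k, p k \in P k, injective a, injective p &
        forall k l, k != l -> a k != p l].
Proof.
move=> A3 P3.
have [x0 _] : exists x, x \in A ord0 by apply/set0Pn; rewrite -card_gt0 A3.
pose L (i : 'I_6) := if i < 3 then A (inord i) else P (inord (i - 3)).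
have L3 i : #|L i| = 3 by rewrite /L; case: ifP.
pose l (i : 'I_6) (j : 'I_3) := nth x0 (enum (L i)) j.
have sz i : size (enum (L i)) = 3 by rewrite -cardE.
have [|| f fD] := @alon_tarsi_nat 5 (fun i j => enum_rank (l i j))
  [:: (0,1); (0,2); (1,2); (3,4); (3,5); (4,5);
      (0,4); (0,5); (1,3); (1,5); (2,3); (2,4)].
- move=> i j j' /val_inj/enum_rank_inj/eqP; rewrite nth_uniq ?sz ?enum_uniq //.
  by move/eqP/val_inj.
- by vm_compute.
- have [g gL neq] : exists2 g : nat -> C, forall i, i < 6 -> g i \in L (inord i) &
      forall i j, (i, j) \in [:: (0,1); (0,2); (1,2); (3,4); (3,5); (4,5);
        (0,4); (0,5); (1,3); (1,5); (2,3); (2,4)] -> g i != g j.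
    exists (fun i => l (inord i) (f (inord i))) => [i _|i j ij].
      by rewrite -mem_enum mem_nth // sz.
    by apply/eqP=> E; apply: (fD i j ij); rewrite E.
  exists (fun k => g k), (fun k => g (3 + k)); split.
  + move=> k; have lk : k < 6 by have := ltn_ord k; lia.
    by have := gL _ lk; rewrite /L inordK // ltn_ord inord_val.
  + move=> k; have lk : 3 + k < 6 by have := ltn_ord k; lia.
    by have := gL _ lk; rewrite /L inordK // ltnNge leq_addr /= addKn inord_val.
  + move=> k k'; apply: contra_eq; rewrite -val_eqE.
    by case: k k' => [[|[|[|//]]] i] [[|[|[|//]]] j] //= _; first [exact: neq | rewrite eq_sym; exact: neq].
  + move=> k k'; apply: contra_eq; rewrite -val_eqE.
    by case: k k' => [[|[|[|//]]] i] [[|[|[|//]]] j] //= _; first [exact: neq | rewrite eq_sym; exact: neq].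
  + by move=> [[|[|[|//]]] i] [[|[|[|//]]] j] //= _; apply: neq.
Qed.

Lemma set_pick (C : finType) (A B : {set C}) : #|B| < #|A| ->
  exists2 x, x \in A & x \notin B.
Proof.
move=> AB; have /subsetPn[x xA xB] : ~~ (A \subset B).
  by apply: contraL AB => /subset_leq_card; rewrite -leqNgt.
by exists x.
Qed.

Lemma pick_notin1 (C : finType) (A : {set C}) u : 1 < #|A| ->
  exists2 x, x \in A & x != u.
Proof.
move=> A1; have [|x xA xu] := @set_pick _ A [set u]; first by rewrite cards1.
by exists x => //; rewrite inE in xu.
Qed.

Lemma pick_notin2 (C : finType) (A : {set C}) u v : 2 < #|A| ->
  exists2 x, x \in A & (x != u) && (x != v).
Proof.
move=> A1; have [|x xA xu] := @set_pick _ A [set u; v].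
  by rewrite cards2; case: eqP => ? /=; lia.
by exists x => //; move: xu; rewrite !inE negb_or.
Qed.

(** An element outside [T] is taken whenever there is one; otherwise [A] is contained in [T], and
    the sizes force equality. *)
Lemma pick_avoid (C : finType) (A T : {set C}) : #|T| <= #|A| -> 0 < #|A| ->
  exists2 x, x \in A & x \in T -> A = T.
Proof.
move=> TA A0; case: (boolP (A \subset T)) => [AT|/subsetPn[x xA xT]].
  have /set0Pn[x xA] : A != set0 by rewrite -card_gt0.
  by exists x => // _; apply/eqP; rewrite eqEcard AT.
by exists x => //; rewrite (negbTE xT).
Qed.

Lemma card_set2_le (C : finType) (a b : C) : #|[set a; b]| <= 2.
Proof. by rewrite cards2; case: eqP. Qed.

Lemma card_set3_le (C : finType) (a b c : C) : #|[set a; b; c]| <= 3.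
Proof. by rewrite setUC cardsU1; have := card_set2_le a b; case: (_ \notin _) => /=; lia. Qed.

(** * Colouring the hub edges *)

Section Multiplicity.
Variable T : finType.
Definition occ (C : eqType) (a : T -> C) (x : C) : nat := #|[set i | a i == x]|.

Lemma occE (C : eqType) (a : T -> C) x : occ a x = \sum_i (a i == x).
Proof. by rewrite /occ -sum1dep_card big_mkcond. Qed.

Lemma occ_inj (C : eqType) (a : T -> C) x : injective a -> occ a x <= 1.
Proof.
move=> ai; rewrite /occ; case: (set_0Vmem [set i | a i == x]) => [->|[i]].
  by rewrite cards0.
rewrite inE => /eqP aix; rewrite -(cards1 i); apply/subset_leq_card/subsetP=> j.
by rewrite !inE -aix => /eqP/ai ->.
Qed.

Lemma occ_max (C : eqType) (a : T -> C) x : occ a x <= #|T|.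
Proof. exact: max_card. Qed.

Lemma occ_eq0 (C : eqType) (a : T -> C) x : (forall i, a i != x) -> occ a x = 0.
Proof.
by move=> h; apply/eqP; rewrite cards_eq0; apply/eqP/setP=> i; rewrite !inE (negbTE (h i)).
Qed.

Lemma occ_gt0 (C : eqType) (a : T -> C) x : 0 < occ a x -> exists i, a i = x.
Proof. by rewrite card_gt0 => /set0Pn[i]; rewrite inE => /eqP; exists i. Qed.

Lemma occ_pair (C : eqType) (a : T -> C) x y : x != y -> occ a x + occ a y <= #|T|.
Proof.
move=> xy; rewrite -cardsUI (_ : _ :&: _ = set0) ?cards0 ?addn0 ?max_card //.
by apply/setP=> i; rewrite !inE; case: eqP => // ->; rewrite (negbTE xy).
Qed.

(** Two different lists together occur at most [#|T|] times, so each list but the most frequent one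
    occurs at most half the time. Hall's condition is then delicate mainly at [T0]. *)
Lemma majority (C : finType) (L : T -> {set C}) : (forall i, #|L i| = 3) ->
  exists T0 : {set C}, [/\ #|T0| <= 3, forall A, A != T0 -> 2 * occ L A <= #|T| &
    0 < #|T| -> exists i, L i = T0].
Proof.
move=> L3; pose T0 := [arg max_(A > set0) occ L A].
have h A : occ L A <= occ L T0 by rewrite /T0; case: arg_maxnP => // B _; apply.
have h2 A : A != T0 -> 2 * occ L A <= #|T|.
  by move=> AT; have := occ_pair L AT; have := h A; lia.
case: (posnP (occ L T0)) => [m0|/occ_gt0[i Li]]; last first.
  by exists T0; split=> //; [rewrite -Li L3 | exists i].
exists set0; split=> [|A _|/card_gt0P[i _]]; rewrite ?cards0 //.
  by have := h A; rewrite m0; lia.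
by have := h (L i); rewrite m0 leqn0 cards_eq0 => /eqP/setP/(_ i); rewrite !inE eqxx.
Qed.
End Multiplicity.

Section AlphaBig.
Variables (I C : finType) (c0 : C) (L : I -> {set C}) (Z1 Z2 : {set C}).
Hypothesis L3 : forall i, #|L i| = 3.

(** The restrictions come from smaller classes coloured before: [Z1] is for colours they use at most
    once each, which may appear once more here, and [Z2] for colours reserved to them. *)
Let good := exists a : I -> C, (forall i, a i \in L i) /\
  forall x, [/\ occ a x <= 3, x \in Z1 -> occ a x <= 1 & x \in Z2 -> occ a x = 0].

Lemma assign_with_caps :
  (forall J : {set I}, J != set0 -> let U := \bigcup_(s in J) L s in
     #|J| + 2 * #|U :&: Z1| + 3 * #|U :&: Z2| <= 3 * #|U|) -> good.
Proof.
move=> H.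
(* A colour has three slots. A cap of one costs two of them, a ban all three. *)
pose def x := if x \in Z2 then 3 else if x \in Z1 then 2 else 0.
have [||a [aL ad]] := @hall_capacity _ _ c0 L def.
- by move=> x; rewrite /def; case: ifP => // _; case: ifP.
- move=> J J0 /=; set U := \bigcup_(s in J) L s.
  apply: leq_trans (_ : #|J| + (2 * #|U :&: Z1| + 3 * #|U :&: Z2|) <= _);
    last by rewrite addnA; exact: H.
  rewrite leq_add2l.
  have E k (Z : {set C}) : k * #|U :&: Z| = \sum_(x in U) (if x \in Z then k else 0).
    rewrite mulnC -sum_nat_const (eq_bigl (fun x => (x \in U) && (x \in Z))) ?big_mkcondr //.
    by move=> x; rewrite inE.
  rewrite !E -big_split /=; apply: leq_sum => x _.
  by rewrite /def; do 2 case: (x \in _).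
exists a; split=> // x; have := ad x; rewrite /def -/(occ a x).
by split=> [|h|h]; move: (ad x); rewrite /def -/(occ a x) ?h; do ?case: ifP => _; lia.
Qed.

Lemma bigcup_lists (J : {set I}) : J != set0 ->
  let U := \bigcup_(s in J) L s in 3 <= #|U| /\ (#|U| = 3 -> #|J| <= occ L U).
Proof.
move=> /set0Pn[i iJ] U.
have sub j : j \in J -> L j \subset U by move=> jJ; apply: bigcup_sup.
split=> [|U3]; first by rewrite -(L3 i) subset_leq_card ?sub.
apply/subset_leq_card/subsetP=> j jJ; rewrite inE eqEcard sub //.
by rewrite U3 L3.
Qed.

(** Hall's condition for the union [U] splits into three cases. If [U] has at least four colours,
    there are 12 slots for all of [I]. If [U] has three, there are 9 slots, and only legs whose list
    is [U] count: at most half of them unless [U] is [T0]. *)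
Lemma assign_with_few_caps (T0 : {set C}) n :
  (forall A, A != T0 -> 2 * occ L A <= #|I|) -> #|I| <= n ->
  let z := 2 * #|Z1| + 3 * #|Z2| in
  n./2 + z <= 9 -> n + z <= 12 ->
  occ L T0 + 2 * #|T0 :&: Z1| + 3 * #|T0 :&: Z2| <= 9 -> good.
Proof.
move=> hT In z z1 z2 z3; apply: assign_with_caps => J J0 /=.
set U := \bigcup_(s in J) L s.
have [U3 U4] : 3 <= #|U| /\ (#|U| = 3 -> #|J| <= occ L U) := bigcup_lists J0.
have u1 : #|U :&: Z1| <= #|Z1| by apply/subset_leq_card/subsetIr.
have u2 : #|U :&: Z2| <= #|Z2| by apply/subset_leq_card/subsetIr.
have Jn : #|J| <= n := leq_trans (max_card _) In.
rewrite {}/z in z1 z2; clearbody U; case: (leqP #|U| 3) => Ule; last first.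
  by move: u1 u2 Jn z2 Ule; clear; lia.
have E : #|U| = 3 by apply/eqP; rewrite eqn_leq Ule.
have {}U4 := U4 E; have [UT|/hT hU] := eqVneq U T0.
  by rewrite E UT; rewrite UT in U4; move: U4 z3; clear; lia.
have {}hU : occ L U <= n./2.
  by rewrite -(doubleK (occ L U)) half_leq // -mul2n (leq_trans hU In).
by rewrite E; move: hU U4 u1 u2 z1; clear; lia.
Qed.
End AlphaBig.

(** The arguments are the numbers of legs of one hub colour in the three classes; two classes are
    modelled by [c = 0]. *)
Definition compatible (a b c : nat) : bool :=
  [&& a <= 3, b <= 3, c <= 3, (1 < a) ==> (b == 0) && (c == 0),
      (1 < b) ==> (a == 0) && (c == 0) & (1 < c) ==> (a == 0) && (b == 0)].

Lemma compatible_le1 a b c : a <= 1 -> b <= 1 -> c <= 1 -> compatible a b c.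
Proof. by case: a b c => [|[|//]] [|[|//]] [|[|//]]. Qed.

Lemma compatible0 b : b <= 3 -> compatible 0 b 0.
Proof. by rewrite /compatible /= => ->; rewrite implybT. Qed.

Lemma card_sub1 (T : finType) (A : {set T}) u : A \subset [set u] -> #|A| <= 1.
Proof. by move/subset_leq_card; rewrite cards1. Qed.

Section HubColours.
Variable C : finType.
Implicit Types I : finType.

(** The last clause admits a single colour [w] in all three classes, because the legs of such a
    colour are coloured jointly with the three edges between tips. *)
Definition hub_colouring I1 I2 I3 (L1 : I1 -> {set C}) (L2 : I2 -> {set C})
    (L3 : I3 -> {set C}) (a1 : I1 -> C) (a2 : I2 -> C) (a3 : I3 -> C) : Prop :=
  [/\ (forall i, a1 i \in L1 i), (forall i, a2 i \in L2 i), (forall i, a3 i \in L3 i),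
      (forall x, compatible (occ a1 x) (occ a2 x) (occ a3 x)) &
      exists w, forall x, x != w -> [|| occ a1 x == 0, occ a2 x == 0 | occ a3 x == 0]].

Definition hub_colourable I1 I2 I3 (L1 : I1 -> {set C}) (L2 : I2 -> {set C})
    (L3 : I3 -> {set C}) : Prop :=
  exists a1 a2 a3, hub_colouring L1 L2 L3 a1 a2 a3.

Lemma hub_colourable_swap12 I1 I2 I3 (L1 : I1 -> {set C}) (L2 : I2 -> {set C})
    (L3 : I3 -> {set C}) : hub_colourable L2 L1 L3 -> hub_colourable L1 L2 L3.
Proof.
case=> a2 [a1 [a3 [h2 h1 h3 hc [w hw]]]]; exists a1, a2, a3; split=> // [x|].
  have := hc x; rewrite /compatible => /and5P[-> -> ->].
  by move=> -> /andP[-> ]; rewrite andbC.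
by exists w => x /hw; rewrite orbCA.
Qed.

Lemma hub_colourable_swap23 I1 I2 I3 (L1 : I1 -> {set C}) (L2 : I2 -> {set C})
    (L3 : I3 -> {set C}) : hub_colourable L1 L3 L2 -> hub_colourable L1 L2 L3.
Proof.
case=> a1 [a3 [a2 [h1 h3 h2 hc [w hw]]]]; exists a1, a2, a3; split=> // [x|].
  have := hc x; rewrite /compatible => /and5P[-> -> ->].
  by rewrite [(occ a3 x == 0) && _]andbC => -> /andP[-> ->].
by exists w => x /hw; rewrite [X in _ || X]orbC.
Qed.

Section Big.
Variables (I1 I2 I3 : finType) (L1 : I1 -> {set C}) (L2 : I2 -> {set C})
  (L3 : I3 -> {set C}) (a2 : I2 -> C) (a3 : I3 -> C) (Z1 Z2 : {set C}) (w : C).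

Lemma hub_colourable_big :
  (exists a : I1 -> C, (forall i, a i \in L1 i) /\
    forall x, [/\ occ a x <= 3, x \in Z1 -> occ a x <= 1 & x \in Z2 -> occ a x = 0]) ->
  (forall i, a2 i \in L2 i) -> (forall i, a3 i \in L3 i) ->
  (forall x, x \in Z2 -> compatible 0 (occ a2 x) (occ a3 x)) ->
  (forall x, x \notin Z2 -> occ a2 x <= (x \in Z1) /\ occ a3 x <= (x \in Z1)) ->
  (forall x, x != w -> x \notin Z2 -> (occ a2 x == 0) || (occ a3 x == 0)) ->
  hub_colourable L1 L2 L3.
Proof.
case=> a [aL am] h2 h3 hZ2 hZ hw; exists a, a2, a3; split=> // [x|].
  have [m3 m1 m0] := am x; case: (boolP (x \in Z2)) => xZ; first by rewrite m0 // hZ2.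
  have [] := hZ x xZ; case: (boolP (x \in Z1)) => xZ1 b1 b2.
    by rewrite compatible_le1 ?m1.
  by move: b1 b2; rewrite !leqn0 => /eqP -> /eqP ->; rewrite /compatible m3 /= !implybT.
exists w => x xw; have [_ _ m0] := am x.
by case: (boolP (x \in Z2)) => xZ; [rewrite m0 | rewrite hw ?orbT].
Qed.
End Big.

Lemma occ_const1 (a : C) x : occ (fun _ : 'I_1 => a) x = (a == x).
Proof. by rewrite occE big_ord1. Qed.

Lemma hub_711 I (L : I -> {set C}) (Y Z : {set C}) : #|I| <= 7 ->
  (forall i, #|L i| = 3) -> #|Y| = 3 -> #|Z| = 3 ->
  hub_colourable L (fun _ : 'I_1 => Y) (fun _ : 'I_1 => Z).
Proof.
move=> I7 L3 Y3 Z3; have [T0 [T03 hT _]] := majority L3.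
have mT : occ L T0 <= 7 := leq_trans (occ_max L T0) I7.
case: (set_0Vmem (Y :&: Z)) => [YZ0|[w]]; last first.
  rewrite inE => /andP[wY wZ].
  apply: (@hub_colourable_big _ _ _ L _ _ (fun=> w) (fun=> w) [set w] set0 w) => //.
  - apply: (assign_with_few_caps w L3 hT I7); rewrite ?setI0 ?cards0 ?cards1; try lia.
    have : #|T0 :&: [set w]| <= 1 by apply: (@card_sub1 _ _ w); apply: subsetIr.
    lia.
  - by move=> x; rewrite inE.
  - by move=> x _; rewrite !occ_const1 inE eq_sym.
  - by move=> x xw _; rewrite !occ_const1 [w == x]eq_sym (negbTE xw).
(* Seven legs leave two of the nine slots of [T0], enough for one capped colour in it. Disjoint [Y]
   and [Z] are not both equal to [T0], so one of [y], [z] falls outside. *)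
have [y yY yT] : exists2 y, y \in Y & y \in T0 -> Y = T0 by apply: pick_avoid; rewrite Y3.
have [z zZ zT] : exists2 z, z \in Z & z \in T0 -> Z = T0 by apply: pick_avoid; rewrite Z3.
have dis x : x \in Y -> x \in Z -> False.
  by move=> xY xZ; have := in_set0 x; rewrite -YZ0 inE xY xZ.
apply: (@hub_colourable_big _ _ _ L _ _ (fun=> y) (fun=> z) [set y; z] set0 y) => //.
- have c2 := card_set2_le y z.
  apply: (assign_with_few_caps y L3 hT I7); rewrite ?setI0 ?cards0; try lia.
  suff : #|T0 :&: [set y; z]| <= 1 by lia.
  case: (boolP (y \in T0)) => yT0.
    apply: (@card_sub1 _ _ y); apply/subsetP=> x; rewrite !inE.
    case/andP=> xT /orP[//|/eqP xz]; exfalso; apply: (dis z) => //.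
    by rewrite (yT yT0) -xz.
  apply: (@card_sub1 _ _ z); apply/subsetP=> x; rewrite !inE.
  by case/andP=> xT /orP[/eqP xy|//]; move: yT0; rewrite -xy xT.
- by move=> x; rewrite inE.
- by move=> x _; rewrite !occ_const1 !inE [y == x]eq_sym [z == x]eq_sym; case: eqP; case: eqP.
- by move=> x xw _; rewrite !occ_const1 [y == x]eq_sym (negbTE xw).
Qed.

Lemma occ_I0 (a : 'I_0 -> C) x : occ a x = 0.
Proof. by rewrite occE big_ord0. Qed.

(** The empty third class makes this a case of two tips. The three small legs use one banned colour,
    a banned and a capped one, or three capped ones. Six legs leave three slots of [T0], so at most
    one of the colours used may lie in it. *)
Lemma hub_63 I (L : I -> {set C}) (N : 'I_3 -> {set C}) (M : 'I_0 -> {set C}) : #|I| <= 6 ->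
  (forall i, #|L i| = 3) -> (forall i, #|N i| = 3) -> hub_colourable L N M.
Proof.
move=> I6 L3 N3; have [T0 [T03 hT _]] := majority L3.
have mT : occ L T0 <= 6 := leq_trans (occ_max L T0) I6.
have [c _] : exists c, c \in N ord0 by apply/set0Pn; rewrite -card_gt0 N3.
pose a3 (_ : 'I_0) := c.
have a3P i : a3 i \in M i by case: i.
case: (boolP [exists c, forall i, c \in N i]) => [/existsP[d /forallP dN]|nc].
  apply: (@hub_colourable_big _ _ _ L _ _ (fun=> d) a3 set0 [set d] d) => //.
  - apply: (assign_with_few_caps d L3 hT I6); rewrite ?setI0 ?cards0 ?cards1; try lia.
    have : #|T0 :&: [set d]| <= 1 by apply: (@card_sub1 _ _ d); apply: subsetIr.
    lia.
  - by move=> x _; rewrite occ_I0 compatible0 //; apply: leq_trans (occ_max _ _) _; rewrite card_ord.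
  - move=> x; rewrite inE => xd; rewrite occ_I0 occ_eq0 // => _; by rewrite eq_sym.
  - by move=> x _ _; rewrite occ_I0 orbT.
case: (boolP [exists i, exists j, (i != j) && (N i :&: N j != set0)]).
  case/existsP=> i /existsP[j /andP[ij /set0Pn[d]]]; rewrite inE => /andP[di dj].
  have [k dk] : exists k, d \notin N k.
    by move: nc; rewrite negb_exists => /forallP/(_ d); rewrite negb_forall => /existsP.
  (* If [e] is forced into [T0], then [N k] is [T0], and [d] lies outside it. *)
  have [e eN eT] : exists2 e, e \in N k & e \in T0 -> N k = T0 by apply: pick_avoid; rewrite N3.
  have de : d != e by apply: contraNneq dk => ->.
  have h l : l != k -> d \in N l.
    have ik : i != k by apply: contraNneq dk => <-.
    have jk : j != k by apply: contraNneq dk => <-.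
    move=> lk; suff: (l == i) || (l == j) by case/orP=> /eqP ->.
    move: ij ik jk lk; rewrite -!val_eqE.
    by case: i {di} => -[|[|[|//]]] ?; case: j {dj} => -[|[|[|//]]] ?;
       case: k {dk eN eT} => -[|[|[|//]]] ?; case: l => -[|[|[|//]]] ?.
  pose a2 l := if l == k then e else d.
  have m2 x : occ a2 x <= if x == d then 2 else (x == e).
    case: eqP => [->|/eqP xd].
      apply: leq_trans (_ : #|[set~ k]| <= _); last by rewrite cardsC1 card_ord.
      apply/subset_leq_card/subsetP=> l; rewrite !inE /a2; case: ifP => // _.
      by rewrite eq_sym (negbTE de).
    case: eqP => [->|/eqP xe].
      apply: (@card_sub1 _ _ k); apply/subsetP=> l; rewrite !inE /a2.
      by case: ifP => // _; rewrite (negbTE de).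
    by rewrite occ_eq0 // => l; rewrite /a2; case: ifP => _; rewrite eq_sym.
  apply: (@hub_colourable_big _ _ _ L _ _ a2 a3 [set e] [set d] d) => //.
  - apply: (assign_with_few_caps d L3 hT I6); rewrite ?cards1; try lia.
    have c1 : #|T0 :&: [set e]| <= (e \in T0).
      case: (boolP (e \in T0)) => eT0; first by apply: (@card_sub1 _ _ e); apply: subsetIr.
      by rewrite leqn0 cards_eq0; apply/eqP/setP=> x; rewrite !inE; case: eqP => [->|]; rewrite ?andbF ?andbT // (negbTE eT0).
    have c2 : #|T0 :&: [set d]| <= (d \in T0).
      case: (boolP (d \in T0)) => dT0; first by apply: (@card_sub1 _ _ d); apply: subsetIr.
      by rewrite leqn0 cards_eq0; apply/eqP/setP=> x; rewrite !inE; case: eqP => [->|]; rewrite ?andbF ?andbT // (negbTE dT0).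
    have : (e \in T0) + (d \in T0) <= 1.
      by case: (boolP (e \in T0)) => [/eT <-|_]; rewrite ?(negbTE dk) //; case: (d \in T0).
    by move: c1 c2; do 2 case: (_ \in T0) => /=; lia.
  - by move=> l; rewrite /a2; case: eqP => [->//|/eqP/h].
  - move=> x; rewrite inE => /eqP ->; rewrite occ_I0 compatible0 //.
    by have := m2 d; rewrite eqxx; lia.
  - by move=> x; rewrite !inE occ_I0 => xd; have := m2 x; rewrite (negbTE xd).
  - by move=> x _ _; rewrite occ_I0 orbT.
rewrite negb_exists => /forallP dis.
have {}dis i j x : x \in N i -> x \in N j -> i = j.
  move=> xi xj; apply/eqP; apply: contraT => ij.
  have := dis i; rewrite negb_exists => /forallP/(_ j); rewrite ij /= negbK.
  by move/eqP/setP/(_ x); rewrite !inE xi xj.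
have [a2 a2P] : exists a2 : 'I_3 -> C, forall j, a2 j \in N j /\ (a2 j \in T0 -> N j = T0).
  apply: (fin_all_exists (P := fun j u => u \in N j /\ (u \in T0 -> N j = T0))) => j.
  by have [|//|x] := @pick_avoid _ (N j) T0; rewrite ?N3 //; exists x.
have a2i : injective a2.
  by move=> i j E; apply: (dis _ _ (a2 i)); [|rewrite E]; case: (a2P i); case: (a2P j).
apply: (@hub_colourable_big _ _ _ L _ _ a2 a3 [set a2 j | j in [set: 'I_3]] set0 c) => //.
- have c3 : #|[set a2 j | j in [set: 'I_3]]| <= 3.
    by rewrite (leq_trans (leq_imset_card _ _)) // cardsT card_ord.
  apply: (assign_with_few_caps c L3 hT I6); rewrite ?setI0 ?cards0; try lia.
  suff : #|T0 :&: [set a2 j | j in [set: 'I_3]]| <= 1 by lia.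
  case: (set_0Vmem (T0 :&: [set a2 j | j in [set: 'I_3]])) => [->|[u]]; first by rewrite cards0.
  rewrite inE => /andP[uT /imsetP[j _ uj]]; apply: (@card_sub1 _ _ u).
  apply/subsetP=> v; rewrite !inE => /andP[vT /imsetP[k _ vk]].
  rewrite uj vk; apply/eqP; congr a2; subst u v.
  have [kN kT] := a2P k; have [jN jT] := a2P j.
  by apply: (dis _ _ (a2 k)) => //; rewrite (jT uT) -(kT vT).
- by move=> j; case: (a2P j).
- by move=> x; rewrite inE.
- move=> x _; rewrite occ_I0; split=> //; case: (boolP (x \in _)) => xZ; first exact: occ_inj.
  rewrite occ_eq0 // => j; apply: contraNneq xZ => <-; exact: imset_f.
- by move=> x _ _; rewrite occ_I0 orbT.
Qed.
End HubColours.

Lemma card_setI1 (T : finType) (A : {set T}) u : #|A :&: [set u]| = (u \in A).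
Proof.
case: (boolP (u \in A)) => uA; first by rewrite (setIidPr _) ?cards1 // sub1set.
by apply/eqP; rewrite cards_eq0 setI_eq0 disjoint_sym disjoints1.
Qed.

Lemma card_setI2 (T : finType) (A : {set T}) u v :
  #|A :&: [set u; v]| <= (u \in A) + (v \in A).
Proof. by rewrite setIUr -!card_setI1 (leq_card_setU _ _).1. Qed.

Lemma subset_card_eq (T : finType) (A B : {set T}) : A \subset B -> #|B| <= #|A| -> A = B.
Proof. by move=> AB BA; apply/eqP; rewrite eqEcard AB. Qed.

(** * Hub colours for class sizes (4,4,1) and (3,3,3) *)

Section HubColours2.
Variable C : finType.
Implicit Types I : finType.

(** Hall's condition can fail only for the full index set with a union of exactly [q] elements,
    which the last hypothesis excludes. *)
Lemma sdr_succ I (c0 : C) (M : I -> {set C}) q : (forall i, q <= #|M i|) -> #|I| <= q.+1 ->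
  (forall T : {set C}, #|T| <= q -> exists i, ~~ (M i \subset T)) ->
  exists a : I -> C, injective a /\ forall i, a i \in M i.
Proof.
move=> Mq Iq hM; apply: (hall c0) => J; have [->|/set0Pn[i iJ]] := eqVneq J set0.
  by rewrite cards0.
set U := \bigcup_(s in J) M s.
have Uq : q <= #|U|.
  by apply: leq_trans (Mq i) _; apply/subset_leq_card/bigcup_sup.
have Jm : #|J| <= #|I| := max_card _.
rewrite leqNgt; apply/negP=> JU.
have [|j /negP[]] := hM U; first by lia.
apply: bigcup_sup; suff -> : J = setT by rewrite inE.
by apply/eqP; rewrite eqEcard subsetT cardsT; lia.
Qed.

(** One colour [v] serves all legs of the constant class except [j0], which takes [y]. The other
    class of four loses [v] and may use [y] and [w] once each. Four legs leave five slots of [T0],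
    so [v], [y] and [w] must not be three different colours of [T0]. *)
Lemma hub_441_const I1 I2 (L : I1 -> {set C}) (N : I2 -> {set C}) (N0 M : {set C}) (j0 : I2) :
  #|I1| <= 4 -> #|I2| <= 4 -> (forall i, #|L i| = 3) -> #|N0| = 3 -> (forall j, N j = N0) ->
  #|M| = 3 -> hub_colourable L N (fun _ : 'I_1 => M).
Proof.
move=> I14 I24 L3 N3 NE M3; have [T0 [T03 hT _]] := majority L3.
have mT : occ L T0 <= 4 := leq_trans (occ_max L T0) I14.
have [v vN] : exists v, v \in N0 by apply/set0Pn; rewrite -card_gt0 N3.
have [y [w [yN wM yv wv hyw]]] : exists y w, [/\ y \in N0, w \in M, y != v, w != v &
    y = w \/ ~~ [&& v \in T0, y \in T0 & w \in T0]].
  have [w wM wv] : exists2 w, w \in M & w != v by apply: pick_notin1; rewrite M3.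
  have [y yN /andP[yv yw]] : exists2 y, y \in N0 & (y != v) && (y != w).
    by apply: pick_notin2; rewrite N3.
  case: (boolP [&& v \in T0, y \in T0 & w \in T0]) => [/and3P[vT yT wT]|h]; last first.
    by exists y, w; split=> //; right.
  have [y' y'N /andP[y'v y'y]] : exists2 y', y' \in N0 & (y' != v) && (y' != y).
    by apply: pick_notin2; rewrite N3.
  case: (eqVneq y' w) => [y'w|y'w]; first by exists y', w; split=> //; left.
  (* Now [y'] lies outside [T0], which already contains the three different colours [v], [y] and
     [w]. *)
  exists y', w; split=> //; right; apply/negP=> /and3P[_ y'T _].
  suff : #|[set y'; y; v; w]| <= 3.
    have vw : v != w by rewrite eq_sym.
    by rewrite -!setUA !cardsU1 cards1 !inE !negb_or y'y y'v y'w yv yw vw.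
  apply: leq_trans T03; apply/subset_leq_card/subsetP=> x.
  by rewrite !inE -!orbA => /or4P[] /eqP ->.
pose a2 j := if j == j0 then y else v.
have m2 x : occ a2 x <= if x == v then 3 else (x == y).
  case: eqP => [->|/eqP xv].
    apply: leq_trans (_ : #|[set~ j0]| <= _); last by rewrite cardsC1; lia.
    apply/subset_leq_card/subsetP=> l; rewrite !inE /a2; case: ifP => // _.
    by rewrite (negbTE yv).
  case: eqP => [->|/eqP xe].
    apply: (@card_sub1 _ _ j0); apply/subsetP=> l; rewrite !inE /a2.
    by case: ifP => // _; rewrite eq_sym (negbTE yv).
  by rewrite occ_eq0 // => l; rewrite /a2; case: ifP => _; rewrite eq_sym.
apply: (@hub_colourable_big _ _ _ _ L _ _ a2 (fun=> w) [set y; w] [set v] w) => //.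
- have c2 := card_set2_le y w.
  apply: (assign_with_few_caps v L3 hT I14); rewrite ?cards1; try lia.
  have := card_setI2 T0 y w; rewrite card_setI1.
  case: hyw => [<-|]; first by rewrite setUid card_setI1; case: (y \in T0); case: (v \in T0) => /=; lia.
  by case: (v \in T0); case: (y \in T0); case: (w \in T0) => //=; lia.
- by move=> j; rewrite NE /a2; case: ifP.
- move=> x; rewrite inE => /eqP ->; rewrite occ_const1 (negbTE wv) compatible0 //.
  by have := m2 v; rewrite eqxx.
- move=> x; rewrite !inE occ_const1 => xv; have := m2 x; rewrite (negbTE xv).
  by rewrite [w == x]eq_sym; case: (x == y); case: (x == w) => /=; lia.
- by move=> x xw _; rewrite occ_const1 [w == x]eq_sym (negbTE xw) orbT.
Qed.

(** Unless one class of four has constant lists, both have distinct representatives, and then every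
    colour occurs at most once per class. *)
Lemma hub_441 I1 I2 (L : I1 -> {set C}) (N : I2 -> {set C}) (M : {set C}) :
  #|I1| <= 4 -> #|I2| <= 4 -> 0 < #|I1| -> 0 < #|I2| ->
  (forall i, #|L i| = 3) -> (forall i, #|N i| = 3) ->
  #|M| = 3 -> hub_colourable L N (fun _ : 'I_1 => M).
Proof.
move=> I14 I24 /card_gt0P[i0 _] /card_gt0P[j0 _] L3 N3 M3.
have [w wM] : exists w, w \in M by apply/set0Pn; rewrite -card_gt0 M3.
have cst (I : finType) (K : I -> {set C}) : (forall i, #|K i| = 3) -> forall T : {set C}, #|T| <= 3 ->
    (forall i, K i \subset T) -> forall i, K i = T.
  by move=> K3 T T3 h i; apply: subset_card_eq; rewrite ?K3.
case: (boolP [exists T : {set C}, (#|T| <= 3) && [forall i, L i \subset T]]).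
  case/existsP=> T /andP[T3 /forallP LT]; have LE := cst _ _ L3 _ T3 LT.
  apply: hub_colourable_swap12; apply: (@hub_441_const _ _ _ _ T _ i0) => //.
  by rewrite -(LE i0) L3.
rewrite negb_exists => /forallP nL.
case: (boolP [exists T : {set C}, (#|T| <= 3) && [forall i, N i \subset T]]).
  case/existsP=> T /andP[T3 /forallP NT]; have NE := cst _ _ N3 _ T3 NT.
  apply: (@hub_441_const _ _ _ _ T _ j0) => //.
  by rewrite -(NE j0) N3.
rewrite negb_exists => /forallP nN.
have [a1 [a1i a1L]] : exists a : I1 -> C, injective a /\ forall i, a i \in L i.
  apply: (@sdr_succ _ w _ 3) => // [i|T T3]; first by rewrite L3.
  by have := nL T; rewrite T3 /= negb_forall => /existsP.
have [a2 [a2i a2L]] : exists a : I2 -> C, injective a /\ forall i, a i \in N i.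
  apply: (@sdr_succ _ w _ 3) => // [i|T T3]; first by rewrite N3.
  by have := nN T; rewrite T3 /= negb_forall => /existsP.
exists a1, a2, (fun=> w); split=> // [x|].
  by apply: compatible_le1; [exact: occ_inj | exact: occ_inj | rewrite occ_const1; case: eqP].
by exists w => x xw; rewrite occ_const1 [w == x]eq_sym (negbTE xw) !orbT.
Qed.

(** The first class uses only [c], which the other classes avoid. Either one of them has a second
    common colour [d], and the third avoids both, or both have distinct representatives without
    [c]. *)
Lemma hub_333_common I1 I2 I3 (L1 : I1 -> {set C}) (L2 : I2 -> {set C}) (L3 : I3 -> {set C}) c :
  #|I1| <= 3 -> #|I2| <= 3 -> #|I3| <= 3 ->
  (forall i, #|L2 i| = 3) -> (forall i, #|L3 i| = 3) ->
  (forall i, c \in L1 i) -> hub_colourable L1 L2 L3.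
Proof.
move=> s1 s2 s3 L23 L33 cL.
have small (I : finType) (a : I -> C) x : #|I| <= 3 -> occ a x <= 3.
  by move=> I3'; apply: leq_trans (occ_max _ _) I3'.
have two (J2 J3 : finType) (K2 : J2 -> {set C}) (K3 : J3 -> {set C}) d : #|J2| <= 3 -> #|J3| <= 3 ->
    (forall i, #|K3 i| = 3) -> d != c -> (forall i, d \in K2 i) -> hub_colourable L1 K2 K3.
  move=> t2 t3 K33 dc dK.
  have [a3 a3P] : exists a3 : J3 -> C, forall i, a3 i \in K3 i /\ (a3 i != c) && (a3 i != d).
    apply: (fin_all_exists (P := fun j u => u \in K3 j /\ (u != c) && (u != d))) => j.
    by have [|x] := @pick_notin2 _ (K3 j) c d; rewrite ?K33 //; exists x.
  have a3L i : a3 i \in K3 i by case: (a3P i).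
  have a3c : occ a3 c = 0 by apply: occ_eq0 => i; case: (a3P i) => _ /andP[].
  have a3d : occ a3 d = 0 by apply: occ_eq0 => i; case: (a3P i) => _ /andP[].
  exists (fun=> c), (fun=> d), a3; split=> // [x|].
    case: (eqVneq x c) => [->|xc].
      by rewrite a3c [occ (fun=> d) c]occ_eq0 // /compatible small //= implybT.
    rewrite [occ (fun=> c) x]occ_eq0; last by move=> i; rewrite eq_sym.
    case: (eqVneq x d) => [->|xd]; first by rewrite a3d compatible0 // small.
    rewrite [occ (fun=> d) x]occ_eq0; last by move=> i; rewrite eq_sym.
    by rewrite /compatible small //= !implybT.
  exists c => x xc; rewrite [occ (fun=> c) x]occ_eq0 // => i; by rewrite eq_sym.
case: (boolP [exists d, (d != c) && [forall i, d \in L2 i]]).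
  by case/existsP=> d /andP[dc /forallP]; apply: two.
rewrite negb_exists => /forallP n2.
case: (boolP [exists d, (d != c) && [forall i, d \in L3 i]]).
  by case/existsP=> d /andP[dc /forallP h]; apply: hub_colourable_swap23; apply: two h.
rewrite negb_exists => /forallP n3.
have sdr (J : finType) (K : J -> {set C}) : #|J| <= 3 -> (forall i, #|K i| = 3) ->
    (forall d, ~~ ((d != c) && [forall i, d \in K i])) ->
    exists a : J -> C, injective a /\ forall i, a i \in K i :\ c.
  move=> J3 K3 nK; case: (posnP #|J|) => [J0|/card_gt0P[j0 _]].
    have no (i : J) : False by have := max_card (pred1 i); rewrite J0 card1.
    by exists (fun=> c); split=> [i|i]; case: (no i).
  apply: (@sdr_succ _ c _ 2) => // [i|T T2].
    by have := cardsD1 c (K i); rewrite K3; case: (c \in K i); lia.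
  apply/existsP; rewrite -negb_forall; apply/negP=> /forallP hT.
  (* Lists that keep at least two colours without [c] and lie in a two-element set are all equal to
     it, which would give a common colour other than [c]. *)
  have KT i : K i :\ c = T.
    apply: subset_card_eq => //; apply: leq_trans T2 _.
    by have := cardsD1 c (K i); rewrite K3; case: (c \in K i); lia.
  have [|d dK] := @pick_notin1 _ (K j0) c; first by rewrite K3.
  move=> dc; have := nK d; rewrite dc /= negb_forall => /existsP[i] /negP[].
  have : d \in K i :\ c by rewrite KT -(KT j0) !inE dc.
  by rewrite inE => /andP[].
have [a2 [a2i a2L]] := sdr _ _ s2 L23 n2; have [a3 [a3i a3L]] := sdr _ _ s3 L33 n3.
have nc (J : finType) (a : J -> C) (K : J -> {set C}) : (forall i, a i \in K i :\ c) -> occ a c = 0.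
  by move=> h; apply: occ_eq0 => i; have := h i; rewrite !inE => /andP[].
exists (fun=> c), a2, a3; split=> // [i|i|x|].
- by have := a2L i; rewrite inE => /andP[].
- by have := a3L i; rewrite inE => /andP[].
- case: (eqVneq x c) => [->|xc].
    by rewrite (nc _ _ _ a2L) (nc _ _ _ a3L) /compatible small //= implybT.
  rewrite [occ (fun=> c) x]occ_eq0; last by move=> i; rewrite eq_sym.
  by rewrite compatible_le1 ?occ_inj.
by exists c => x xc; rewrite [occ (fun=> c) x]occ_eq0 // => i; rewrite eq_sym.
Qed.

(** If every leg of the first class that admits [c] gets it, at most one leg has another colour. The
    other classes have distinct representatives avoiding [c], so the colour of that one leg is the
    only one that may occur in all classes. *)
Lemma hub_333_pair I1 I2 I3 (L1 : I1 -> {set C}) (L2 : I2 -> {set C}) (L3 : I3 -> {set C}) c i j :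
  #|I1| <= 3 -> #|I2| <= 3 -> #|I3| <= 3 ->
  (forall i, #|L1 i| = 3) -> (forall i, #|L2 i| = 3) -> (forall i, #|L3 i| = 3) ->
  (forall d, exists i, d \notin L2 i) -> (forall d, exists i, d \notin L3 i) ->
  i != j -> c \in L1 i -> c \in L1 j -> hub_colourable L1 L2 L3.
Proof.
move=> s1 s2 s3 L13 L23 L33 n2 n3 ij ci cj.
have sdr (J : finType) (K : J -> {set C}) : #|J| <= 3 -> (forall i, #|K i| = 3) ->
    (forall d, exists i, d \notin K i) ->
    exists a : J -> C, injective a /\ forall i, a i \in K i :\ c.
  move=> J3 K3 nK; have K2 k : 2 <= #|K k :\ c|.
    by have := cardsD1 c (K k); rewrite K3; case: (c \in K k); lia.
  apply: (@sdr_succ _ c _ 2) => // T T2.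
  apply/existsP; rewrite -negb_forall; apply/negP=> /forallP hT.
  have KT k : K k :\ c = T by apply: subset_card_eq => //; apply: leq_trans T2 (K2 k).
  have [j0 _] := nK c; have [|d dK dc] := @pick_notin1 _ (K j0) c; first by rewrite K3.
  have [k /negP[]] := nK d; have : d \in K k :\ c by rewrite KT -(KT j0) !inE dc.
  by rewrite inE => /andP[].
have [a2 [a2i a2L]] := sdr _ _ s2 L23 n2; have [a3 [a3i a3L]] := sdr _ _ s3 L33 n3.
have nc (J : finType) (a : J -> C) (K : J -> {set C}) : (forall i, a i \in K i :\ c) -> occ a c = 0.
  by move=> h; apply: occ_eq0 => k; have := h k; rewrite !inE => /andP[].
have [a1 a1P] : exists a1 : I1 -> C, forall k, a1 k \in L1 k /\ (c \in L1 k -> a1 k = c).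
  apply: (fin_all_exists (P := fun k u => u \in L1 k /\ (c \in L1 k -> u = c))) => k.
  case: (boolP (c \in L1 k)) => ck; first by exists c.
  by have /card_gt0P[u uL] : 0 < #|L1 k| by [rewrite L13]; exists u.
have a1k k l : a1 k != c -> a1 l != c -> k = l.
  have h m : a1 m != c -> m != i /\ m != j.
    by move=> mc; split; apply: contraNneq mc => ->; [have [_ ->] := a1P i | have [_ ->] := a1P j].
  move=> /h[ki kj] /h[li lj]; apply/eqP; apply: contraT => kl.
  suff : 4 <= #|I1| by lia.
  have <- : #|[set i; j; k; l]| = 4.
    rewrite -!setUA !cardsU1 cards1 !inE !negb_or ij [i == k]eq_sym ki [i == l]eq_sym li.
    by rewrite [j == k]eq_sym kj [j == l]eq_sym lj kl.
  exact: max_card.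
exists a1, a2, a3; split=> // [k|k|k|x|].
- by case: (a1P k).
- by have := a2L k; rewrite inE => /andP[].
- by have := a3L k; rewrite inE => /andP[].
- case: (eqVneq x c) => [->|xc].
    rewrite (nc _ _ _ a2L) (nc _ _ _ a3L) /compatible /= implybT !andbT.
    exact: leq_trans (occ_max _ _) s1.
  apply: compatible_le1; [|exact: occ_inj|exact: occ_inj].
  case: (set_0Vmem [set k | a1 k == x]) => [h|[k]]; first by rewrite /occ h cards0.
  rewrite inE => /eqP kx; apply: (@card_sub1 _ _ k); apply/subsetP=> l.
  by rewrite !inE => /eqP lx; apply/eqP/a1k; rewrite ?lx ?kx.
case: (boolP [exists k, a1 k != c]) => [/existsP[k kc]|].
  exists (a1 k) => x xk; case: (eqVneq x c) => [->|xc].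
    by rewrite (nc _ _ _ a2L) orbT.
  rewrite occ_eq0 // => l; apply/eqP=> lx.
  by case/eqP: xk; rewrite -lx; congr a1; apply: a1k => //; rewrite lx.
rewrite negb_exists => /forallP h; exists c => x xc; rewrite occ_eq0 // => l.
by have := h l; rewrite negbK => /eqP ->; rewrite eq_sym.
Qed.

Lemma hub_333 I1 I2 I3 (L1 : I1 -> {set C}) (L2 : I2 -> {set C}) (L3 : I3 -> {set C}) :
  #|I1| <= 3 -> #|I2| <= 3 -> #|I3| <= 3 -> 0 < #|I1| ->
  (forall i, #|L1 i| = 3) -> (forall i, #|L2 i| = 3) -> (forall i, #|L3 i| = 3) ->
  hub_colourable L1 L2 L3.
Proof.
move=> s1 s2 s3 /card_gt0P[i0 _] L13 L23 L33.
pose common (I : finType) (L : I -> {set C}) := [exists c, forall i, c \in L i].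
have notcommon (I : finType) (L : I -> {set C}) : ~~ common I L -> forall d, exists i, d \notin L i.
  by rewrite negb_exists => /forallP h d; have := h d; rewrite negb_forall => /existsP.
case: (boolP (common _ L1)) => [/existsP[c /forallP h]|/notcommon n1].
  exact: hub_333_common h.
case: (boolP (common _ L2)) => [/existsP[c /forallP h]|/notcommon n2].
  by apply: hub_colourable_swap12; apply: hub_333_common h.
case: (boolP (common _ L3)) => [/existsP[c /forallP h]|/notcommon n3].
  by apply: hub_colourable_swap23; apply: hub_colourable_swap12; apply: hub_333_common h.
pose meet (I : finType) (L : I -> {set C}) := [exists c, exists i, exists j, [&& i != j, c \in L i & c \in L j]].
have disj (I : finType) (L : I -> {set C}) : ~~ meet I L ->
    forall c i j, c \in L i -> c \in L j -> i = j.
  rewrite negb_exists => /forallP h c i j ci cj; apply/eqP; apply: contraT => ij.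
  have := h c; rewrite negb_exists => /forallP/(_ i); rewrite negb_exists => /forallP/(_ j).
  by rewrite ij ci cj.
case: (boolP (meet _ L1)) => [/existsP[c /existsP[i /existsP[j /and3P[ij ci cj]]]]|/disj d1].
  exact: (hub_333_pair s1 s2 s3 _ _ _ _ _ ij ci cj).
case: (boolP (meet _ L2)) => [/existsP[c /existsP[i /existsP[j /and3P[ij ci cj]]]]|/disj d2].
  by apply: hub_colourable_swap12; apply: (hub_333_pair s2 s1 s3 _ _ _ _ _ ij ci cj).
case: (boolP (meet _ L3)) => [/existsP[c /existsP[i /existsP[j /and3P[ij ci cj]]]]|/disj d3].
  apply: hub_colourable_swap23; apply: hub_colourable_swap12.
  by apply: (hub_333_pair s3 s1 s2 _ _ _ _ _ ij ci cj).
have pick_any (I : finType) (L : I -> {set C}) : (forall i, #|L i| = 3) ->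
    exists a : I -> C, forall i, a i \in L i.
  move=> L_3; apply: (fin_all_exists (P := fun i u => u \in L i)) => i.
  by apply/card_gt0P; rewrite L_3.
have inj (I : finType) (L : I -> {set C}) (a : I -> C) : (forall c i j, c \in L i -> c \in L j -> i = j) ->
    (forall i, a i \in L i) -> injective a.
  by move=> d aL i j E; apply: (d (a i)) => //; rewrite E.
have [a1 a1L] := pick_any _ _ L13; have [a3 a3L] := pick_any _ _ L33.
(* The lists within each class are now disjoint, so every choice is injective. At most one list of
   the second class equals [A], hence [a2] meets [A] in at most one colour. *)
pose A := [set a1 i | i in [set: I1]].
have A3 : #|A| <= 3 by rewrite (leq_trans (leq_imset_card _ _)) // cardsT.
have [a2 a2P] : exists a2 : I2 -> C, forall j, a2 j \in L2 j /\ (a2 j \in A -> L2 j = A).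
  apply: (fin_all_exists (P := fun j u => u \in L2 j /\ (u \in A -> L2 j = A))) => j.
  by have [||x] := @pick_avoid _ (L2 j) A; rewrite ?L23 //; exists x.
have a2L j : a2 j \in L2 j by case: (a2P j).
have a1i := inj _ _ _ d1 a1L; have a2i := inj _ _ _ d2 a2L; have a3i := inj _ _ _ d3 a3L.
exists a1, a2, a3; split=> // [x|]; first by apply: compatible_le1; apply: occ_inj.
have out x : x \notin A -> occ a1 x = 0.
  by move=> xA; apply: occ_eq0 => i; apply: contraNneq xA => <-; apply: imset_f.
case: (boolP [exists j, a2 j \in A]) => [/existsP[j jA]|].
  exists (a2 j) => x xj; case: (boolP (x \in A)) => [xA|/out -> //].
  rewrite [occ a2 x]occ_eq0 ?orbT // => k; apply/eqP=> kx.
  case/eqP: xj; rewrite -kx; congr a2; have [kL kA] := a2P k; have [jL jA'] := a2P j.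
  by apply: (d2 (a2 k)) => //; rewrite (jA' jA) -kA // kx.
rewrite negb_exists => /forallP h; exists (a1 i0) => x _.
case: (boolP (x \in A)) => [xA|/out -> //]; rewrite [occ a2 x]occ_eq0 ?orbT // => k.
by apply: contraNneq (h k) => ->.
Qed.
End HubColours2.

(** * Hub colours for class sizes (5,2,2) *)

Definition mk2 (T : Type) (u v : T) (i : 'I_2) : T := if i == ord0 then u else v.

Section Hub522.
Variable C : finType.

Lemma occ_mk2 (u v x : C) : occ (mk2 u v) x = (u == x) + (v == x).
Proof. by rewrite occE !big_ord_recl big_ord0 addn0. Qed.

Lemma mk2_in (u v : C) (Y0 Y1 : {set C}) : u \in Y0 -> v \in Y1 ->
  forall i, mk2 u v i \in mk2 Y0 Y1 i.
Proof. by move=> uY vY i; rewrite /mk2; case: ifP. Qed.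

Lemma hub_swap_mk2 (I1 I3 : finType) (L1 : I1 -> {set C}) (Y0 Y1 : {set C}) (L3 : I3 -> {set C}) :
  hub_colourable L1 (mk2 Y1 Y0) L3 -> hub_colourable L1 (mk2 Y0 Y1) L3.
Proof.
case=> a1 [a2 [a3 [h1 h2 h3 hc [w hw]]]].
have E x : occ (mk2 (a2 (lift ord0 ord0)) (a2 ord0)) x = occ a2 x.
  by rewrite occ_mk2 occE !big_ord_recl big_ord0 addn0 addnC.
exists a1, (mk2 (a2 (lift ord0 ord0)) (a2 ord0)), a3; split=> // [|x|].
- by apply: mk2_in; [have := h2 (lift ord0 ord0) | have := h2 ord0].
- by rewrite E.
by exists w => x; rewrite E; apply: hw.
Qed.

Variables (I : finType) (L : I -> {set C}) (T0 : {set C}).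
Hypotheses (I5 : #|I| <= 5) (L3 : forall i, #|L i| = 3) (T03 : #|T0| <= 3).
Hypothesis T0L : 0 < #|I| -> exists i, L i = T0.
Hypothesis hT : forall A, A != T0 -> 2 * occ L A <= #|I|.

Let notsub (Y : {set C}) : #|Y| = 3 -> Y != T0 -> exists2 y, y \in Y & y \notin T0.
Proof.
move=> Y3 YT; apply/subsetPn; apply: contra YT => /subset_card_eq ->; first exact: eqxx.
by rewrite Y3.
Qed.

(** The common colour [w] serves one leg in each small class, and [w], [y], [z] are capped in the
    large one. Five legs and two capped colours fill the nine slots of [T0], so one of the three has
    to lie outside it. *)
Lemma hub_522_shared (Y0 Y1 Z0 Z1 : {set C}) w : #|Y1| = 3 -> #|Z1| = 3 ->
  w \in Y0 -> w \in Z0 -> (Y1 != T0) || (Z1 != T0) ->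
  hub_colourable L (mk2 Y0 Y1) (mk2 Z0 Z1).
Proof.
move=> Y13 Z13 wY wZ hYZ; have mT : occ L T0 <= 5 := leq_trans (occ_max L T0) I5.
have [y [z [yY zZ yw zw [yz hyz]]]] : exists y z, [/\ y \in Y1, z \in Z1, y != w, z != w &
    y != z /\ ~~ [&& w \in T0, y \in T0 & z \in T0]].
  case: (boolP (w \in T0)) => wT /=; last first.
    have [|y yY yw] := @pick_notin1 _ Y1 w; first by rewrite Y13.
    have [|z zZ /andP[zw zy]] := @pick_notin2 _ Z1 w y; first by rewrite Z13.
    by exists y, z; split=> //; rewrite eq_sym.
  case/orP: hYZ => [/(notsub Y13)|/(notsub Z13)] [u uY uT].
    have uw : u != w by apply: contraNneq uT => ->.
    have [|z zZ /andP[zw zu]] := @pick_notin2 _ Z1 w u; first by rewrite Z13.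
    by exists u, z; split=> //; rewrite eq_sym zu (negbTE uT).
  have uw : u != w by apply: contraNneq uT => ->.
  have [|y yY /andP[yw yu]] := @pick_notin2 _ Y1 w u; first by rewrite Y13.
  by exists y, u; split=> //; rewrite yu (negbTE uT) andbF.
apply: (@hub_colourable_big _ _ _ _ L _ _ (mk2 w y) (mk2 w z) (w |: [set y; z]) set0 w).
- have c3 : #|w |: [set y; z]| <= 3.
    by rewrite (leq_trans (leq_card_setU _ _).1) // cards1 add1n ltnS card_set2_le.
  apply: (assign_with_few_caps w L3 hT I5); rewrite ?setI0 ?cards0;
    try by move: c3; clear; lia.
  have : #|T0 :&: (w |: [set y; z])| <= (w \in T0) + ((y \in T0) + (z \in T0)).
    by rewrite setIUr (leq_trans (leq_card_setU _ _).1) // card_setI1 leq_add2l card_setI2.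
  by move: hyz mT; case: (w \in T0); case: (y \in T0); case: (z \in T0) => //=; clear; lia.
- exact: mk2_in.
- exact: mk2_in.
- by move=> x; rewrite inE.
- move=> x _; rewrite !occ_mk2 !inE ![_ == x]eq_sym.
  case: (eqVneq x w) => [->|xw] /=; last by case: (x == y); case: (x == z).
  by rewrite [w == y]eq_sym (negbTE yw) [w == z]eq_sym (negbTE zw).
- move=> x xw _; rewrite !occ_mk2 ![_ == x]eq_sym (negbTE xw) /=.
  by case: (eqVneq x y) => [->|//]; rewrite (negbTE yz) orbT.
Qed.

(** The legs with lists [Y0] and [Y1] get colours outside [T0]. If these differ, four colours are
    capped, which exceeds what [assign_with_few_caps] can handle, and Hall's condition is checked
    directly. *)
Lemma hub_522_disjoint (Y0 Y1 Z0 Z1 : {set C}) : #|Y0| = 3 -> #|Y1| = 3 -> #|Z0| = 3 -> #|Z1| = 3 ->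
  (forall x, x \in Y0 :|: Y1 -> x \notin Z0 :|: Z1) -> Y0 != T0 -> Y1 != T0 ->
  hub_colourable L (mk2 Y0 Y1) (mk2 Z0 Z1).
Proof.
move=> Y03 Y13 Z03 Z13 dYZ /(notsub Y03)[y0 y0Y y0T] /(notsub Y13)[y1 y1Y y1T].
have mT : occ L T0 <= 5 := leq_trans (occ_max L T0) I5.
have [z0 z0Z] : exists z, z \in Z0 by apply/set0Pn; rewrite -card_gt0 Z03.
have [|z1 z1Z z10] := @pick_notin1 _ Z1 z0; first by rewrite Z13.
have d y z : y \in Y0 :|: Y1 -> z \in Z0 :|: Z1 -> y != z.
  by move=> /dYZ yZ zZ; apply: contraNneq yZ => ->.
have d00 : y0 != z0 by apply: d; rewrite inE ?y0Y ?z0Z.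
have d01 : y0 != z1 by apply: d; rewrite inE ?y0Y ?z1Z ?orbT.
have d10 : y1 != z0 by apply: d; rewrite inE ?y1Y ?z0Z ?orbT.
have d11 : y1 != z1 by apply: d; rewrite inE ?y1Y ?z1Z ?orbT.
have cz := card_set2_le z0 z1.
have cTz : #|T0 :&: [set z0; z1]| <= #|[set z0; z1]| by apply/subset_leq_card/subsetIr.
case: (eqVneq y0 y1) => [E|y01].
  subst y1.
  apply: (@hub_colourable_big _ _ _ _ L _ _ (mk2 y0 y0) (mk2 z0 z1) [set z0; z1] [set y0] y0).
  - apply: (assign_with_few_caps y0 L3 hT I5); rewrite ?cards1 ?card_setI1 ?(negbTE y0T) /=;
    by move: cz cTz mT; clear; lia.
  - exact: mk2_in.
  - exact: mk2_in.
  - move=> x; rewrite inE => /eqP ->; rewrite !occ_mk2 eqxx ![_ == y0]eq_sym.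
    by rewrite (negbTE d00) (negbTE d01).
  - move=> x; rewrite !inE => xy; rewrite !occ_mk2 [y0 == x]eq_sym (negbTE xy).
    rewrite [z0 == x]eq_sym [z1 == x]eq_sym.
    by split=> //; case: (eqVneq x z0) => [->|//]; rewrite eq_sym (negbTE z10).
  - by move=> x xy _; rewrite !occ_mk2 [y0 == x]eq_sym (negbTE xy).
pose W := [set y0; y1] :|: [set z0; z1].
have cy := card_set2_le y0 y1.
have cW : #|W| <= 4 by apply: leq_trans (leq_card_setU _ _).1 (leq_add cy cz).
have TW : #|T0 :&: W| <= 2.
  apply: leq_trans cz; apply/subset_leq_card/subsetP=> x; rewrite !inE -!orbA.
  by case/andP=> xT /or4P[/eqP xE|/eqP xE|->|->]; rewrite ?orbT //; move: xT; rewrite xE ?(negbTE y0T) ?(negbTE y1T).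
apply: (@hub_colourable_big _ _ _ _ L _ _ (mk2 y0 y1) (mk2 z0 z1) W set0 y0).
- apply: (assign_with_caps y0) => J J0 /=; set U := \bigcup_(s in J) L s.
  have [U3 U4] : 3 <= #|U| /\ (#|U| = 3 -> #|J| <= occ L U) := bigcup_lists L3 J0.
  have Jm : #|J| <= 5 := leq_trans (max_card _) I5.
  have UW : #|U :&: W| <= #|W| by apply/subset_leq_card/subsetIr.
  have UWU : #|U :&: W| <= #|U| by apply/subset_leq_card/subsetIl.
  rewrite setI0 cards0 muln0 addn0.
  case: (leqP #|U| 3) => U3'.
    have E : #|U| = 3 by apply/eqP; rewrite eqn_leq U3'.
    have {}U4 := U4 E; case: (eqVneq U T0) => [UT|/hT hU].
      by rewrite E UT; rewrite UT in U4; move: U4 mT TW; clear; lia.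
    by have {}hU := leq_trans hU I5; move: U4 E hU UWU; clear; lia.
  case: (leqP 5 #|U|) => U5; first by move: Jm UW cW U5; clear; lia.
  case: (leqP #|J| 4) => J4; first by move: J4 UW cW U3'; clear; lia.
  suff : #|U :&: W| <= 3 by move: Jm U3'; clear; lia.
  (* Here [J] is the whole class, so [U] would contain [T0] together with [y0] and [y1], which makes
     five colours. *)
  rewrite leqNgt; apply/negP=> UW4.
  have WU : W \subset U.
    have -> : W = U :&: W by apply/esym; apply: subset_card_eq (subsetIr _ _) (leq_trans cW UW4).
    exact: subsetIl.
  have JT : J = setT by apply/eqP; rewrite eqEcard subsetT cardsT (leq_trans I5).
  have [|i Li] := T0L; first by apply: leq_trans (max_card (mem J)); apply: leq_trans J4.
  have TU : T0 \subset U by rewrite -Li; apply: bigcup_sup; rewrite JT inE.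
  suff : 5 <= #|U| by rewrite leqNgt U5.
  have <- : #|y0 |: (y1 |: T0)| = 5.
    by rewrite !cardsU1 !inE negb_or y01 y0T y1T -Li L3.
  apply/subset_leq_card; rewrite !subUset !sub1set TU andbT.
  by apply/andP; split; apply: (subsetP WU); rewrite !inE eqxx ?orbT.
- exact: mk2_in.
- exact: mk2_in.
- by move=> x; rewrite inE.
- move=> x _; rewrite !occ_mk2 !inE ![_ == x]eq_sym -orbA.
  case: (eqVneq x y0) => [->|x0] /=; first by rewrite (negbTE y01) (negbTE d00) (negbTE d01).
  case: (eqVneq x y1) => [->|x1] /=; first by rewrite (negbTE d10) (negbTE d11).
  by case: (eqVneq x z0) => [->|_] /=; [rewrite eq_sym (negbTE z10) | case: (x == z1)].
- move=> x x0 _; rewrite !occ_mk2 ![_ == x]eq_sym (negbTE x0) /=.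
  by case: (eqVneq x y1) => [->|//]; rewrite (negbTE d10) (negbTE d11) orbT.
Qed.

(** Both small classes use [w] and [v]. The large class may use [w] once and [v] never, so only [w]
    can occur in three classes. This costs five slots of [T0], whence the bound 4. *)
Lemma hub_522_const : #|T0| = 3 -> occ L T0 <= 4 ->
  hub_colourable L (mk2 T0 T0) (mk2 T0 T0).
Proof.
move=> T3 m4.
have [w wT] : exists z, z \in T0 by apply/set0Pn; rewrite -card_gt0 T3.
have [|v vT vw] := @pick_notin1 _ T0 w; first by rewrite T3.
apply: (@hub_colourable_big _ _ _ _ L _ _ (mk2 w v) (mk2 w v) [set w] [set v] w).
- by apply: (assign_with_few_caps w L3 hT I5); rewrite ?cards1 ?card_setI1 ?wT ?vT /=; lia.
- exact: mk2_in.
- exact: mk2_in.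
- move=> x; rewrite inE => /eqP ->; rewrite !occ_mk2 eqxx eq_sym (negbTE vw).
  by [].
- move=> x; rewrite !inE => xv; rewrite !occ_mk2 [v == x]eq_sym (negbTE xv).
  by rewrite addn0 eq_sym.
- move=> x xw; rewrite inE => xv; rewrite !occ_mk2 [v == x]eq_sym (negbTE xv).
  by rewrite [w == x]eq_sym (negbTE xw).
Qed.

(** By symmetry, a colour common to a [Y] and a [Z] list may be taken from the first lists. Nothing
    works only if all lists equal [T0], when five legs and the five slots of [hub_522_const] would
    exceed nine. *)
Lemma hub_522 (Y0 Y1 Z0 Z1 : {set C}) : #|Y0| = 3 -> #|Y1| = 3 -> #|Z0| = 3 -> #|Z1| = 3 ->
  hub_colourable L (mk2 Y0 Y1) (mk2 Z0 Z1) \/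
  [/\ forall i, L i = T0, Y0 = T0, Y1 = T0, Z0 = T0 & Z1 = T0].
Proof.
move=> Y03 Y13 Z03 Z13.
have share (A0 A1 B0 B1 : {set C}) w : #|A0| = 3 -> #|A1| = 3 -> #|B0| = 3 -> #|B1| = 3 ->
    w \in A0 -> w \in B0 -> hub_colourable L (mk2 A0 A1) (mk2 B0 B1) \/
    [/\ forall i, L i = T0, A0 = T0, A1 = T0, B0 = T0 & B1 = T0].
  move=> A03 A13 B03 B13 wA wB.
  case: (boolP ((A1 != T0) || (B1 != T0))) => h; first by left; apply: (@hub_522_shared _ _ _ _ w).
  move: h; rewrite negb_or !negbK => /andP[/eqP A1E /eqP B1E].
  have [v vT] : exists z, z \in T0 by apply/set0Pn; rewrite -card_gt0 -A1E A13.
  case: (boolP ((A0 != T0) || (B0 != T0))) => h.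
    left; apply/hub_swap_mk2/hub_colourable_swap23/hub_swap_mk2/hub_colourable_swap23.
    by apply: (@hub_522_shared _ _ _ _ v) => //; rewrite ?A1E ?B1E.
  move: h; rewrite negb_or !negbK => /andP[/eqP A0E /eqP B0E].
  case: (leqP (occ L T0) 4) => m4.
    by left; rewrite A0E A1E B0E B1E; apply: hub_522_const => //; rewrite -A1E.
  right; split=> // i; have : [set i | L i == T0] = setT.
    by apply/eqP; rewrite eqEcard subsetT cardsT /=; exact: leq_trans I5 m4.
  by move/setP/(_ i); rewrite !inE => /eqP.
case: (set_0Vmem (Y0 :&: Z0)) => [e00|[w]]; last by rewrite inE => /andP[]; apply: share.
case: (set_0Vmem (Y1 :&: Z0)) => [e10|[w]]; last first.
  rewrite inE => /andP[w1 w0]; have [h|[? ? ? ? ?]] := share Y1 Y0 Z0 Z1 w Y13 Y03 Z03 Z13 w1 w0.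
    by left; apply: hub_swap_mk2.
  by right; split.
case: (set_0Vmem (Y0 :&: Z1)) => [e01|[w]]; last first.
  rewrite inE => /andP[w1 w0]; have [h|[? ? ? ? ?]] := share Y0 Y1 Z1 Z0 w Y03 Y13 Z13 Z03 w1 w0.
    by left; apply/hub_colourable_swap23/hub_swap_mk2/hub_colourable_swap23.
  by right; split.
case: (set_0Vmem (Y1 :&: Z1)) => [e11|[w]]; last first.
  rewrite inE => /andP[w1 w0]; have [h|[? ? ? ? ?]] := share Y1 Y0 Z1 Z0 w Y13 Y03 Z13 Z03 w1 w0.
    by left; apply/hub_swap_mk2/hub_colourable_swap23/hub_swap_mk2/hub_colourable_swap23.
  by right; split.
left; have dis x : x \in Y0 :|: Y1 -> x \notin Z0 :|: Z1.
  rewrite !inE negb_or => /orP[xY|xY]; apply/andP; split; apply/negP=> xZ.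
  - by have := in_set0 x; rewrite -e00 inE xY xZ.
  - by have := in_set0 x; rewrite -e01 inE xY xZ.
  - by have := in_set0 x; rewrite -e10 inE xY xZ.
  - by have := in_set0 x; rewrite -e11 inE xY xZ.
case: (boolP ((Y0 != T0) && (Y1 != T0))) => [/andP[h0 h1]|h].
  exact: hub_522_disjoint.
(* One of [Y0], [Y1] is [T0]; by disjointness neither [Z0] nor [Z1] is, so the roles are
   exchanged. *)
apply: hub_colourable_swap23; apply: hub_522_disjoint => //.
- by move=> x; apply: contraL => /dis.
- apply: contra h => /eqP Z0E; apply/andP; split; apply/eqP=> YE.
  + by have := cards0 C; rewrite -e00 YE Z0E setIid -Z0E Z03.
  + by have := cards0 C; rewrite -e10 YE Z0E setIid -Z0E Z03.
- apply: contra h => /eqP Z0E; apply/andP; split; apply/eqP=> YE.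
  + by have := cards0 C; rewrite -e01 YE Z0E setIid -Z0E Z13.
  + by have := cards0 C; rewrite -e11 YE Z0E setIid -Z0E Z13.
Qed.
End Hub522.

Lemma third_ord (k l m m' : 'I_3) : k != l -> m != k -> m != l -> m' != k -> m' != l -> m' = m.
Proof.
move=> kl mk ml m'k m'l; apply/val_inj; move: kl mk ml m'k m'l; rewrite -!val_eqE.
by case: k => -[|[|[|//]]] ?; case: l => -[|[|[|//]]] ?; case: m => -[|[|[|//]]] ?;
   case: m' => -[|[|[|//]]] ?.
Qed.

(** * Colouring the tip edges: three classes of legs *)

Section Good3.
Variables (C S : finType) (cls : S -> 'I_3).

(* [t k] is the colour of the edge joining the two tips other than tip [k]. *)
Definition good3 (a b : S -> C) (t : 'I_3 -> C) : Prop :=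
  [/\ injective t,
      forall s s', cls s = cls s' -> a s = a s' -> b s = b s' -> s = s' &
      forall s s' k, cls s != cls s' -> a s = a s' -> k != cls s -> k != cls s' ->
        b s != b s' /\ b s != t k].

Variables (LA LB : S -> {set C}) (LT : 'I_3 -> {set C}).
Hypotheses (LB3 : forall s, #|LB s| = 3) (LT3 : forall k, #|LT k| = 3).

Definition occ_in (a : S -> C) (k : 'I_3) (x : C) := #|[set s | (cls s == k) && (a s == x)]|.

Lemma occ_in_uniq (a : S -> C) s s' : occ_in a (cls s) (a s) <= 1 ->
  cls s' = cls s -> a s' = a s -> s' = s.
Proof.
move=> h cE aE; apply/eqP; apply: contraLR h => ss'; rewrite -ltnNge.
have : #|[set s'; s]| = 2 by rewrite cards2 ss'.
move=> <-; apply/subset_leq_card/subsetP=> u; rewrite !inE => /orP[] /eqP ->; by rewrite ?cE ?aE !eqxx.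
Qed.

Lemma occ_in_gt0 (a : S -> C) s : 0 < occ_in a (cls s) (a s).
Proof. by apply/card_gt0P; exists s; rewrite inE !eqxx. Qed.

Lemma occ_in_eq0 (a : S -> C) k x s : occ_in a k x = 0 -> a s = x -> cls s != k.
Proof.
by move=> h aE; apply/eqP=> ck; move: (occ_in_gt0 a s); rewrite ck aE h.
Qed.

(** Legs whose hub colour occurs in all classes have colour [w], one leg per class, and are coloured
    together with the edges between tips as an octahedron. The other legs follow greedily. *)
Lemma good3_of_hub (a : S -> C) (w : C) :
  (forall k x, occ_in a k x <= 3) ->
  (forall k l x, k != l -> 1 < occ_in a k x -> occ_in a l x = 0) ->
  (forall x, x != w -> exists k, occ_in a k x = 0) ->
  exists b t, [/\ forall s, b s \in LB s, forall k, t k \in LT k & good3 a b t].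
Proof.
move=> c1 c2 cw.
pose D0 := [set s | [forall k, 0 < occ_in a k (a s)]].
have D0w s : s \in D0 -> a s = w.
  rewrite inE => /forallP h; apply/eqP; apply: contraT => /cw[k k0].
  by have := h k; rewrite k0.
have D01 s k : s \in D0 -> occ_in a k (a s) <= 1.
  rewrite inE leqNgt => /forallP h; apply/negP=> k1.
  have [l lk] : exists l : 'I_3, k != l.
    by case: (eqVneq k ord0) => [->|]; [exists ord_max | exists ord0].
  by have := h l; rewrite (c2 _ _ _ lk k1).
(* If class [k] has no leg in [D0], the list [LT k] fills the vacant vertex of the octahedron. *)
pose P k := if [pick s | (s \in D0) && (cls s == k)] is Some s then LB s else LT k.
have P3 k : #|P k| = 3 by rewrite /P; case: pickP.
have PD s : s \in D0 -> P (cls s) = LB s.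
  move=> sD; rewrite /P; case: pickP => [u /andP[uD /eqP uc]|/(_ s)]; last by rewrite sD eqxx.
  by congr LB; apply: (occ_in_uniq (a := a)) => //; [apply: D01 | rewrite !D0w].
have [t [p [tL pP ti pi tp]]] := octahedron_choosable LT3 P3.
(* Colours of edges between tips on the path from [s] to a leg of another class with the same hub
   colour. *)
pose F s := [set t m | m in [set m | [exists s', [&& a s' == a s, cls s' != cls s, m != cls s & m != cls s']]]].
have shared1 s s' : cls s != cls s' -> a s = a s' -> occ_in a (cls s) (a s) <= 1.
  move=> cc aa; rewrite leqNgt; apply/negP=> /(c2 _ _ _ cc).
  by have := occ_in_gt0 a s'; rewrite aa => /[swap] ->.
have [||b [b1 b2 b3]] := @greedy S C LB F (fun s s' => a s == a s') (fun s => p (cls s)) D0.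
- by move=> s s'; rewrite eq_sym.
- move=> s sD; rewrite LB3.
  (* A leg sharing its hub colour with one other class has one conflicting leg and one forbidden
     colour; an unshared leg has at most two conflicting legs and no forbidden colour. *)
  case: (boolP [exists s', (a s' == a s) && (cls s' != cls s)]).
    case/existsP=> s' /andP[/eqP aE cE].
    have [m] : exists m, occ_in a m (a s) = 0.
      move: sD; rewrite inE negb_forall => /existsP[m]; rewrite -leqNgt leqn0.
      by move/eqP; exists m.
    move=> m0; have ms := occ_in_eq0 m0 (erefl (a s)); have ms' := occ_in_eq0 m0 aE.
    have h1 : #|[set u | (a s == a u) && (u != s)]| <= 1.
      apply: (@card_sub1 _ _ s'); apply/subsetP=> u; rewrite !inE => /andP[/eqP au us].
      have mu := occ_in_eq0 m0 (esym au).
      have uc : cls u != cls s.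
        apply: contraNneq us => uc; apply/eqP; apply: (occ_in_uniq (a := a)) => //.
        by apply: (shared1 _ s'); rewrite // eq_sym.
      have ucs' : cls u = cls s'.
        by apply: (@third_ord (cls s) m) => //; rewrite eq_sym.
      apply/eqP; apply: (occ_in_uniq (a := a)) => //; last by rewrite -au.
      exact: (shared1 _ s).
    have h2 : #|F s| <= 1.
      apply: (@card_sub1 _ _ (t m)); apply/subsetP=> x /imsetP[m'].
      rewrite !inE => /existsP[u /and4P[/eqP au uc m's m'u]] ->; apply/eqP; congr t.
      have mu := occ_in_eq0 m0 au.
      by apply: (@third_ord (cls s) (cls u)) => //; rewrite eq_sym.
    by apply: leq_ltn_trans (leq_add h2 h1) _.
  rewrite negb_exists => /forallP un.
  have -> : F s = set0.
    apply/setP=> x; rewrite inE; apply/negbTE/imsetP=> -[m].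
    by rewrite inE => /existsP[u /and4P[h1 h2 _ _]]; have := un u; rewrite h1 h2.
  rewrite cards0 add0n; have := c1 (cls s) (a s); rewrite /occ_in (cardsD1 s).
  rewrite inE !eqxx add1n; apply: leq_ltn_trans.
  apply/subset_leq_card/subsetP=> u; rewrite !inE => /andP[au ->].
  by have := un u; rewrite [a u == _]eq_sym au /= negbK andbT.
have t3 : forall s s' k, cls s != cls s' -> a s = a s' -> k != cls s -> k != cls s' ->
    b s != b s' /\ b s != t k.
  move=> s s' k cc aa ks ks'; case: (boolP (s \in D0)) => sD.
    have s'D : s' \in D0 by move: sD; rewrite !inE aa.
    by rewrite !b1 // (inj_eq pi) cc eq_sym tp.
  split; first by apply: b3 => //; [apply: contraNneq cc => -> | rewrite aa].
  have := b2 s; rewrite inE => /(_ sD); rewrite inE => /andP[bF _].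
  apply: contraNneq bF => ->; apply: imset_f; rewrite inE; apply/existsP; exists s'.
  by rewrite aa eqxx ks ks' eq_sym cc.
exists b, t; split=> // [s|].
  case: (boolP (s \in D0)) => sD; first by rewrite b1 // -PD.
  by have := b2 s; rewrite inE => /(_ sD); rewrite inE => /andP[].
split=> // s s' cE aE; apply: contra_eq => ss'.
case: (boolP (s \in D0)) => sD.
  case/eqP: ss'; apply/esym; apply: (occ_in_uniq (a := a)) => //; exact: D01.
by apply: b3 => //; [rewrite eq_sym | rewrite aE].
Qed.
End Good3.

Section Sums.
Variables (I1 I2 I3 : finType).
Definition sum3_cls (s : (I1 + I2) + I3) : 'I_3 :=
  match s with inl (inl _) => ord0 | inl (inr _) => lift ord0 ord0 | inr _ => ord_max end.
Definition sum3 (T : Type) (f1 : I1 -> T) (f2 : I2 -> T) (f3 : I3 -> T) (s : (I1 + I2) + I3) : T :=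
  match s with inl (inl i) => f1 i | inl (inr i) => f2 i | inr i => f3 i end.

Lemma occ_in_sum3 (C : finType) (a : (I1 + I2) + I3 -> C) k x :
  occ_in sum3_cls a k x =
  tnth [tuple occ (fun i => a (inl (inl i))) x; occ (fun i => a (inl (inr i))) x;
              occ (fun i => a (inr i)) x] k.
Proof.
rewrite /occ_in /occ; case: k => -[|[|[|//]]] lk; rewrite (tnth_nth 0) /=.
- rewrite -(card_imset _ (f := fun i : I1 => inl I3 (inl I2 i))); last by move=> ? ? [].
  apply: eq_card => s; rewrite inE; apply/andP/imsetP.
    by case: s => [[i|i]|i] [] // _ h; exists i; rewrite ?inE.
  by case=> i; rewrite inE => h ->.
- rewrite -(card_imset _ (f := fun i : I2 => inl I3 (inr I1 i))); last by move=> ? ? [].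
  apply: eq_card => s; rewrite inE; apply/andP/imsetP.
    by case: s => [[i|i]|i] [] // _ h; exists i; rewrite ?inE.
  by case=> i; rewrite inE => h ->.
- rewrite -(card_imset _ (f := fun i : I3 => @inr (I1 + I2) I3 i)); last by move=> ? ? [].
  apply: eq_card => s; rewrite inE; apply/andP/imsetP.
    by case: s => [[i|i]|i] [] // _ h; exists i; rewrite ?inE.
  by case=> i; rewrite inE => h ->.
Qed.

Lemma hub_good3 (C : finType) (LA LB : (I1 + I2) + I3 -> {set C}) (LT : 'I_3 -> {set C}) :
  (forall s, #|LB s| = 3) -> (forall k, #|LT k| = 3) ->
  hub_colourable (fun i => LA (inl (inl i))) (fun i => LA (inl (inr i))) (fun i => LA (inr i)) ->
  exists a b t, [/\ forall s, a s \in LA s, forall s, b s \in LB s, forall k, t k \in LT k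
    & good3 sum3_cls a b t].
Proof.
move=> LB3 LT3 [a1 [a2 [a3 [h1 h2 h3 hc [w hw]]]]].
pose a := sum3 a1 a2 a3.
have E k x : occ_in sum3_cls a k x = tnth [tuple occ a1 x; occ a2 x; occ a3 x] k.
  exact: occ_in_sum3.
have [|||b [t [bL tL g]]] := @good3_of_hub _ _ sum3_cls LB LT LB3 LT3 a w.
- move=> k x; have := hc x; rewrite /compatible => /and5P[x1 x2 x3 _ _].
  by rewrite E (tnth_nth 0); case: k => -[|[|[|//]]] ?.
- move=> k l x; have := hc x; rewrite /compatible => /and5P[_ _ _ x1 /andP[x2 x3]].
  rewrite !E !(tnth_nth 0) -val_eqE.
  case: k => -[|[|[|//]]] ?; case: l => -[|[|[|//]]] ? //= _ h; apply/eqP.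
  - by move: x1; rewrite h => /andP[].
  - by move: x1; rewrite h => /andP[].
  - by move: x2; rewrite h => /andP[].
  - by move: x2; rewrite h => /andP[].
  - by move: x3; rewrite h => /andP[].
  - by move: x3; rewrite h => /andP[].
- move=> x /hw /or3P[] /eqP h.
  + by exists ord0; rewrite E (tnth_nth 0).
  + by exists (lift ord0 ord0); rewrite E (tnth_nth 0).
  + by exists ord_max; rewrite E (tnth_nth 0).
by exists a, b, t; split=> // -[[i|i]|i]; rewrite /a /=.
Qed.
End Sums.

Definition mk3 (T : Type) (u v w : T) (k : 'I_3) : T :=
  if val k is 0 then u else if val k is 1 then v else w.

Lemma mk3_inj (T : eqType) (u v w : T) : u != v -> u != w -> v != w -> injective (mk3 u v w).
Proof.
move=> uv uw vw k l; apply: contra_eq; rewrite -val_eqE.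
by case: k => -[|[|[|//]]] ?; case: l => -[|[|[|//]]] ? //= _; rewrite ?uv ?uw ?vw // eq_sym ?uv ?uw ?vw.
Qed.

(** * Tip colours for class sizes (5,2,2) with constant hub lists *)

Section Const522.
Variables (C I : finType) (T W : {set C}) (P : I -> {set C}).
Variables (Q0 Q1 R0 R1 A B D : {set C}).
Hypotheses (T3 : #|T| = 3) (P3 : forall i, #|P i| = 3).

Let solved := exists (a b : (I + 'I_2) + 'I_2 -> C) (t : 'I_3 -> C),
  [/\ forall s, a s \in T, forall s, b s \in sum3 P (mk2 Q0 Q1) (mk2 R0 R1) s,
      forall k, t k \in mk3 A B D k & good3 (@sum3_cls _ _ _) a b t].

Let three : exists u1 u2 u3 : C, [/\ u1 \in T, u2 \in T, u3 \in T & [/\ u1 != u2, u1 != u3 & u2 != u3]].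
Proof.
have [u1 h1] : exists x, x \in T by apply/set0Pn; rewrite -card_gt0 T3.
have [|u2 h2 u21] := @pick_notin1 _ T u1; first by rewrite T3.
have [|u3 h3 /andP[u31 u32]] := @pick_notin2 _ T u1 u2; first by rewrite T3.
by exists u1, u2, u3; split=> //; split=> //; rewrite eq_sym.
Qed.

(** The hub colours [u2] and [u3] both occur once in every class, and [u1] on the remaining legs of
    the large class, at most three, whose tip colours are distinct representatives. [hub_colouring]
    excludes two triply shared colours, so the tip colours of their legs are prescribed here. *)
Lemma double_triple (s s' : I) a b c p0 p1 q0 q1 r0 r1 : #|I| <= 5 ->
  s != s' -> a \in A -> b \in B -> c \in D -> a != b -> a != c -> b != c ->
  p0 \in P s -> p1 \in P s' -> q0 \in Q0 -> q1 \in Q1 -> r0 \in R0 -> r1 \in R1 ->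
  [&& p0 != q0, p0 != r0 & q0 != r0] -> [&& p1 != q1, p1 != r1 & q1 != r1] ->
  [&& p0 != b, p0 != c, p1 != b & p1 != c] -> [&& q0 != a, q0 != c, q1 != a & q1 != c] ->
  [&& r0 != a, r0 != b, r1 != a & r1 != b] -> solved.
Proof.
move=> I5 ss' aA bB cD ab ac bc p0P p1P q0Q q1Q r0R r1R.
case/and3P=> pq0 pr0 qr0 /and3P[pq1 pr1 qr1] /and4P[p0b p0c p1b p1c].
case/and4P=> q0a q0c q1a q1c /and4P[r0a r0b r1a r1b].
have [u1 [u2 [u3 [u1T u2T u3T [u12 u13 u23]]]]] := three.
have [f [fi fP]] : exists f : I -> C,
    {in ~: [set s; s'] &, injective f} /\ {in ~: [set s; s'], forall i, f i \in P i}.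
  apply: (hall_in a) => J JX; have [->|/set0Pn[i iJ]] := eqVneq J set0; first by rewrite cards0.
  apply: leq_trans (_ : 3 <= _); last first.
    by rewrite -(P3 i); apply/subset_leq_card/bigcup_sup.
  apply: leq_trans (subset_leq_card JX) _; rewrite cardsCs setCK cards2 ss'.
  by rewrite leq_subLR (leq_trans I5).
pose al := sum3 (fun i => if i == s then u2 else if i == s' then u3 else u1) (mk2 u2 u3) (mk2 u2 u3).
pose be := sum3 (fun i => if i == s then p0 else if i == s' then p1 else f i) (mk2 q0 q1) (mk2 r0 r1).
have fin i : i != s -> i != s' -> i \in ~: [set s; s'] by move=> h1 h2; rewrite !inE negb_or h1.
exists al, be, (mk3 a b c); split.
- by case=> [[i|i]|i]; rewrite /al /= /mk2; do ?case: ifP.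
- case=> [[i|i]|i]; rewrite /be /= /mk2; [|by case: ifP|by case: ifP].
  case: eqP => [->//|/eqP is0]; case: eqP => [->//|/eqP is1]; exact/fP/fin.
- by case=> -[|[|[|//]]] ?.
split; first exact: mk3_inj.
  case=> [[i|i]|i] [[j|j]|j] // _; rewrite /al /be /=.
  - case: (eqVneq i s) => [->|is0]; case: (eqVneq j s) => [->//|js0].
    + by case: ifP => _ E; move: u12 u23; rewrite E eqxx.
    + by case: ifP => _ E; move: u12 u23; rewrite E eqxx.
    case: (eqVneq i s') => [->|is1]; case: (eqVneq j s') => [->//|js1].
    + by move=> E; move: u13; rewrite E eqxx.
    + by move=> E; move: u13; rewrite E eqxx.
    by move=> _ /(fi _ _ (fin _ is0 is1) (fin _ js0 js1)) ->.
  - rewrite /mk2; case: i j => -[|[|//]] h [[|[|//]] h'] /= E _;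
      first [by move: u23; rewrite E eqxx | by rewrite (bool_irrelevance h h')].
  - rewrite /mk2; case: i j => -[|[|//]] h [[|[|//]] h'] /= E _;
      first [by move: u23; rewrite E eqxx | by rewrite (bool_irrelevance h h')].
have u32 : u3 != u2 by rewrite eq_sym.
have u21 : u2 != u1 by rewrite eq_sym.
have u31 : u3 != u1 by rewrite eq_sym.
have neqs := (negbTE u12, negbTE u13, negbTE u23, negbTE u32, negbTE u21, negbTE u31).
case=> [[i|[[|[|//]] hi]]|[[|[|//]] hi]] [[j|[[|[|//]] hj]]|[[|[|//]] hj]] [[|[|[|//]]] hk] //= _;
  rewrite /al /be /= /mk2 /= => /eqP; do ?case: ifP => _; rewrite ?neqs // => _ _ _; rewrite /mk3 /=;
  by split; rewrite // eq_sym.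
Qed.

(** Both legs of the second class take hub colour [u2], both of the third [u3]. A leg of the large
    class may still take [u2] with a tip colour outside [F2], or [u3] with one outside [F3]. Hall's
    theorem distributes the pairs of hub and tip colour, whether or not the hub colours are
    [compatible]. *)
Lemma shared_pairs (a b c q0 q1 r0 r1 : C) : #|I| <= 5 ->
  (forall V : {set C}, 3 < occ P V -> (V != [set c; q0; q1]) && (V != [set b; r0; r1])) ->
  a \in A -> b \in B -> c \in D -> a != b -> a != c -> b != c ->
  q0 \in Q0 -> q1 \in Q1 -> r0 \in R0 -> r1 \in R1 ->
  [&& q0 != c, q1 != c & q0 != q1] -> [&& r0 != b, r1 != b & r0 != r1] -> solved.
Proof.
move=> I5 hV aA bB cD ab ac bc q0Q q1Q r0R r1R /and3P[q0c q1c q01] /and3P[r0b r1b r01].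
have [u1 [u2 [u3 [u1T u2T u3T [u12 u13 u23]]]]] := three.
set F2 := [set c; q0; q1] in hV; set F3 := [set b; r0; r1] in hV.
have F23 : #|F2| <= 3 by apply: card_set3_le.
have F33 : #|F3| <= 3 by apply: card_set3_le.
pose Dn (V : {set C}) := [set p : C * C | (p.2 \in V) && [|| p.1 == u1, (p.1 == u2) && (p.2 \notin F2)
    | (p.1 == u3) && (p.2 \notin F3)]].
have cardD (V : {set C}) : #|V| + #|V :\: F2| + #|V :\: F3| <= #|Dn V|.
  have disj (u v : C) (X Y : {set C}) : u != v -> [disjoint pair u @: X & pair v @: Y].
    move=> uv; rewrite -setI_eq0; apply/eqP/setP=> p; rewrite !inE; apply/negbTE/negP.
    by case/andP=> /imsetP[x _ ->] /imsetP[y _ [E _]]; move: uv; rewrite E eqxx.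
  have im (u : C) (X : {set C}) : #|pair u @: X| = #|X| by rewrite card_imset // => ? ? [].
  rewrite -(im u1 V) -(im u2 (V :\: F2)) -(im u3 (V :\: F3)).
  have cU (X Y : {set C * C}) : [disjoint X & Y] -> #|X| + #|Y| = #|X :|: Y|.
    by move=> dXY; rewrite cardsU disjoint_setI0 // cards0 subn0.
  rewrite cU ?disj //.
  set X := _ :|: _; have dX : [disjoint X & pair u3 @: (V :\: F3)].
    rewrite /X disjoint_sym disjoints_subset setCU subsetI -!disjoints_subset.
    by rewrite !disj // eq_sym.
  rewrite cU // /X.
  apply/subset_leq_card; rewrite !subUset -andbA; apply/and3P; split; apply/subsetP=> p /imsetP[x].
  - by move=> xV ->; rewrite inE /= xV eqxx.
  - by rewrite inE => /andP[xF xV] ->; rewrite inE /= xV eqxx xF orbT.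
  - by rewrite inE => /andP[xF xV] ->; rewrite inE /= xV eqxx xF !orbT.
have [g [gi gD]] : exists g : I -> C * C, injective g /\ forall i, g i \in Dn (P i).
  apply: (hall (a, a)) => J; have [->|J0] := eqVneq J set0; first by rewrite cards0.
  set V := \bigcup_(i in J) P i.
  have -> : \bigcup_(i in J) Dn (P i) = Dn V.
    apply/setP=> p; rewrite inE; apply/bigcupP/andP.
      case=> i iJ; rewrite inE => /andP[pP ->]; split=> //.
      by apply/bigcupP; exists i.
    by case=> /bigcupP[i iJ pP] h; exists i; rewrite // inE pP.
  apply: leq_trans (cardD V).
  have [V3 V4] : 3 <= #|V| /\ (#|V| = 3 -> #|J| <= occ P V) := bigcup_lists P3 J0.
  have Jm : #|J| <= 5 := leq_trans (max_card _) I5.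
  have d2 : #|V| <= #|V :\: F2| + 3.
    by rewrite -(cardsID F2 V) addnC leq_add2l (leq_trans _ F23) // subset_leq_card ?subsetIr.
  have d3 : #|V| <= #|V :\: F3| + 3.
    by rewrite -(cardsID F3 V) addnC leq_add2l (leq_trans _ F33) // subset_leq_card ?subsetIr.
  case: (leqP #|J| 3) => J3; first by rewrite -addnA; apply: leq_trans J3 (leq_trans V3 (leq_addr _ _)).
  (* Four colours in [V] give at least 4 + 1 + 1 pairs. Three colours give at least 3 + 1 + 1, since
     [V] is neither [F2] nor [F3]. *)
  case: (leqP #|V| 3) => V3'; last by move: V3' Jm d2 d3; clear; lia.
  have E : #|V| = 3 by apply/eqP; rewrite eqn_leq V3'.
  have /andP[n2 n3] := hV V (leq_trans J3 (V4 E)).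
  have ne (F : {set C}) : #|F| <= 3 -> V != F -> 0 < #|V :\: F|.
    move=> F3' VF; rewrite card_gt0 setD_eq0; apply: contra VF => /subset_card_eq ->; rewrite ?eqxx //.
    by rewrite E.
  by move: (ne _ F23 n2) (ne _ F33 n3) Jm V3; clear; lia.
pose al := sum3 (fun i => (g i).1) (fun _ : 'I_2 => u2) (fun _ : 'I_2 => u3).
pose be := sum3 (fun i => (g i).2) (mk2 q0 q1) (mk2 r0 r1).
have g2 i : (g i).1 = u2 -> [&& (g i).2 != c, (g i).2 != q0 & (g i).2 != q1].
  move=> E; have := gD i; rewrite inE E eqxx [u2 == u1]eq_sym (negbTE u12) (negbTE u23) /= orbF.
  by rewrite !inE !negb_or -andbA => /andP[].
have g3 i : (g i).1 = u3 -> [&& (g i).2 != b, (g i).2 != r0 & (g i).2 != r1].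
  move=> E; have := gD i; rewrite inE E eqxx [u3 == u1]eq_sym (negbTE u13) [u3 == u2]eq_sym (negbTE u23) /=.
  by rewrite !inE !negb_or -andbA => /andP[].
exists al, be, (mk3 a b c); split.
- case=> [[i|i]|i]; rewrite /al /= //; have := gD i; rewrite inE => /andP[_].
  by case/or3P=> [/eqP ->|/andP[/eqP -> _]|/andP[/eqP -> _]].
- case=> [[i|i]|i]; rewrite /be /= /mk2; [|by case: ifP|by case: ifP].
  by have := gD i; rewrite inE => /andP[].
- by case=> -[|[|[|//]]] ?.
split; first exact: mk3_inj.
  case=> [[i|i]|i] [[j|j]|j] // _; rewrite /al /be /=.
  - by move=> E1 E2; rewrite (gi i j) // [g i]surjective_pairing E1 E2 -surjective_pairing.
  - move=> _; rewrite /mk2; case: i j => -[|[|//]] h [[|[|//]] h'] /= E;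
      first [by move: q01; rewrite E eqxx | by rewrite (bool_irrelevance h h')].
  - move=> _; rewrite /mk2; case: i j => -[|[|//]] h [[|[|//]] h'] /= E;
      first [by move: r01; rewrite E eqxx | by rewrite (bool_irrelevance h h')].
case=> [[i|[[|[|//]] hi]]|[[|[|//]] hi]] [[j|[[|[|//]] hj]]|[[|[|//]] hj]] [[|[|[|//]]] hk] //= _;
  rewrite /al /be /= /mk2 /mk3 /= => E _ _; try by move: u23; rewrite E eqxx.
all: try by have /and3P[? ? ?] := g2 i E; split; rewrite // eq_sym.
all: try by have /and3P[? ? ?] := g3 i E; split; rewrite // eq_sym.
all: try by have /and3P[? ? ?] := g2 j (esym E); split; rewrite // eq_sym.
all: try by have /and3P[? ? ?] := g3 j (esym E); split; rewrite // eq_sym.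
Qed.
End Const522.

Lemma pick_notin3 (C : finType) (A : {set C}) u v w : #|A| = 3 -> A != [set u; v; w] ->
  exists2 x, x \in A & [&& x != u, x != v & x != w].
Proof.
move=> A3 An; have /subsetPn[x xA xB] : ~~ (A \subset [set u; v; w]).
  by apply: contra An => /subset_card_eq ->; rewrite // A3 card_set3_le.
by exists x => //; move: xB; rewrite !inE !negb_or -andbA.
Qed.

Section Plan2.
Variable C : finType.
Implicit Types W A B R : {set C}.

(** Input for [double_triple] when [W] is the list of two large-class legs, of both legs of a small
    class and of an edge between tips: [m] goes to the two large-class legs, [n] to that small
    class, [z0] and [z1] to the other one, and [a], [b], [c] to the edges between tips. *)
Definition flexible_triple W A B R0 R1 : Prop := exists a b c m n z0 z1 : C,
  [/\ [/\ a \in A, b \in B, c \in W, m \in W & n \in W],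
      [&& c != m, c != n & m != n], [&& a != b, a != c, b != c, a != n & b != m],
      z0 \in R0 /\ z1 \in R1 &
      [&& z0 != a, z0 != b, z0 != m & z0 != n] && [&& z1 != a, z1 != b, z1 != m & z1 != n]].

Lemma flexible_triple_sym W A B R0 R1 : flexible_triple W A B R0 R1 -> flexible_triple W B A R0 R1.
Proof.
case=> a [b [c [m [n [z0 [z1 [[h1 h2 h3 h4 h5] /and3P[k1 k2 k3] /and5P[l1 l2 l3 l4 l5] hz]]]]]]].
case/andP=> /and4P[x1 x2 x3 x4] /and4P[y1 y2 y3 y4].
exists b, a, c, n, m, z0, z1; split=> //.
- by rewrite k1 k2 eq_sym k3.
- by rewrite eq_sym l1 l2 l3 l4 l5.
- by rewrite x1 x2 x3 x4 y1 y2 y3 y4.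
Qed.

(** With [a = m], the colours [z0] and [z1] avoid just [b], [m], [n], so a list fails only if it
    equals this set. If [b1] is blocked both with [n1] and with [n2], then [R0] and [R1] both
    contain [b1], and neither blocks [b2]. *)
Lemma flexible_triple_half W A B R0 R1 m b1 b2 :
  #|W| = 3 -> #|R0| = 3 -> #|R1| = 3 -> m \in A -> m \in W ->
  b1 \in B -> b2 \in B -> b1 != b2 -> b1 \notin W -> b2 \notin W -> flexible_triple W A B R0 R1.
Proof.
move=> W3 R03 R13 mA mW b1B b2B b12 b1W b2W.
have [|n1 n1W n1m] := @pick_notin1 _ W m; first by rewrite W3.
have [|n2 n2W /andP[n2m n21]] := @pick_notin2 _ W m n1; first by rewrite W3.
have go b n c : b \in B -> b \notin W -> n \in W -> c \in W -> n != m -> c != m -> c != n ->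
    R0 != [set b; m; n] -> R1 != [set b; m; n] -> flexible_triple W A B R0 R1.
  move=> bB bW nW cW nm cm cn h0 h1.
  have [z0 z0R /and3P[x1 x2 x3]] := pick_notin3 R03 h0.
  have [z1 z1R /and3P[y1 y2 y3]] := pick_notin3 R13 h1.
  have bne x : x \in W -> b != x by move=> xW; apply: contraNneq bW => ->.
  exists m, b, c, m, n, z0, z1; split=> //.
  - by rewrite cm cn eq_sym nm.
  - by rewrite [m == b]eq_sym [m == c]eq_sym cm [m == n]eq_sym nm !bne.
  - by rewrite x1 x2 x3 y1 y2 y3.
have kill R x y : R = [set b1; m; x] -> R != [set b2; m; y] \/ b1 = y.
  move=> RE; case: (eqVneq b1 y) => [|b1y]; [by right | left].
  apply: contraTneq b12 => E; move: RE; rewrite E => /setP/(_ b1).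
  rewrite !inE eqxx (negbTE b1y) orbF /= => /orP[->//|/eqP b1m].
  by move: b1W; rewrite b1m mW.
case: (boolP ((R0 != [set b1; m; n1]) && (R1 != [set b1; m; n1]))) => [/andP[h0 h1]|h1].
  by apply: (go b1 n1 n2).
case: (boolP ((R0 != [set b1; m; n2]) && (R1 != [set b1; m; n2]))) => [/andP[h0 h2]|h2].
  by apply: (go b1 n2 n1); rewrite // eq_sym.
have b1n x : x \in W -> b1 != x by move=> xW; apply: contraNneq b1W => ->.
have ne : [set b1; m; n1] != [set b1; m; n2].
  apply/eqP=> /setP/(_ n2); rewrite !inE eqxx orbT [n2 == b1]eq_sym (negbTE (b1n _ n2W)).
  by rewrite (negbTE n2m) (negbTE n21).
have [x [y [E0 E1]]] : exists x y, R0 = [set b1; m; x] /\ R1 = [set b1; m; y].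
  move: h1 h2; rewrite !negb_and !negbK.
  case/orP=> /eqP e1 /orP[] /eqP e2.
  - by move: ne; rewrite -e1 -e2 eqxx.
  - by exists n1, n2.
  - by exists n2, n1.
  - by move: ne; rewrite -e1 -e2 eqxx.
apply: (go b2 n1 n2) => //.
- by case: (kill _ _ n1 E0) => // E; move: (b1n _ n1W); rewrite E eqxx.
- by case: (kill _ _ n1 E1) => // E; move: (b1n _ n1W); rewrite E eqxx.
Qed.

Lemma two_outside W B : #|W| = 3 -> #|B| = 3 -> #|B :&: W| <= 1 ->
  exists b1 b2, [/\ b1 \in B, b2 \in B, b1 != b2, b1 \notin W & b2 \notin W].
Proof.
move=> W3 B3 BW; have : 1 < #|B :\: W| by move: (cardsID W B); rewrite B3; lia.
move=> h; have /set0Pn[b1 b1P] : B :\: W != set0 by rewrite -card_gt0 (leq_trans _ h).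
have [b2 b2P b21] := pick_notin1 b1 h.
by move: b1P b2P; rewrite !inE => /andP[? ?] /andP[? ?]; exists b1, b2; rewrite eq_sym.
Qed.

Lemma flexible_triple_exists W A B R0 R1 : #|W| = 3 -> #|A| = 3 -> #|B| = 3 ->
  #|R0| = 3 -> #|R1| = 3 -> flexible_triple W A B R0 R1.
Proof.
move=> W3 A3 B3 R03 R13.
case: (boolP [exists m in A :&: W, exists n in B :&: W, m != n]).
  case/existsP=> m /andP[]; rewrite inE => /andP[mA mW] /existsP[n /andP[]].
  rewrite inE => /andP[nB nW] mn.
  have [|c cW /andP[cm cn]] := @pick_notin2 _ W m n; first by rewrite W3.
  have [|z0 z0R /andP[x1 x2]] := @pick_notin2 _ R0 m n; first by rewrite R03.
  have [|z1 z1R /andP[y1 y2]] := @pick_notin2 _ R1 m n; first by rewrite R13.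
  exists m, n, c, m, n, z0, z1; split=> //.
  - by rewrite cm cn mn.
  - by rewrite mn [m == c]eq_sym cm [n == c]eq_sym cn eq_sym mn.
  - by rewrite x1 x2 y1 y2.
move=> nd; have {}nd m n : m \in A -> m \in W -> n \in B -> n \in W -> m = n.
  move=> mA mW nB nW; apply/eqP; apply: contraR nd => mn; apply/existsP; exists m.
  by rewrite inE mA mW; apply/existsP; exists n; rewrite inE nB nW mn.
case: (set_0Vmem (A :&: W)) => [AW|[m]]; last first.
  rewrite inE => /andP[mA mW].
  have [|b1 [b2 [h1 h2 h3 h4 h5]]] := two_outside W3 B3.
    apply: (@card_sub1 _ _ m); apply/subsetP=> n; rewrite !inE => /andP[nB nW].
    by rewrite (nd m n).
  exact: (flexible_triple_half W3 R03 R13 mA mW h1 h2).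
case: (set_0Vmem (B :&: W)) => [BW|[n]]; last first.
  rewrite inE => /andP[nB nW].
  have [|a1 [a2 [h1 h2 h3 h4 h5]]] := two_outside W3 A3; first by rewrite AW cards0.
  apply: flexible_triple_sym.
  exact: (flexible_triple_half W3 R03 R13 nB nW h1 h2).
have out X x : X :&: W = set0 -> x \in X -> x \notin W.
  by move=> XW xX; apply/negP=> xW; have := in_set0 x; rewrite -XW inE xX xW.
(* [R] can block two choices of [c] only if it consists of [a], [b] and an element of [W], so [a]
   and [b] are chosen not both in [E R]. A list disjoint from [W] is harmless; making [E R] empty
   then keeps its size at most 2, below that of [A] and [B]. *)
pose E R := if R :&: W == set0 then set0 else R :\: W.
have E2 R : #|R| = 3 -> #|E R| <= 2.
  rewrite /E => R3; case: ifP => [_|/negbT]; first by rewrite cards0.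
  by rewrite -card_gt0 => h; move: (cardsID W R); rewrite R3; lia.
have [|a aA aE] := @set_pick _ A (E R0); first by rewrite A3 ltnS E2.
have [b [bB ba bE]] : exists b, [/\ b \in B, b != a & ~~ ((a \in E R1) && (b \in E R1))].
  have [|b bB bE] := @set_pick _ B (E R1); first by rewrite B3 ltnS E2.
  case: (eqVneq b a) => [ba|ba]; last by exists b; rewrite bB ba (negbTE bE) andbF.
  have [|b' b'B b'a] := @pick_notin1 _ B a; first by rewrite B3.
  by exists b'; rewrite b'B b'a -ba (negbTE bE).
have aW := out _ _ AW aA; have bW := out _ _ BW bB.
(* Each [R] rules out at most one choice of [c]: two choices force R = {a, b, x} with x in W. *)
have kill R c c' : #|R| = 3 -> ~~ ((a \in E R) && (b \in E R)) -> c \in W -> c' \in W -> c != c' ->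
    ~~ (R \subset a |: (b |: W :\ c)) \/ ~~ (R \subset a |: (b |: W :\ c')).
  move=> R3 nE cW c'W cc'; case: (boolP (R \subset a |: _)) => h1; last by left.
  right; apply: contra nE => h2.
  have [|x xW /andP[xc xc']] := @pick_notin2 _ W c c'; first by rewrite W3.
  have Wx y : y \in W -> y != c -> y != c' -> y = x.
    move=> yW yc yc'; apply/eqP; apply: contraT => yx.
    suff : 4 <= #|W| by rewrite W3.
    have <- : #|[set y; x; c; c']| = 4 by rewrite -!setUA !cardsU1 cards1 !inE !negb_or yx yc yc' xc xc' cc'.
    by apply/subset_leq_card/subsetP=> u; rewrite !inE -!orbA => /or4P[] /eqP ->.
  have Rsub : R \subset [set a; b; x].
    apply/subsetP=> y yR; have := subsetP h1 y yR; have := subsetP h2 y yR; rewrite !inE -!orbA.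
    case: (y == a) => //=; case: (y == b) => //= /andP[yc' yW] /andP[yc _].
    by rewrite (Wx y).
  have RE := subset_card_eq Rsub; rewrite R3 in RE; have {}RE := RE (card_set3_le _ _ _).
  have xR : x \in R :&: W by rewrite RE !inE eqxx xW !orbT.
  have -> : E R = R :\: W by rewrite /E; case: eqP xR => // ->; rewrite inE.
  by rewrite !inE aW bW RE !inE !eqxx !orbT.
have [c [cW k0 k1]] : exists c, [/\ c \in W, ~~ (R0 \subset a |: (b |: W :\ c)) &
    ~~ (R1 \subset a |: (b |: W :\ c))].
  have [c1 c1W] : exists x, x \in W by apply/set0Pn; rewrite -card_gt0 W3.
  have [|c2 c2W c21] := @pick_notin1 _ W c1; first by rewrite W3.
  have [|c3 c3W /andP[c31 c32]] := @pick_notin2 _ W c1 c2; first by rewrite W3.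
  have nE0 : ~~ ((a \in E R0) && (b \in E R0)) by rewrite (negbTE aE).
  have K0 x y := kill R0 x y R03 nE0; have K1 x y := kill R1 x y R13 bE.
  case: (boolP (R0 \subset a |: (b |: W :\ c1))) => h1.
    have g2 : ~~ (R0 \subset a |: (b |: W :\ c2)).
      by case: (K0 c1 c2) => //; rewrite ?h1 // eq_sym.
    have g3 : ~~ (R0 \subset a |: (b |: W :\ c3)).
      by case: (K0 c1 c3) => //; rewrite ?h1 // eq_sym.
    by case: (K1 c2 c3) => // [|h|h]; [rewrite eq_sym | exists c2 | exists c3].
  case: (boolP (R1 \subset a |: (b |: W :\ c1))) => h1'; last by exists c1.
  have g2 : ~~ (R1 \subset a |: (b |: W :\ c2)).
    by case: (K1 c1 c2) => //; rewrite ?h1' // eq_sym.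
  have g3 : ~~ (R1 \subset a |: (b |: W :\ c3)).
    by case: (K1 c1 c3) => //; rewrite ?h1' // eq_sym.
  by case: (K0 c2 c3) => // [|h|h]; [rewrite eq_sym | exists c2 | exists c3].
have [|m mW mc] := @pick_notin1 _ W c; first by rewrite W3.
have [|n nW /andP[nc nm]] := @pick_notin2 _ W c m; first by rewrite W3.
have fin R : ~~ (R \subset a |: (b |: W :\ c)) -> exists2 z, z \in R & [&& z != a, z != b, z != m & z != n].
  case/subsetPn=> z zR; rewrite !inE !negb_or => /and3P[za zb zW]; exists z => //.
  rewrite za zb /=; apply/andP; split; apply: contraNneq zW => ->; by rewrite ?mc ?nc.
have [z0 z0R hz0] := fin _ k0; have [z1 z1R hz1] := fin _ k1.
have ne u x : u \notin W -> x \in W -> u != x by move=> uW xW; apply: contraNneq uW => ->.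
exists a, b, c, m, n, z0, z1; split=> //.
- by rewrite [c == m]eq_sym mc [c == n]eq_sym nc [m == n]eq_sym nm.
- by rewrite [a == b]eq_sym ba !ne.
- by rewrite hz0 hz1.
Qed.
End Plan2.

Section Groups.
Variables (C : finType) (W : {set C}).

Lemma outside (Y : {set C}) : #|W| <= 3 -> #|Y| = 3 -> Y != W -> exists2 y, y \in Y & y \notin W.
Proof.
move=> W3 Y3 YW; apply/subsetPn; apply: contra YW => /subset_card_eq ->; first exact: eqxx.
by rewrite Y3.
Qed.

Lemma neq_triple (x y z u : C) : u \in [set x; y; z] -> u \notin W -> W != [set x; y; z].
Proof. by move=> h uW; apply: contraNneq uW => ->. Qed.

Lemma group_from (x : C) (Y0 Y1 : {set C}) : #|Y0| = 3 -> #|Y1| = 3 ->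
  exists y0 y1, [/\ y0 \in Y0, y1 \in Y1 & [&& y0 != x, y1 != x & y0 != y1]].
Proof.
move=> Y03 Y13; have [|y0 y0Y y0x] := @pick_notin1 _ Y0 x; first by rewrite Y03.
have [|y1 y1Y /andP[y1x y10]] := @pick_notin2 _ Y1 x y0; first by rewrite Y13.
by exists y0, y1; rewrite y0x y1x eq_sym y10.
Qed.

(** A group is a set [F2] or [F3] of [shared_pairs]: the colour [x] of an edge between tips and the
    tip colours of two legs. Any colour outside [W] makes it different from [W]; avoiding [e] keeps
    the edge colours of the two groups apart. *)
Lemma group_avoiding (X Y0 Y1 : {set C}) : #|W| <= 3 -> #|X| = 3 -> #|Y0| = 3 -> #|Y1| = 3 ->
  (Y0 != W) || (Y1 != W) -> forall e, exists x y0 y1,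
    [/\ x \in X, x != e, y0 \in Y0, y1 \in Y1 & [&& y0 != x, y1 != x & y0 != y1] /\ W != [set x; y0; y1]].
Proof.
move=> W3 X3 Y03 Y13 /orP[h|h] e.
  have [y yY yW] := outside W3 Y03 h.
  have [|x xX /andP[xe xy]] := @pick_notin2 _ X e y; first by rewrite X3.
  have [|y1 y1Y /andP[y1x y1y]] := @pick_notin2 _ Y1 x y; first by rewrite Y13.
  exists x, y, y1; split=> //; split; first by rewrite [y == x]eq_sym xy y1x eq_sym y1y.
  by apply: neq_triple yW; rewrite !inE eqxx orbT.
have [y yY yW] := outside W3 Y13 h.
have [|x xX /andP[xe xy]] := @pick_notin2 _ X e y; first by rewrite X3.
have [|y0 y0Y /andP[y0x y0y]] := @pick_notin2 _ Y0 x y; first by rewrite Y03.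
exists x, y0, y; split=> //; split; first by rewrite y0x y0y [y == x]eq_sym xy.
by apply: neq_triple yW; rewrite !inE eqxx orbT.
Qed.
End Groups.

(** Only the majority list [W] can occur more than three times, so [shared_pairs] applies once both
    groups differ from [W]. Where this is impossible, so many lists equal [W] that [double_triple]
    has an explicit input. *)
Lemma const_522 (C I : finType) (T : {set C}) (P : I -> {set C}) (Q0 Q1 R0 R1 A B D : {set C}) :
  #|I| <= 5 -> #|T| = 3 -> (forall i, #|P i| = 3) ->
  #|Q0| = 3 -> #|Q1| = 3 -> #|R0| = 3 -> #|R1| = 3 -> #|A| = 3 -> #|B| = 3 -> #|D| = 3 ->
  exists (a b : (I + 'I_2) + 'I_2 -> C) (t : 'I_3 -> C),
  [/\ forall s, a s \in T, forall s, b s \in sum3 P (mk2 Q0 Q1) (mk2 R0 R1) s,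
      forall k, t k \in mk3 A B D k & good3 (@sum3_cls _ _ _) a b t].
Proof.
move=> I5 T3 P3 Q03 Q13 R03 R13 A3 B3 D3; have [W [W3 hW _]] := majority P3.
have occW V : 3 < occ P V -> V = W.
  move=> h; apply/eqP; apply: contraTT h => /hW h; rewrite -leqNgt.
  by move: (leq_trans h I5); clear; lia.
have finish b c q0 q1 r0 r1 : b \in B -> c \in D -> b != c -> q0 \in Q0 -> q1 \in Q1 ->
    r0 \in R0 -> r1 \in R1 -> [&& q0 != c, q1 != c & q0 != q1] -> [&& r0 != b, r1 != b & r0 != r1] ->
    (3 < occ P W -> (W != [set c; q0; q1]) && (W != [set b; r0; r1])) ->
    exists (a b : (I + 'I_2) + 'I_2 -> C) (t : 'I_3 -> C),
    [/\ forall s, a s \in T, forall s, b s \in sum3 P (mk2 Q0 Q1) (mk2 R0 R1) s,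
      forall k, t k \in mk3 A B D k & good3 (@sum3_cls _ _ _) a b t].
  move=> bB cD bc h1 h2 h3 h4 h5 h6 h7.
  have [|a aA /andP[ab ac]] := @pick_notin2 _ A b c; first by rewrite A3.
  apply: (@shared_pairs C I T P Q0 Q1 R0 R1 A B D T3 P3 a b c q0 q1 r0 r1) => // V VP.
  by have VE := occW V VP; rewrite VE in VP *; apply: h7.
case: (leqP (occ P W) 3) => PW.
  have [c cD] : exists x, x \in D by apply/set0Pn; rewrite -card_gt0 D3.
  have [|b bB bc] := @pick_notin1 _ B c; first by rewrite B3.
  have [q0 [q1 [h1 h2 h3]]] := group_from c Q03 Q13.
  have [r0 [r1 [h4 h5 h6]]] := group_from b R03 R13.
  by apply: (finish b c q0 q1 r0 r1) => //; rewrite ltnNge PW.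
have [s [s' [ss' Ps Ps']]] : exists s s', [/\ s != s', P s = W & P s' = W].
  have /set0Pn[s sX] : [set i | P i == W] != set0 by rewrite -card_gt0 (leq_trans _ PW).
  have [|s' s'X s's] := @pick_notin1 _ [set i | P i == W] s; first exact: leq_trans PW.
  by move: sX s'X; rewrite !inE => /eqP ? /eqP ?; exists s, s'; rewrite eq_sym.
have {}W3 : #|W| = 3 by rewrite -Ps P3.
have W3' : #|W| <= 3 by rewrite W3.
case: (boolP [&& D == W, Q0 == W & Q1 == W]) => [/and3P[/eqP DE /eqP Q0E /eqP Q1E]|nDQ].
  have [a [b [c [m [n [z0 [z1 [[h1 h2 h3 h4 h5] /and3P[k1 k2 k3] /and5P[l1 l2 l3 l4 l5] [hz0 hz1]]]]]]]]] :=
    flexible_triple_exists W3 A3 B3 R03 R13.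
  case/andP=> /and4P[x1 x2 x3 x4] /and4P[y1 y2 y3 y4].
  apply: (@double_triple C I T P Q0 Q1 R0 R1 A B D T3 P3 s s' a b c m m n n z0 z1) => //.
  - by rewrite DE.
  - by rewrite Ps.
  - by rewrite Ps'.
  - by rewrite Q0E.
  - by rewrite Q1E.
  - by rewrite k3 [m == z0]eq_sym x3 eq_sym x4.
  - by rewrite k3 [m == z1]eq_sym y3 eq_sym y4.
  - by rewrite [m == b]eq_sym l5 [m == c]eq_sym k1.
  - by rewrite [n == a]eq_sym l4 [n == c]eq_sym k2.
  - by rewrite x1 x2 y1 y2.
case: (boolP [&& B == W, R0 == W & R1 == W]) => [/and3P[/eqP BE /eqP R0E /eqP R1E]|nBR].
  have [a [c [b [m [n [z0 [z1 [[h1 h2 h3 h4 h5] /and3P[k1 k2 k3] /and5P[l1 l2 l3 l4 l5] [hz0 hz1]]]]]]]]] :=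
    flexible_triple_exists W3 A3 D3 Q03 Q13.
  case/andP=> /and4P[x1 x2 x3 x4] /and4P[y1 y2 y3 y4].
  apply: (@double_triple C I T P Q0 Q1 R0 R1 A B D T3 P3 s s' a b c m m z0 z1 n n) => //.
  - by rewrite BE.
  - by rewrite eq_sym.
  - by rewrite Ps.
  - by rewrite Ps'.
  - by rewrite R0E.
  - by rewrite R1E.
  - by rewrite k3 [m == z0]eq_sym x3 x4.
  - by rewrite k3 [m == z1]eq_sym y3 y4.
  - by rewrite [m == b]eq_sym k1 [m == c]eq_sym l5.
  - by rewrite x1 x2 y1 y2.
  - by rewrite [n == a]eq_sym l4 [n == b]eq_sym k2.
case: (boolP ((Q0 != W) || (Q1 != W))) => nQ.
  case: (boolP ((R0 != W) || (R1 != W))) => nR.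
    have [x0 _] : exists x, x \in D by apply/set0Pn; rewrite -card_gt0 D3.
    have [c [q0 [q1 [cD _ h1 h2 [h3 h4]]]]] := group_avoiding W3' D3 Q03 Q13 nQ x0.
    have [b [r0 [r1 [bB bc h5 h6 [h7 h8]]]]] := group_avoiding W3' B3 R03 R13 nR c.
    by apply: (finish b c q0 q1 r0 r1) => // _; rewrite h4.
  have [b bB bW] : exists2 b, b \in B & b \notin W.
    apply: outside => //; move: nR nBR; rewrite negb_or !negbK => /andP[/eqP -> /eqP ->].
    by rewrite eqxx !andbT.
  have [r0 [r1 [h4 h5 h6]]] := group_from b R03 R13.
  have [c [q0 [q1 [cD cb h1 h2 [h3 h7]]]]] := group_avoiding W3' D3 Q03 Q13 nQ b.
  apply: (finish b c q0 q1 r0 r1) => // [|_]; first by rewrite eq_sym.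
  by rewrite h7 (neq_triple _ bW) // !inE eqxx.
have DW : D != W.
  by move: nQ nDQ; rewrite negb_or !negbK => /andP[/eqP -> /eqP ->]; rewrite eqxx !andbT.
have [c cD cW] := outside W3' D3 DW.
have [q0 [q1 [h1 h2 h3]]] := group_from c Q03 Q13.
have nF2 : W != [set c; q0; q1] by rewrite (neq_triple _ cW) // !inE eqxx.
case: (boolP ((R0 != W) || (R1 != W))) => nR.
  have [b [r0 [r1 [bB bc h5 h6 [h7 h8]]]]] := group_avoiding W3' B3 R03 R13 nR c.
  by apply: (finish b c q0 q1 r0 r1) => // _; rewrite nF2.
have BW : B != W.
  by move: nR nBR; rewrite negb_or !negbK => /andP[/eqP -> /eqP ->]; rewrite eqxx !andbT.
case: (boolP [exists b' in B :\: W, exists c' in D :\: W, b' != c']).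
  case/existsP=> b /andP[]; rewrite inE => /andP[bW bB] /existsP[c' /andP[]].
  rewrite inE => /andP[c'W c'D] bc'.
  have [y0 [y1 [g1 g2 g3]]] := group_from c' Q03 Q13.
  have [r0 [r1 [g4 g5 g6]]] := group_from b R03 R13.
  apply: (finish b c' y0 y1 r0 r1) => // _.
  by rewrite (neq_triple _ c'W) ?(neq_triple _ bW) // !inE eqxx.
move=> nd; have {}nd b c' : b \in B -> b \notin W -> c' \in D -> c' \notin W -> b = c'.
  move=> bB bW c'D c'W; apply/eqP; apply: contraR nd => bc; apply/existsP; exists b.
  by rewrite inE bB bW; apply/existsP; exists c'; rewrite inE c'D c'W bc.
(* Now [B] and [D] have the same single colour outside [W], hence two colours each inside it, from
   which distinct [b] and [c'] are taken. *)
have [e eB eW] := outside W3' B3 BW.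
have two (X : {set C}) u : #|X| = 3 -> (forall x, x \in X -> x \notin W -> x = u) -> 2 <= #|X :&: W|.
  move=> X3 h; have : #|X :\: W| <= 1.
    by apply: (@card_sub1 _ _ u); apply/subsetP=> x; rewrite !inE => /andP[xW xX]; apply/eqP/h.
  by move: (cardsID W X); rewrite X3; clear; lia.
have B2 := two B c B3 (fun x h1 h2 => nd x c h1 h2 cD cW).
have D2 := two D e D3 (fun x h1 h2 => esym (nd e x eB eW h1 h2)).
have /set0Pn[b] : B :&: W != set0 by rewrite -card_gt0 (leq_trans _ B2).
rewrite inE => /andP[bB bW].
have [c'] := pick_notin1 b D2; rewrite inE => /andP[c'D c'W] c'b.
have [|p pW /andP[pb pc]] := @pick_notin2 _ W b c'; first by rewrite W3.
have [|a aA /andP[ab ac]] := @pick_notin2 _ A b c'; first by rewrite A3.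
move: nQ nR; rewrite !negb_or !negbK => /andP[/eqP Q0E /eqP Q1E] /andP[/eqP R0E /eqP R1E].
have bc : b != c' by rewrite eq_sym.
apply: (@double_triple C I T P Q0 Q1 R0 R1 A B D T3 P3 s s' a b c' p p b b c' c') => //;
  rewrite ?Ps ?Ps' ?Q0E ?Q1E ?R0E ?R1E ?pb ?pc ?bc ?c'b //.
- by rewrite eq_sym ab.
- by rewrite eq_sym ac.
Qed.

(** * From a colouring in three colours to the class sizes, for three tips *)

Definition solvable3 (S : finType) (cls : S -> 'I_3) : Prop :=
  forall (C : finType) (LA LB : S -> {set C}) (LT : 'I_3 -> {set C}),
    (forall s, #|LA s| = 3) -> (forall s, #|LB s| = 3) -> (forall k, #|LT k| = 3) ->
    exists a b t, [/\ forall s, a s \in LA s, forall s, b s \in LB s, forall k, t k \in LT k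
      & good3 cls a b t].

Lemma hub_colourable_ext (C I1 I2 I3 : finType) (L1 : I1 -> {set C}) (L2 K2 : I2 -> {set C})
    (L3 K3 : I3 -> {set C}) : L2 =1 K2 -> L3 =1 K3 ->
  hub_colourable L1 L2 L3 -> hub_colourable L1 K2 K3.
Proof.
move=> E2 E3 [a1 [a2 [a3 [h1 h2 h3 hc hw]]]]; exists a1, a2, a3; split=> // i.
  by rewrite -E2.
by rewrite -E3.
Qed.

Lemma ord2E (T : Type) (f : 'I_2 -> T) i : mk2 (f ord0) (f ord_max) i = f i.
Proof.
by rewrite /mk2 -val_eqE; case: i => -[|[|//]] h /=; congr f; apply: val_inj.
Qed.

Lemma solvable_711 : solvable3 (@sum3_cls 'I_7 'I_1 'I_1).
Proof.
move=> C LA LB LT LA3 LB3 LT3; apply: hub_good3 => //.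
apply: (@hub_colourable_ext _ _ _ _ _ (fun=> LA (inl (inr ord0))) _ (fun=> LA (inr ord0))).
- by move=> i; rewrite [i]ord1.
- by move=> i; rewrite [i]ord1.
- by apply: hub_711; rewrite ?card_ord.
Qed.

Lemma solvable_441 : solvable3 (@sum3_cls 'I_4 'I_4 'I_1).
Proof.
move=> C LA LB LT LA3 LB3 LT3; apply: hub_good3 => //.
apply: (@hub_colourable_ext _ _ _ _ _ (fun i => LA (inl (inr i))) _ (fun=> LA (inr ord0))) => //.
- by move=> i; rewrite [i]ord1.
- by apply: hub_441; rewrite ?card_ord.
Qed.

Lemma solvable_333 : solvable3 (@sum3_cls 'I_3 'I_3 'I_3).
Proof.
move=> C LA LB LT LA3 LB3 LT3; apply: hub_good3 => //.
by apply: hub_333; rewrite ?card_ord.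
Qed.

Lemma solvable_522 : solvable3 (@sum3_cls 'I_5 'I_2 'I_2).
Proof.
move=> C LA LB LT LA3 LB3 LT3.
pose L i := LA (inl (inl i)); have L3 i : #|L i| = 3 by apply: LA3.
have I5 : #|'I_5| <= 5 by rewrite card_ord.
have [T0 [T03 hT T0L]] := majority L3.
have [h|[LE Y0 Y1 Z0 Z1]] := hub_522 I5 L3 T03 T0L hT (LA3 (inl (inr ord0))) (LA3 (inl (inr ord_max)))
    (LA3 (inr ord0)) (LA3 (inr ord_max)).
  apply: hub_good3 => //; apply: hub_colourable_ext h => i.
    exact: (ord2E (fun i => LA (inl (inr i)))).
  exact: (ord2E (fun i => LA (inr i))).
have LAE s : LA s = T0.
  case: s => [[i|i]|i]; first exact: LE.
    by rewrite -(ord2E (fun i => LA (inl (inr i)))) Y0 Y1 /mk2; case: ifP.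
  by rewrite -(ord2E (fun i => LA (inr i))) Z0 Z1 /mk2; case: ifP.
have T3 : #|T0| = 3 by rewrite -(LAE (inr ord0)).
have [a [b [t [h1 h2 h3 g]]]] := @const_522 C 'I_5 T0 (fun i => LB (inl (inl i)))
  (LB (inl (inr ord0))) (LB (inl (inr ord_max))) (LB (inr ord0)) (LB (inr ord_max))
  (LT ord0) (LT (lift ord0 ord0)) (LT ord_max) I5 T3 (fun i => LB3 _) (LB3 _) (LB3 _) (LB3 _) (LB3 _)
  (LT3 _) (LT3 _) (LT3 _).
exists a, b, t; split=> // [s|s|k]; first by rewrite LAE.
- case: s => [[i|i]|i]; first exact: h2 (inl (inl i)).
    by have := h2 (inl (inr i)); rewrite /= (ord2E (fun i => LB (inl (inr i)))).
  by have := h2 (inr i); rewrite /= (ord2E (fun i => LB (inr i))).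
- have := h3 k; rewrite /mk3; case: k => -[|[|[|//]]] h /=; congr (_ \in LT _); exact: val_inj.
Qed.

(** Legs outside the image of [phi] receive a dummy list, the lists of edges between tips are
    permuted by [pi], and a good colouring stays good when restricted. *)
Lemma solvable3_embed (S' S : finType) (cls' : S' -> 'I_3) (cls : S -> 'I_3) (phi : S' -> S)
    (pi : 'I_3 -> 'I_3) : injective phi -> injective pi -> (forall s, cls (phi s) = pi (cls' s)) ->
  solvable3 cls -> solvable3 cls'.
Proof.
move=> phi_inj pi_inj cE sol C LA LB LT LA3 LB3 LT3.
pose pull (L : S' -> {set C}) s := if [pick s' | phi s' == s] is Some s' then L s' else LT ord0.
have pullE L s : pull L (phi s) = L s.
  rewrite /pull; case: pickP => [s' /eqP/phi_inj -> //|/(_ s)]; by rewrite eqxx.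
have pull3 (L : S' -> {set C}) s : (forall s', #|L s'| = 3) -> #|pull L s| = 3 by move=> L3; rewrite /pull; case: pickP.
have [a [b [t [aL bL tL [ti g1 g2]]]]] := sol C (pull LA) (pull LB) (fun k => LT (invF pi_inj k))
  (fun s => pull3 _ s LA3) (fun s => pull3 _ s LB3) (fun k => LT3 _).
exists (a \o phi), (b \o phi), (t \o pi); split=> [s|s|k|] /=.
- by rewrite -pullE.
- by rewrite -[LB s]pullE.
- by have := tL (pi k); rewrite invF_f.
split=> [k l /ti/pi_inj //|s s' cs as' bs|s s' k cs as' ks ks'] /=.
  by apply/phi_inj/g1; rewrite ?cE ?cs.
by apply: g2; rewrite ?cE ?(inj_eq pi_inj).
Qed.

Lemma solvable3_card (S' S : finType) (cls' : S' -> 'I_3) (cls : S -> 'I_3) (pi : 'I_3 -> 'I_3) :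
  injective pi -> S ->
  (forall k, #|[set s | cls' s == k]| <= #|[set s | cls s == pi k]|) ->
  solvable3 cls -> solvable3 cls'.
Proof.
move=> pi_inj s0 le.
pose phi s := nth s0 (enum [set u | cls u == pi (cls' s)]) (index s (enum [set u | cls' u == cls' s])).
have lt s : index s (enum [set u | cls' u == cls' s]) < size (enum [set u | cls u == pi (cls' s)]).
  by rewrite -cardE; apply: leq_trans (le _); rewrite cardE index_mem mem_enum inE.
have cE s : cls (phi s) = pi (cls' s).
  by have := mem_nth s0 (lt s); rewrite mem_enum inE => /eqP.
apply: (solvable3_embed _ pi_inj cE) => s s' E.
have cs : cls' s = cls' s' by apply: pi_inj; rewrite -!cE E.
have ls := lt s; have ls' := lt s'; move: E; rewrite /phi; rewrite cs in ls *.
move/eqP; rewrite nth_uniq ?enum_uniq // => /eqP E.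
have m u : cls' u = cls' s' -> u \in enum [set u | cls' u == cls' s'].
  by move=> h; rewrite mem_enum inE h.
by rewrite -(nth_index s (m s cs)) E nth_index ?m.
Qed.

Lemma card_sum3_cls (I1 I2 I3 : finType) k :
  #|[set s | @sum3_cls I1 I2 I3 s == k]| = mk3 #|I1| #|I2| #|I3| k.
Proof.
have := occ_in_sum3 (fun _ : (I1 + I2) + I3 => tt) k tt; rewrite /occ_in (tnth_nth 0).
have -> : [set s | (@sum3_cls I1 I2 I3 s == k) && (tt == tt)] = [set s | @sum3_cls I1 I2 I3 s == k].
  by apply/setP=> s; rewrite !inE eqxx andbT.
move=> ->; have E (I : finType) : occ (fun _ : I => tt) tt = #|I|.
  by rewrite /occ -cardsT; congr #|pred_of_set _|; apply/setP=> i; rewrite !inE eqxx.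
by rewrite !E /mk3; case: k => -[|[|[|//]]] ?.
Qed.

(* The possible numbers of legs of one hub colour in the three classes. *)
Definition profile (p : nat * nat * nat) : Prop :=
  let: (x, y, z) := p in
  [\/ [/\ x <= 1, y <= 1 & z <= 1], [/\ x <= 3, y = 0 & z = 0],
      [/\ x = 0, y <= 3 & z = 0] | [/\ x = 0, y = 0 & z <= 3]].

Lemma profile_sum (x0 y0 z0 x1 y1 z1 x2 y2 z2 : nat) :
  profile (x0, y0, z0) -> profile (x1, y1, z1) -> profile (x2, y2, z2) ->
  let x := x0 + x1 + x2 in let y := y0 + y1 + y2 in let z := z0 + z1 + z2 in
  0 < x -> 0 < y -> 0 < z ->
  [|| [&& x <= 3, y <= 3 & z <= 3],
      [|| [&& x <= 7, y <= 1 & z <= 1], [&& x <= 1, y <= 7 & z <= 1] | [&& x <= 1, y <= 1 & z <= 7]],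
      [|| [&& x <= 4, y <= 4 & z <= 1], [&& x <= 4, y <= 1 & z <= 4] | [&& x <= 1, y <= 4 & z <= 4]]
    | [|| [&& x <= 5, y <= 2 & z <= 2], [&& x <= 2, y <= 5 & z <= 2] | [&& x <= 2, y <= 2 & z <= 5]]].
Proof.
move=> h0 h1 h2 x y z; rewrite {}/x {}/y {}/z.
move=> px py pz; apply/or4P.
by case: h0 => -[a1 a2 a3]; case: h1 => -[b1 b2 b3]; case: h2 => -[c1 c2 c3];
  first [ apply: Or41; apply/and3P; split; lia
        | apply: Or42; apply/or3P; apply: Or31; apply/and3P; split; lia
        | apply: Or42; apply/or3P; apply: Or32; apply/and3P; split; lia
        | apply: Or42; apply/or3P; apply: Or33; apply/and3P; split; lia
        | apply: Or43; apply/or3P; apply: Or31; apply/and3P; split; lia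
        | apply: Or43; apply/or3P; apply: Or32; apply/and3P; split; lia
        | apply: Or43; apply/or3P; apply: Or33; apply/and3P; split; lia
        | apply: Or44; apply/or3P; apply: Or31; apply/and3P; split; lia
        | apply: Or44; apply/or3P; apply: Or32; apply/and3P; split; lia
        | apply: Or44; apply/or3P; apply: Or33; apply/and3P; split; lia ].
Qed.

Lemma card_uniq_lt4 (s : seq 'I_3) : uniq s -> size s <= 3.
Proof. by move/card_uniqP <-; rewrite -[X in _ <= X](card_ord 3) max_card. Qed.

Theorem solvable3_of_three_colours (S : finType) (cls : S -> 'I_3) (a b : S -> 'I_3) (t : 'I_3 -> 'I_3) :
  (forall k, exists s, cls s = k) ->
  (forall s s', cls s = cls s' -> a s = a s' -> b s = b s' -> s = s') ->
  (forall s s' k, cls s != cls s' -> a s = a s' -> k != cls s -> k != cls s' ->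
     b s != b s' /\ b s != t k) -> solvable3 cls.
Proof.
move=> onto g1 g2.
have c3 k x : occ_in cls a k x <= 3.
  rewrite /occ_in -(card_in_imset (f := b)); last first.
    by move=> s s'; rewrite !inE => /andP[/eqP h1 /eqP h2] /andP[/eqP h3 /eqP h4]; apply: g1; rewrite ?h1 ?h2.
  by rewrite -[X in _ <= X](card_ord 3) max_card.
(* Two legs of hub colour [x] in class [k], one in class [l] and the edge between their tips would
   show four of the three colours. *)
have c0 k l x : k != l -> 1 < occ_in cls a k x -> occ_in cls a l x = 0.
  move=> kl k2; apply/eqP; rewrite -leqn0 leqNgt; apply/negP=> /card_gt0P[s3].
  rewrite inE => /andP[/eqP c3' /eqP a3].
  have /card_gt0P[s1] : 0 < occ_in cls a k x by apply: leq_trans k2.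
  move=> s1X; have [s2 s2X s21] := pick_notin1 s1 k2.
  move: s1X s2X; rewrite !inE => /andP[/eqP c1 /eqP a1] /andP[/eqP c2 /eqP a2].
  have [m [mk ml]] : exists m : 'I_3, m != k /\ m != l.
    have [|m _ /andP[]] := @pick_notin2 _ [set: 'I_3] k l; first by rewrite cardsT card_ord.
    by exists m.
  have [h1 h2] : b s1 != b s3 /\ b s1 != t m by apply: g2; rewrite ?c1 ?c3' ?a1 ?a3.
  have [h3 h4] : b s2 != b s3 /\ b s2 != t m by apply: g2; rewrite ?c2 ?c3' ?a2 ?a3.
  have [h5 h6] : b s3 != b s1 /\ b s3 != t m by apply: g2; rewrite ?c1 ?c3' ?a1 ?a3 // eq_sym.
  have h7 : b s1 != b s2.
    by apply: contraNneq s21 => E; apply/eqP; apply: g1; rewrite ?c1 ?c2 ?a1 ?a2.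
  have : uniq [:: b s1; b s2; b s3; t m] by rewrite /= !inE !negb_or h1 h2 h3 h4 h6 h7.
  by move/card_uniq_lt4.
pose o k x := occ_in cls a k x.
have prof x : profile (o ord0 x, o (lift ord0 ord0) x, o ord_max x).
  rewrite /profile /o; pose i1 : 'I_3 := lift ord0 ord0.
  case: (leqP (occ_in cls a ord0 x) 1) => w0; last first.
    by apply: Or42; rewrite (c0 ord0 i1 x isT w0) (c0 ord0 ord_max x isT w0).
  case: (leqP (occ_in cls a (lift ord0 ord0) x) 1) => w1; last first.
    by apply: Or43; rewrite (c0 i1 ord0 x isT w1) (c0 i1 ord_max x isT w1).
  case: (leqP (occ_in cls a ord_max x) 1) => w2; last first.
    by apply: Or44; rewrite (c0 ord_max ord0 x isT w2) (c0 ord_max i1 x isT w2).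
  by apply: Or41.
have n k : #|[set s | cls s == k]| = o k ord0 + o k (lift ord0 ord0) + o k ord_max.
  rewrite -sum1_card (partition_big a predT) //= !big_ord_recl big_ord0 addn0 -addnA.
  by congr (_ + (_ + _)); rewrite sum1dep_card; apply: eq_card => s; rewrite !inE //;
     congr (_ && (_ == _)); apply: val_inj.
have pos k : 0 < #|[set s | cls s == k]|.
  by have [s sk] := onto k; apply/card_gt0P; exists s; rewrite inE sk.
have p0 := pos ord0; have p1 := pos (lift ord0 ord0); have p2 := pos ord_max.
rewrite !n in p0 p1 p2.
have := profile_sum (prof ord0) (prof (lift ord0 ord0)) (prof ord_max) p0 p1 p2.
rewrite -!n => reg.
have use (I1 I2 I3 : finType) (pi : 'I_3 -> 'I_3) (s0 : (I1 + I2) + I3) : injective pi ->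
    solvable3 (@sum3_cls I1 I2 I3) ->
    (forall k, #|[set s | cls s == k]| <= mk3 #|I1| #|I2| #|I3| (pi k)) -> solvable3 cls.
  by move=> pi_inj sol h; apply: (solvable3_card pi_inj s0) sol => k; rewrite card_sum3_cls.
have u (I1 I2 I3 : finType) (i j k : 'I_3) (s0 : (I1 + I2) + I3) : i != j -> i != k -> j != k ->
    solvable3 (@sum3_cls I1 I2 I3) ->
    [&& #|[set s | cls s == ord0]| <= mk3 #|I1| #|I2| #|I3| i,
        #|[set s | cls s == lift ord0 ord0]| <= mk3 #|I1| #|I2| #|I3| j &
        #|[set s | cls s == ord_max]| <= mk3 #|I1| #|I2| #|I3| k] -> solvable3 cls.
  move=> ij ik jk sol /and3P[h0 h1 h2]; apply: (use _ _ _ (mk3 i j k) s0 _ sol); first exact: mk3_inj.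
  move=> l; have [-> | [-> | ->]] : l = ord0 \/ (l = lift ord0 ord0 \/ l = ord_max) => //.
  by case: l => -[|[|[|//]]] ?; [left | right; left | right; right]; apply: val_inj.
pose i0 : 'I_3 := ord0; pose i1 : 'I_3 := lift ord0 ord0; pose i2 : 'I_3 := ord_max.
case/or4P: reg => [h|/or3P[] h|/or3P[] h|/or3P[] h].
- by apply: (u 'I_3 'I_3 'I_3 i0 i1 i2 (inr ord0) isT isT isT solvable_333); rewrite /mk3 /= !card_ord.
- by apply: (u 'I_7 'I_1 'I_1 i0 i1 i2 (inr ord0) isT isT isT solvable_711); rewrite /mk3 /= !card_ord.
- by apply: (u 'I_7 'I_1 'I_1 i1 i0 i2 (inr ord0) isT isT isT solvable_711); rewrite /mk3 /= !card_ord.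
- by apply: (u 'I_7 'I_1 'I_1 i2 i1 i0 (inr ord0) isT isT isT solvable_711); rewrite /mk3 /= !card_ord.
- by apply: (u 'I_4 'I_4 'I_1 i0 i1 i2 (inr ord0) isT isT isT solvable_441); rewrite /mk3 /= !card_ord.
- by apply: (u 'I_4 'I_4 'I_1 i0 i2 i1 (inr ord0) isT isT isT solvable_441); rewrite /mk3 /= !card_ord.
- by apply: (u 'I_4 'I_4 'I_1 i2 i1 i0 (inr ord0) isT isT isT solvable_441); rewrite /mk3 /= !card_ord.
- by apply: (u 'I_5 'I_2 'I_2 i0 i1 i2 (inr ord0) isT isT isT solvable_522); rewrite /mk3 /= !card_ord.
- by apply: (u 'I_5 'I_2 'I_2 i1 i0 i2 (inr ord0) isT isT isT solvable_522); rewrite /mk3 /= !card_ord.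
- by apply: (u 'I_5 'I_2 'I_2 i2 i1 i0 (inr ord0) isT isT isT solvable_522); rewrite /mk3 /= !card_ord.
Qed.

(** * Colouring the tip edges: two classes of legs *)

Section Good2.
Variables (C A B : finType).

(** Each alternative lists two routes. A leg reaches the other tip through its own tip or through
    the hub and a leg of the other class; the hub reaches a tip along a leg of its class or through
    the other tip. *)
Definition good2 (a b : A -> C) (g d : B -> C) (q : C) : Prop :=
  [/\ (forall i i', a i = a i' -> b i = b i' -> i = i') /\
      (forall j j', g j = g j' -> d j = d j' -> j = j'),
      forall i j, a i = g j -> [/\ b i != d j, b i != q & d j != q],
      forall i, b i != q \/ exists j, [&& a i != g j, a i != d j & g j != d j],
      forall j, d j != q \/ exists i, [&& g j != a i, g j != b i & a i != b i] &
      ((exists i, a i != b i) \/ exists j, [&& g j != d j, g j != q & d j != q]) /\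
      ((exists j, g j != d j) \/ exists i, [&& a i != b i, a i != q & b i != q])].
End Good2.

Lemma good2_sym (C A B : finType) (a b : A -> C) (g d : B -> C) (q : C) :
  good2 g d a b q -> good2 a b g d q.
Proof.
case=> -[h1 h2] h3 h4 h5 [h6 h7]; split=> // i j /esym/h3[]; by rewrite eq_sym.
Qed.

Definition solvable2 (A B : finType) : Prop :=
  forall (C : finType) (LA LB : A -> {set C}) (LG LD : B -> {set C}) (LQ : {set C}),
    (forall i, #|LA i| = 3) -> (forall i, #|LB i| = 3) -> (forall j, #|LG j| = 3) ->
    (forall j, #|LD j| = 3) -> #|LQ| = 3 ->
    exists a b g d q, [/\ forall i, a i \in LA i, forall i, b i \in LB i,
      forall j, g j \in LG j, forall j, d j \in LD j & q \in LQ /\ good2 a b g d q].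

Lemma solvable2_sym A B : solvable2 B A -> solvable2 A B.
Proof.
move=> sol C LA LB LG LD LQ h1 h2 h3 h4 h5.
have [g [d [a [b [q [k1 k2 k3 k4 [k5 k6]]]]]]] := sol C LG LD LA LB LQ h3 h4 h1 h2 h5.
by exists a, b, g, d, q; split=> //; split=> //; apply: good2_sym.
Qed.

Lemma card_same (A C : finType) (a : A -> C) i :
  #|[set i' | (a i == a i') && (i' != i)]|.+1 = occ a (a i).
Proof.
rewrite /occ [RHS](cardsD1 i) inE eqxx add1n; congr _.+1; apply: eq_card => i'.
by rewrite !inE [a i == _]eq_sym andbC.
Qed.

Lemma solvable2_single (A B : finType) : #|B| = 1 -> #|A| <= 6 -> solvable2 A B.
Proof.
move=> B1 A6 C LA LB LG LD LQ LA3 LB3 LG3 LD3 LQ3.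
have /card_gt0P[j _] : 0 < #|B| by rewrite B1.
have jE j' : j' = j.
  have /card_le1_eqP h : #|B| <= 1 by rewrite B1.
  exact: h.
have /card_gt0P[g gL] : 0 < #|LG j| by rewrite LG3.
have [|d dL dg] := @pick_notin1 _ (LD j) g; first by rewrite LD3.
have [|q qL /andP[qg qd]] := @pick_notin2 _ LQ g d; first by rewrite LQ3.
(* [g] is shared with the single leg [j], so it is allowed once. A leg of hub colour [d] cannot use
   the detour through [j] and must avoid [q], which leaves room for two such legs. Three slots are
   lost, and 6 + 3 = 9. *)
pose def x := if x == g then 2 else if x == d then 1 else 0.
have [||a [aL am]] := @hall_capacity A C q LA def.
- by move=> x; rewrite /def; case: ifP => // _; case: ifP.
- move=> J J0 /=; set U := \bigcup_(s in J) LA s.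
  have [U3 _] : 3 <= #|U| /\ (#|U| = 3 -> #|J| <= occ LA U) := bigcup_lists LA3 J0.
  have Jm : #|J| <= 6 := leq_trans (max_card _) A6.
  have : \sum_(x in U) def x <= 3.
    apply: leq_trans (_ : \sum_x def x <= _).
      by rewrite big_mkcond; apply: leq_sum => x _; case: ifP.
    rewrite (bigD1 g) //= (bigD1 d) //= big1 ?addn0 /def ?eqxx ?(negbTE dg) //.
    by move=> x /andP[/negbTE -> /negbTE ->].
  by move: U3 Jm; clear; lia.
pose F i := if a i == g then [set q; d] else if a i == d then [set q] else set0.
have [||b [_ bL bc]] := @greedy A C LB F (fun i i' => a i == a i') (fun=> q) set0.
- by move=> i i'; rewrite eq_sym.
- move=> i _; rewrite LB3; have := am (a i); rewrite -/(occ a (a i)) -card_same /def /F.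
  case: ifP => _; first by have := card_set2_le q d; clear; lia.
  by case: ifP => _; rewrite ?cards1 ?cards0; clear; lia.
have bF i : b i \in LB i :\: F i by apply: bL; rewrite !inE.
exists a, b, (fun=> g), (fun=> d), q; split=> //.
- by move=> i; have := bF i; rewrite inE => /andP[].
- by move=> j'; rewrite (jE j').
- by move=> j'; rewrite (jE j').
split=> //; split.
- split=> [i i' ai|j1 j2 _ _]; last by rewrite (jE j1) (jE j2).
  by apply: contra_eq => ii'; apply: bc; rewrite ?inE ?ai // eq_sym.
- move=> i _ ai; have := bF i; rewrite /F ai eqxx !inE negb_or.
  by case/andP=> /andP[-> ->] _; rewrite eq_sym.
- move=> i; have := bF i; rewrite /F; case: ifPn => [_|ag].
    by rewrite !inE negb_or => /andP[/andP[h _] _]; left.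
  case: ifPn => [_|ad]; first by rewrite !inE => /andP[h _]; left.
  by move=> _; right; exists j; apply/and3P; split=> //; rewrite eq_sym.
- by move=> _; left; rewrite eq_sym.
split; [right | left]; exists j; first by rewrite /= [g == d]eq_sym dg [g == q]eq_sym qg [d == q]eq_sym qd.
by rewrite eq_sym.
Qed.

Section TwoClasses.
Variables (C A B : finType) (LB : A -> {set C}) (LD : B -> {set C}) (LQ : {set C}).
Hypotheses (LB3 : forall i, #|LB i| = 3) (LD3 : forall i, #|LD i| = 3) (LQ3 : #|LQ| = 3).
Variables (a : A -> C) (g : B -> C).
Hypothesis ok : forall x, compatible (occ a x) (occ g x) 0.

Let solved := exists b d q, [/\ forall i, b i \in LB i, forall j, d j \in LD j & q \in LQ /\ good2 a b g d q].

Let occ_pos (T : finType) (f : T -> C) i : 0 < occ f (f i).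
Proof. by apply/card_gt0P; exists i; rewrite inE. Qed.

Let shared1 i j : a i = g j -> occ a (a i) = 1 /\ occ g (g j) = 1.
Proof.
move=> E; have := ok (a i); rewrite /compatible => /and5P[_ _ _ h1 /andP[h2 _]].
have p1 := occ_pos a i; have p2 := occ_pos g j; rewrite -E in p2 *.
by move: h1 h2 p1 p2; case: (occ a _) (occ g _) => [|[|x]] [|[|y]].
Qed.

Let a3 x : occ a x <= 3. Proof. by have := ok x; rewrite /compatible => /and5P[]. Qed.
Let g3 x : occ g x <= 3. Proof. by have := ok x; rewrite /compatible => /and5P[]. Qed.

(** A leg sharing its hub colour has a unique partner [j] and no rival in its own class, so it
    avoids only [d j] and [q]; any other leg has at most two rivals. Legs in [D0] are coloured
    beforehand and share no hub colour. *)
Lemma extend_tip_colours (d : B -> C) q (b0 : A -> C) (D0 : {set A}) :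
  (forall i j, a i = g j -> i \notin D0) ->
  exists b : A -> C, [/\ {in D0, b =1 b0}, forall i, i \notin D0 -> b i \in LB i,
    forall i i', i \notin D0 -> i' != i -> a i = a i' -> b i != b i' &
    forall i j, a i = g j -> b i != d j /\ b i != q].
Proof.
move=> nD.
pose F i := [set x | [exists j, (g j == a i) && ((x == d j) || (x == q))]].
have [||b [b1 b2 b3]] := @greedy A C LB F (fun i i' => a i == a i') b0 D0.
- by move=> i i'; rewrite eq_sym.
- move=> i _; rewrite LB3; case: (boolP [exists j, g j == a i]) => [/existsP[j /eqP jE]|].
    have [o1 o2] := shared1 (esym jE).
    have : #|F i| <= 2.
      apply: leq_trans (card_set2_le (d j) q); apply/subset_leq_card/subsetP=> x.
      rewrite !inE => /existsP[j' /andP[/eqP j'E]]; suff -> : j' = j by [].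
      by apply/eqP; apply: contraT => jj; move: (card_same g j); rewrite o2 => -[/eqP]; rewrite cards_eq0 => /eqP/setP/(_ j'); rewrite !inE j'E jE eqxx jj.
    by move: (card_same a i); rewrite o1 => -[->]; clear; lia.
  rewrite negb_exists => /forallP nj; have -> : F i = set0.
    by apply/setP=> x; rewrite !inE; apply/negbTE/existsP=> -[j /andP[h _]]; have := nj j; rewrite h.
  by rewrite cards0 add0n; move: (card_same a i) (a3 (a i)) => <-.
exists b; split=> // [i iD|i i' iD ii' aE|i j aE].
- by have := b2 i; rewrite inE => /(_ iD); rewrite inE => /andP[].
- by apply: b3 => //; rewrite aE.
have := b2 i; rewrite inE => /(_ (nD i j aE)); rewrite inE => /andP[h _].
by split; apply: contraNneq h => ->; rewrite inE; apply/existsP; exists j; rewrite aE !eqxx ?orbT.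
Qed.

(** Two legs with different tip colours [d1] and [d2] provide the detours: the hub colour of an
    unshared leg of the other class differs from at least one of them. As [g] is injective, [q]
    cannot be the hub colour of both. *)
Lemma good2_injective : injective g -> 1 < #|B| -> solved.
Proof.
move=> gi B2; have /card_gt0P[j1 _] : 0 < #|B| by apply: leq_trans B2.
have [|j2 _ j21] := @pick_notin1 _ [set: B] j1; first by rewrite cardsT.
have [|d1 d1L d1g] := @pick_notin1 _ (LD j1) (g j1); first by rewrite LD3.
have [|d2 d2L /andP[d2g d21]] := @pick_notin2 _ (LD j2) (g j2) d1; first by rewrite LD3.
have [|q qL /andP[qd1 qd2]] := @pick_notin2 _ LQ d1 d2; first by rewrite LQ3.
have [d [dL dq dj1 dj2]] : exists d : B -> C, [/\ forall j, d j \in LD j, forall j, d j != q, d j1 = d1 & d j2 = d2].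
  have [d dP] : exists d : B -> C, forall j, [/\ d j \in LD j, d j != q, j = j1 -> d j = d1 & j = j2 -> d j = d2].
    apply: (fin_all_exists (P := fun j x => [/\ x \in LD j, x != q, j = j1 -> x = d1 & j = j2 -> x = d2])) => j.
    case: (eqVneq j j1) => [->|n1].
      by exists d1; split=> //; [rewrite eq_sym | move=> E; move: j21; rewrite E eqxx].
    case: (eqVneq j j2) => [->|n2].
      by exists d2; split=> //; [rewrite eq_sym | move=> E; move: j21; rewrite E eqxx].
    have [|x xL xq] := @pick_notin1 _ (LD j) q; first by rewrite LD3.
    by exists x; split=> // E; [move: n1; rewrite E eqxx | move: n2; rewrite E eqxx].
  exists d; split=> [j|j||]; [by case: (dP j) | by case: (dP j) | | ].
    by case: (dP j1) => _ _ ->.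
  by case: (dP j2) => _ _ _ ->.
have [|b [_ bL bc bs]] := @extend_tip_colours d q (fun=> q) set0; first by move=> *; rewrite inE.
have b_in i : i \notin (set0 : {set A}) by rewrite inE.
exists b, d, q; split=> //; first by move=> i; apply: bL.
split=> //; split.
- split=> [i i' aE|j j' /gi //].
  by apply: contra_eq => ii'; apply: bc; rewrite // eq_sym.
- by move=> i j aE; have [? ?] := bs i j aE; split.
- move=> i; case: (boolP [exists j, a i == g j]) => [/existsP[j /eqP aE]|].
    by left; have [] := bs i j aE.
  rewrite negb_exists => /forallP nj; right.
  case: (eqVneq (a i) d1) => [E|n1].
    by exists j2; rewrite nj dj2 E eq_sym d21 eq_sym d2g.
  by exists j1; rewrite nj dj1 n1 eq_sym d1g.
- by move=> j; left.
split; last by left; exists j1; rewrite dj1 eq_sym.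
right; case: (eqVneq q (g j1)) => [E|n].
  by exists j2; rewrite dj2 eq_sym d2g [d2 == q]eq_sym qd2 E (inj_eq gi) j21.
by exists j1; rewrite dj1 eq_sym d1g [g j1 == q]eq_sym n [d1 == q]eq_sym qd1.
Qed.
End TwoClasses.

Lemma compatible_sym a b : compatible a b 0 -> compatible b a 0.
Proof. by rewrite /compatible => /and5P[-> -> _ -> /andP[-> _]]. Qed.

Lemma compatible_mono a b c a' b' : a' <= a -> b' <= b -> compatible a b c -> compatible a' b' 0.
Proof.
rewrite /compatible /= !andbT => aa bb /and5P[a3 b3 _ h1 /andP[h2 _]].
rewrite (leq_trans aa a3) (leq_trans bb b3) /=; apply/andP; split; apply/implyP=> k.
  by move: h1; rewrite (leq_trans k aa) /= => /andP[/eqP b0 _]; rewrite -leqn0 -b0.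
by move: h2; rewrite (leq_trans k bb) /= => /andP[/eqP a0 _]; rewrite -leqn0 -a0.
Qed.

(** Legs with a repeated hub colour are unshared, so their tip colours can be fixed beforehand: two
    different ones in each class, which serve as detours for the other class. *)
Lemma good2_repeated (C A B : finType) (LB : A -> {set C}) (LD : B -> {set C}) (LQ : {set C})
    (a : A -> C) (g : B -> C) i1 i2 j1 j2 :
  (forall i, #|LB i| = 3) -> (forall i, #|LD i| = 3) -> #|LQ| = 3 ->
  (forall x, compatible (occ a x) (occ g x) 0) ->
  i1 != i2 -> a i1 = a i2 -> j1 != j2 -> g j1 = g j2 ->
  exists b d q, [/\ forall i, b i \in LB i, forall j, d j \in LD j & q \in LQ /\ good2 a b g d q].
Proof.
move=> LB3 LD3 LQ3 ok i12 aE j12 gE.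
have ok' x : compatible (occ g x) (occ a x) 0 by apply/compatible_sym/ok.
have two (T : finType) (f : T -> C) u v : u != v -> f u = f v -> 1 < occ f (f u).
  move=> uv fE; have <- : #|[set u; v]| = 2 by rewrite cards2 uv.
  by apply/subset_leq_card/subsetP=> w; rewrite !inE => /orP[] /eqP ->; rewrite ?fE.
have sep1 i j : a i = g j -> i \notin [set i1; i2].
  move=> E; rewrite !inE; apply/negP=> h.
  have a2 : 1 < occ a (a i) by case/orP: h => /eqP ->; rewrite -?aE; apply: (two _ _ _ i2).
  have := ok (a i); rewrite /compatible a2 => /and5P[_ _ _ /andP[/eqP g0 _] _].
  by move/eqP: g0; rewrite cards_eq0 => /eqP/setP/(_ j); rewrite !inE E eqxx.
have sep2 j i : g j = a i -> j \notin [set j1; j2].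
  move=> E; rewrite !inE; apply/negP=> h.
  have g2 : 1 < occ g (g j) by case/orP: h => /eqP ->; rewrite -?gE; apply: (two _ _ _ j2).
  have := ok' (g j); rewrite /compatible g2 => /and5P[_ _ _ /andP[/eqP a0 _] _].
  by move/eqP: a0; rewrite cards_eq0 => /eqP/setP/(_ i); rewrite !inE E eqxx.
have /card_gt0P[q qL] : 0 < #|LQ| by rewrite LQ3.
have [|d1 d1L d1g] := @pick_notin1 _ (LD j1) (g j1); first by rewrite LD3.
have [|d2 d2L /andP[d2g d21]] := @pick_notin2 _ (LD j2) (g j1) d1; first by rewrite LD3.
have [|b1 b1L b1a] := @pick_notin1 _ (LB i1) (a i1); first by rewrite LB3.
have [|b2 b2L /andP[b2a b21]] := @pick_notin2 _ (LB i2) (a i1) b1; first by rewrite LB3.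
(* The tip colours of the other class are not chosen yet, so the constant [q] stands in for them;
   the second extension then avoids [d]. *)
have [d [dD dL dc ds]] := @extend_tip_colours C B A LD LD3 g a ok' (fun=> q) q
  (fun j => if j == j1 then d1 else d2) [set j1; j2] sep2.
have [b [bD bL bc bs]] := @extend_tip_colours C A B LB LB3 a g ok d q
  (fun i => if i == i1 then b1 else b2) [set i1; i2] sep1.
have dj1 : d j1 = d1 by rewrite dD ?eqxx // !inE eqxx.
have dj2 : d j2 = d2 by rewrite dD ?inE ?eqxx ?orbT // eq_sym (negbTE j12).
have bi1 : b i1 = b1 by rewrite bD ?eqxx // !inE eqxx.
have bi2 : b i2 = b2 by rewrite bD ?inE ?eqxx ?orbT // eq_sym (negbTE i12).
have inj (T : finType) (f h : T -> C) u1 u2 :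
    (forall u u', u \notin [set u1; u2] -> u' != u -> f u = f u' -> h u != h u') -> h u1 != h u2 ->
    forall u u', f u = f u' -> h u = h u' -> u = u'.
  move=> hc h12 u u' fE hE; apply/eqP; apply: contraT => uu'.
  case: (boolP (u \in [set u1; u2])) => uD; last by have := hc u u' uD; rewrite hE eqxx eq_sym; apply.
  case: (boolP (u' \in [set u1; u2])) => u'D; last by have := hc u' u u'D uu' (esym fE); rewrite hE eqxx.
  move: uD u'D; rewrite !inE => /orP[] /eqP uE /orP[] /eqP u'E; move: uu' h12; rewrite uE u'E ?eqxx //.
    by rewrite -uE -u'E hE eqxx.
  by rewrite -u'E -uE hE eqxx.
exists b, d, q; split=> [i|j|].
- case: (boolP (i \in [set i1; i2])) => [|/bL //]; rewrite !inE => /orP[] /eqP ->; by rewrite ?bi1 ?bi2.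
- case: (boolP (j \in [set j1; j2])) => [|/dL //]; rewrite !inE => /orP[] /eqP ->; by rewrite ?dj1 ?dj2.
split=> //; split.
- split; first by apply: (inj _ a b i1 i2) => //; rewrite bi1 bi2 eq_sym.
  by apply: (inj _ g d j1 j2) => //; rewrite dj1 dj2 eq_sym.
- by move=> i j E; have [? ?] := bs i j E; have [_ ?] := ds j i (esym E); split.
- move=> i; case: (boolP [exists j, a i == g j]) => [/existsP[j /eqP E]|].
    by left; have [] := bs i j E.
  rewrite negb_exists => /forallP nj; right; case: (eqVneq (a i) d1) => [E|n1].
    exists j2; rewrite nj dj2 E eq_sym d21 -gE eq_sym; exact: d2g.
  by exists j1; rewrite nj dj1 n1 eq_sym d1g.
- move=> j; case: (boolP [exists i, g j == a i]) => [/existsP[i /eqP E]|].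
    by left; have [] := ds j i E.
  rewrite negb_exists => /forallP ni; right; case: (eqVneq (g j) b1) => [E|n1].
    exists i2; rewrite ni bi2 E eq_sym b21 -aE eq_sym; exact: b2a.
  by exists i1; rewrite ni bi1 n1 eq_sym b1a.
by split; left; [exists i1; rewrite bi1 eq_sym | exists j1; rewrite dj1 eq_sym].
Qed.

Definition hub2 (A B : finType) : Prop := forall (C : finType) (LA : A -> {set C}) (LG : B -> {set C}),
  (forall i, #|LA i| = 3) -> (forall j, #|LG j| = 3) ->
  exists a g, [/\ forall i, a i \in LA i, forall j, g j \in LG j &
    forall x, compatible (occ a x) (occ g x) 0].

Lemma hub2_sym A B : hub2 B A -> hub2 A B.
Proof.
move=> h C LA LG LA3 LG3; have [g [a [h1 h2 h3]]] := h C LG LA LG3 LA3.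
by exists a, g; split=> // x; apply/compatible_sym.
Qed.

(** Smaller classes are embedded into three legs, the vacant ones carrying a copy of the list of
    [j0]. *)
Lemma hub2_63 (A B : finType) : #|A| <= 6 -> #|B| <= 3 -> 0 < #|B| -> hub2 A B.
Proof.
move=> A6 B3 /card_gt0P[j0 _] C LA LG LA3 LG3.
pose phi (j : B) := widen_ord B3 (enum_rank j).
have phi_inj : injective phi by move=> j j' /(congr1 val) /= /ord_inj/enum_rank_inj.
pose N i := if [pick j | phi j == i] is Some j then LG j else LG j0.
have N3 i : #|N i| = 3 by rewrite /N; case: pickP.
have NE j : N (phi j) = LG j.
  by rewrite /N; case: pickP => [j' /eqP/phi_inj -> //|/(_ j)]; rewrite eqxx.
have [a [g [e [h1 h2 _ hc _]]]] := @hub_63 C A LA N (fun=> set0) A6 LA3 N3.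
exists a, (g \o phi); split=> // [j|x]; first by rewrite -NE; apply: h2.
apply: compatible_mono (hc x) => //.
rewrite /occ -(card_imset _ phi_inj); apply/subset_leq_card/subsetP=> i /imsetP[j].
by rewrite !inE => h ->.
Qed.

(** The single leg of the third class is a dummy with an arbitrary list, dropped afterwards. *)
Lemma hub2_44 (A B : finType) : #|A| <= 4 -> #|B| <= 4 -> 0 < #|A| -> 0 < #|B| -> hub2 A B.
Proof.
move=> A4 B4 A0 B0 C LA LG LA3 LG3; have /card_gt0P[i _] := A0.
have [a [g [e [h1 h2 _ hc _]]]] := hub_441 A4 B4 A0 B0 LA3 LG3 (LA3 i).
by exists a, g; split=> // x; apply: compatible_mono (hc x).
Qed.

Lemma solvable2_hub (A B : finType) : 1 < #|A| -> 1 < #|B| -> hub2 A B -> solvable2 A B.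
Proof.
move=> A1 B1 hub C LA LB LG LD LQ LA3 LB3 LG3 LD3 LQ3.
have [a [g [aL gL ok]]] := hub C LA LG LA3 LG3.
have ok' x : compatible (occ g x) (occ a x) 0 by apply/compatible_sym/ok.
case: (boolP (injectiveb g)) => [/injectiveP gi|/injectivePn[j1 [j2 j12 gE]]].
  have [b [d [q [bL dL [qL gd]]]]] := @good2_injective C A B LB LD LQ LB3 LD3 LQ3 a g ok gi B1.
  by exists a, b, g, d, q.
case: (boolP (injectiveb a)) => [/injectiveP ai|/injectivePn[i1 [i2 i12 aE]]].
  have [d [b [q [dL bL [qL gd]]]]] := @good2_injective C B A LD LB LQ LD3 LB3 LQ3 g a ok' ai A1.
  by exists a, b, g, d, q; split=> //; split=> //; apply: good2_sym.
have [b [d [q [bL dL [qL gd]]]]] := good2_repeated LB3 LD3 LQ3 ok i12 aE j12 gE.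
by exists a, b, g, d, q.
Qed.

(** Seven legs would force both colours other than [g j] to occur three times, each time with all
    tip colours. The leg with tip colour [q] then needs the detour through [j], so [d j] differs
    from [g j] and from both other colours, which is absurd. *)
Lemma not_seven_one (A B : finType) (a b : A -> 'I_3) (g d : B -> 'I_3) q :
  (forall i i', a i = a i' -> b i = b i' -> i = i') ->
  (forall i, b i != q \/ exists j, [&& a i != g j, a i != d j & g j != d j]) ->
  (forall x, 1 < occ a x -> occ g x = 0) ->
  #|B| = 1 -> #|A| <= 6.
Proof.
move=> inj reach comp B1; have /card_gt0P[j _] : 0 < #|B| by rewrite B1.
have jE j' : j' = j.
  have /card_le1_eqP h : #|B| <= 1 by rewrite B1.
  exact: h.
have a3 x : occ a x <= 3.
  rewrite /occ -(card_in_imset (f := b)); last first.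
    by move=> i i'; rewrite !inE => /eqP h1 /eqP h2; apply: inj; rewrite h1 h2.
  by rewrite -[X in _ <= X](card_ord 3) max_card.
have ag : occ a (g j) <= 1.
  rewrite leqNgt; apply/negP=> /comp /eqP; rewrite cards_eq0 => /eqP/setP/(_ j).
  by rewrite !inE eqxx.
have full x : occ a x = 3 -> [&& x != g j, x != d j & g j != d j].
  move=> x3; have : q \in b @: [set i | a i == x].
    suff -> : b @: [set i | a i == x] = setT by rewrite inE.
    apply/eqP; rewrite eqEcard subsetT cardsT card_ord card_in_imset ?x3 //.
      by rewrite -/(occ a x) x3.
    by move=> i i'; rewrite !inE => /eqP h1 /eqP h2; apply: inj; rewrite h1 h2.
  case/imsetP=> i; rewrite inE => /eqP <- qE; case: (reach i) => [|[j' ]]; first by rewrite qE eqxx.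
  by rewrite (jE j').
have cA : #|A| = \sum_x occ a x.
  rewrite -sum1_card (partition_big a predT) //=; apply: eq_bigr => x _.
  by rewrite sum1dep_card.
rewrite leqNgt; apply/negP=> A7.
have all3 x : x != g j -> occ a x = 3.
  move=> xg; apply/eqP; rewrite eqn_leq a3 /=; move: A7; rewrite cA.
  rewrite (bigD1 (g j)) //= (bigD1 x) //=.
  have [|y _ /andP[yg yx]] := @pick_notin2 _ [set: 'I_3] (g j) x; first by rewrite cardsT card_ord.
  rewrite (bigD1 y) ?yg ?yx //= big1 ?addn0; last first.
    move=> z /andP[/andP[zg zx] zy].
    suff : 4 <= 3 by [].
    have : uniq [:: g j; x; y; z].
      by rewrite /= !inE !negb_or [g j == x]eq_sym xg [g j == y]eq_sym yg [g j == z]eq_sym zg [x == y]eq_sym yx [x == z]eq_sym zx eq_sym zy.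
    by move/card_uniq_lt4.
  by move: ag (a3 y); clear; lia.
have [|x _ xg] := @pick_notin1 _ [set: 'I_3] (g j); first by rewrite cardsT card_ord.
have /and3P[_ _ gd] := full x (all3 x xg).
have dg : d j != g j by rewrite eq_sym.
by have /and3P[_] := full (d j) (all3 (d j) dg); rewrite eqxx.
Qed.

Lemma profile2_sum (x0 y0 x1 y1 x2 y2 : nat) :
  [\/ x0 <= 1 /\ y0 <= 1, x0 <= 3 /\ y0 = 0 | x0 = 0 /\ y0 <= 3] ->
  [\/ x1 <= 1 /\ y1 <= 1, x1 <= 3 /\ y1 = 0 | x1 = 0 /\ y1 <= 3] ->
  [\/ x2 <= 1 /\ y2 <= 1, x2 <= 3 /\ y2 = 0 | x2 = 0 /\ y2 <= 3] ->
  let x := x0 + x1 + x2 in let y := y0 + y1 + y2 in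
  1 < x -> 1 < y ->
  [|| (x <= 6) && (y <= 3), (x <= 3) && (y <= 6) | (x <= 4) && (y <= 4)].
Proof.
move=> h0 h1 h2 x y; rewrite {}/x {}/y => px py; apply/or3P.
by case: h0 => -[? ?]; case: h1 => -[? ?]; case: h2 => -[? ?];
  first [ apply: Or31; apply/andP; split; lia | apply: Or32; apply/andP; split; lia
        | apply: Or33; apply/andP; split; lia ].
Qed.

Theorem solvable2_of_three_colours (A B : finType) (a b : A -> 'I_3) (g d : B -> 'I_3) q :
  0 < #|A| -> 0 < #|B| ->
  (forall i i', a i = a i' -> b i = b i' -> i = i') ->
  (forall j j', g j = g j' -> d j = d j' -> j = j') ->
  (forall i j, a i = g j -> [/\ b i != d j, b i != q & d j != q]) ->
  (forall i, b i != q \/ exists j, [&& a i != g j, a i != d j & g j != d j]) ->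
  (forall j, d j != q \/ exists i, [&& g j != a i, g j != b i & a i != b i]) ->
  solvable2 A B.
Proof.
move=> A0 B0 injA injB cross reachA reachB.
have comp (X Y : finType) (u v : X -> 'I_3) (u' v' : Y -> 'I_3) x :
    (forall i i', u i = u i' -> v i = v i' -> i = i') ->
    (forall i j, u i = u' j -> [/\ v i != v' j, v i != q & v' j != q]) ->
    1 < occ u x -> occ u' x = 0.
  move=> injX crossX x1; apply/eqP; rewrite -leqn0 leqNgt; apply/negP=> /occ_gt0[j jx].
  have /card_gt0P[i1 i1X] : 0 < occ u x by apply: leq_trans x1.
  have [i2 i2X i21] := pick_notin1 i1 x1; move: i1X i2X; rewrite !inE => /eqP e1 /eqP e2.
  have [h1 h2 h3] := crossX i1 j (etrans e1 (esym jx)).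
  have [h4 h5 _] := crossX i2 j (etrans e2 (esym jx)).
  have h6 : v i1 != v i2 by apply: contraNneq i21 => E; apply/eqP; apply: injX; rewrite ?e1 ?e2.
  have : uniq [:: v i1; v i2; v' j; q] by rewrite /= !inE !negb_or h1 h2 h3 h4 h5 h6.
  by move/card_uniq_lt4.
have cross' j i : g j = a i -> [/\ d j != b i, d j != q & b i != q].
  by move/esym/cross=> [? ? ?]; split; rewrite // eq_sym.
have compA x := comp A B a b g d x injA cross.
have compB x := comp B A g d a b x injB cross'.
case: (leqP #|B| 1) => [B1|B2].
  have {}B1 : #|B| = 1 by apply/eqP; rewrite eqn_leq B1.
  by apply: solvable2_single => //; apply: (@not_seven_one A B a b g d q).
case: (leqP #|A| 1) => [A1|A2].
  have {}A1 : #|A| = 1 by apply/eqP; rewrite eqn_leq A1.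
  by apply/solvable2_sym/solvable2_single => //; apply: (@not_seven_one B A g d a b q).
have le3 (X : finType) (u v : X -> 'I_3) x : (forall i i', u i = u i' -> v i = v i' -> i = i') -> occ u x <= 3.
  move=> inj; rewrite /occ -(card_in_imset (f := v)); last first.
    by move=> i i'; rewrite !inE => /eqP h1 /eqP h2; apply: inj; rewrite h1 h2.
  by rewrite -[X in _ <= X](card_ord 3) max_card.
have prof x : [\/ occ a x <= 1 /\ occ g x <= 1, occ a x <= 3 /\ occ g x = 0 | occ a x = 0 /\ occ g x <= 3].
  case: (leqP (occ a x) 1) => a1; last by apply: Or32; split; [apply: le3 injA | apply: compA].
  case: (leqP (occ g x) 1) => g1; last by apply: Or33; split; [apply: compB | apply: le3 injB].
  by apply: Or31.
have card (X : finType) (u : X -> 'I_3) : #|X| = occ u ord0 + occ u (lift ord0 ord0) + occ u (lift ord0 (lift ord0 ord0)).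
  rewrite -sum1_card (partition_big u predT) //= !big_ord_recl big_ord0 addn0 -addnA.
  by rewrite !sum1dep_card.
apply: solvable2_hub => //.
have := profile2_sum (prof ord0) (prof (lift ord0 ord0)) (prof (lift ord0 (lift ord0 ord0))).
rewrite -!card => /(_ A2 B2) /or3P[] /andP[h1 h2].
- exact: hub2_63.
- by apply: hub2_sym; apply: hub2_63.
- exact: hub2_44.
Qed.

(** * Rainbow paths and blow-ups *)

Section Lifting.
Variable G : sgraph.

Lemma set2_eq (x y x' y' : G) : [set x; y] = [set x'; y'] ->
  (x = x' /\ y = y') \/ (x = y' /\ y = x').
Proof.
move/setP=> h; have := h x; have := h y; have := h x'; have := h y'; rewrite !inE !eqxx /= ?orbT.
by move=> /orP[] /eqP e1 /orP[] /eqP e2 /esym/orP[] /eqP e3 /esym/orP[] /eqP e4; subst; auto.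
Qed.

Lemma lift_sym (T : Type) (t0 : T) (g : G -> G -> T) : (forall x y, g x y = g y x) ->
  exists c : {set G} -> T, forall x y, c [set x; y] = g x y.
Proof.
move=> gs; exists (fun e => if [pick p : G * G | e == [set p.1; p.2]] is Some p then g p.1 p.2 else t0).
move=> x y; case: pickP => [[u v] /eqP /= /set2_eq[[-> ->]|[-> ->]] //|/(_ (x, y))].
by rewrite eqxx.
Qed.

Lemma edgesP (e : {set G}) : reflect (exists x y, adj x y /\ e = [set x; y]) (e \in edges G).
Proof.
rewrite inE; apply: (iffP existsP) => [[x /existsP[y /andP[xy /eqP ->]]]|[x [y [xy ->]]]].
  by exists x, y.
by exists x; apply/existsP; exists y; rewrite xy eqxx.
Qed.

Lemma mem_edges (x y : G) : adj x y -> [set x; y] \in edges G.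
Proof. by move=> xy; apply/edgesP; exists x, y. Qed.

(** Lists are cut down to exactly [r] colours, and a common bound puts all colours into one finite
    type. *)
Lemma finite_lists r (L : {set G} -> nat -> Prop) : edge_list_assignment r L ->
  exists (N : nat) (K : {set G} -> {set 'I_N}), (forall e, #|K e| = r) /\
    forall e, e \in edges G -> forall x, x \in K e -> L e x.
Proof.
move=> hL.
have [f fP] : exists f : {set G} -> 'I_r -> nat, forall e, injective (f e) /\
    (e \in edges G -> forall i, L e (f e i)).
  apply: (fin_all_exists (P := fun e (f : 'I_r -> nat) => injective f /\ (e \in edges G -> forall i, L e (f i)))) => e.
  case: (boolP (e \in edges G)) => [/hL[f [fi fL]]|_]; first by exists f.
  by exists val; split=> //; apply: val_inj.
pose M := \max_e \max_i f e i.
have fM e i : f e i < M.+1.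
  by rewrite ltnS (leq_trans _ (leq_bigmax e)) // (leq_bigmax i).
exists M.+1, (fun e => [set inord (f e i) | i : 'I_r]); split=> [e|e eG x /imsetP[i _ ->]].
  rewrite card_imset ?card_ord // => i j /(congr1 val); rewrite /= !inordK //.
  by case: (fP e) => h _ /h.
by rewrite inordK //; case: (fP e) => _ /(_ eG).
Qed.

Lemma lift_list_colouring (N : nat) (K : {set G} -> {set 'I_N}) (L : {set G} -> nat -> Prop) (g : G -> G -> 'I_N) :
  (forall e, e \in edges G -> forall x, x \in K e -> L e x) ->
  (forall x y, g x y = g y x) -> (forall x y, adj x y -> g x y \in K [set x; y]) ->
  exists c : {set G} -> nat, list_edge_colouring L c /\ forall x y, c [set x; y] = g x y.
Proof.
move=> KL gs gK.
have [c cE] := lift_sym 0 (g := fun x y => nat_of_ord (g x y)) (fun x y => congr1 val (gs x y)).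
exists c; split=> // e /[dup] eG /edgesP[x [y [xy eE]]]; rewrite eE cE.
by apply: KL; rewrite -?eE // eE; apply: gK.
Qed.
End Lifting.

Lemma size_le_num_colours (G : sgraph) (c : {set G} -> nat) (x y : G) p :
  rainbow_path c x y p -> size p <= num_colours c.
Proof.
case=> xp _ _ up; have E : size [seq c e | e <- path_edges x p] = size p.
  by rewrite size_map size_pairmap.
rewrite -E; apply: uniq_leq_size => // k /mapP[e eP ->]; rewrite mem_undup.
apply: map_f; rewrite mem_enum; move: eP; rewrite /path_edges.
elim: p x xp {up E} => //= z p IH x /andP[xz zp]; rewrite inE => /orP[/eqP ->|]; first exact: mem_edges.
exact: IH.
Qed.

Lemma rainbow_sym (G : sgraph) (c : {set G} -> nat) x y :
  (exists p, rainbow_path c x y p) -> exists p, rainbow_path c y x p.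
Proof.
case=> p [xp <- up uc].
have pe : path_edges (last x p) (rev (belast x p)) = rev (path_edges x p).
  rewrite /path_edges; elim: p x {xp up uc} => //= z p IH x.
  rewrite rev_cons -cats1 [in RHS]rev_cons -IH /=.
  rewrite pairmap_cat /= setUC cats1; congr rcons; congr [set _; _].
  by case: p {IH} => //= w p; rewrite rev_cons last_rcons.
exists (rev (belast x p)); split.
- by rewrite rev_path; apply: sub_path xp => u v; rewrite adj_sym.
- by case: p {xp up uc pe} => //= z p; rewrite rev_cons last_rcons.
- by rewrite -rev_rcons -lastI rev_uniq.
- by rewrite pe map_rev rev_uniq.
Qed.

(** [f] maps a vertex to the vertex of [B] of which it is a copy. Neighbours of a duplicated vertex
    have degree above 2 when [B] has minimum degree 2, so they are not duplicated; the last clause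
    keeps track of this. *)
Definition blowup (B G : sgraph) : Prop := exists f : G -> B,
  [/\ forall b, exists x, f x = b, forall x y, adj x y = adj (f x) (f y) &
      forall x y, x != y -> f x = f y -> deg (f x) = 2 /\
        forall z w, adj (f x) (f z) -> f z = f w -> z = w].

Lemma blowup_refl B : blowup B B.
Proof. by exists id; split=> [b|//|x y /eqP xy /xy]; first by exists b. Qed.

Lemma blowup_iso B G H : blowup B G -> isomorphic G H -> blowup B H.
Proof.
case=> f [fs fa fi] [h [[h' hK h'K] hadj]]; exists (f \o h'); split=> [b|x y|x y xy E] /=.
- by have [x xb] := fs b; exists (h x); rewrite /= hK.
- by rewrite -fa -hadj !h'K.
have [||d2 dz] := fi (h' x) (h' y) => //; first by rewrite (can_eq h'K).
by split=> // z w az zw; rewrite -[z]h'K -[w]h'K (dz _ _ az zw).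
Qed.

(** The image of [v] has at least two neighbours, all of them images of the two neighbours of [v].
    Hence its degree is 2 and [f] is injective on the neighbours of [v], so the copy of [v] can be
    sent to [f v]. *)
Lemma blowup_dup (B G : sgraph) (v : G) : (forall b : B, 1 < deg b) -> blowup B G -> deg v = 2 ->
  blowup B (duplicate v).
Proof.
move=> B2 [f [fs fa fi]] v2.
have sub : [set b | adj (f v) b] \subset f @: [set y | adj v y].
  apply/subsetP=> b; rewrite inE => vb; have [x xb] := fs b; apply/imsetP; exists x => //.
  by rewrite inE fa xb.
have le : #|f @: [set y | adj v y]| <= #|[set y | adj v y]| by apply: leq_imset_card.
have degv : deg (f v) = 2.
  apply/eqP; rewrite eqn_leq B2 andbT; apply: leq_trans (subset_leq_card sub) _.
  by rewrite (leq_trans le) // -/(deg v) v2.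
have nv z w : adj (f v) (f z) -> f z = f w -> z = w.
  move=> az zw.
  have /imset_injP inj : #|f @: [set y | adj v y]| == #|[set y | adj v y]|.
    by rewrite eqn_leq le -/(deg v) v2 -degv (leq_trans _ (subset_leq_card sub)).
  by apply: inj => //; rewrite inE fa // -zw.
exists (fun u : option G => f (odflt v u)); split=> [b|x y|].
- by have [x xb] := fs b; exists (Some x).
- by case: x y => [x|] [y|] /=; rewrite ?fa ?adj_irr // adj_sym.
have Nz (z w : option G) : adj (f v) (f (odflt v z)) -> f (odflt v z) = f (odflt v w) -> z = w.
  case: z w => [z|] [w|] /= az zw //; last 1 first.
  - by move: az; rewrite adj_irr.
  - by rewrite (nv z w).
  - by move: az; rewrite zw adj_irr.
move=> x y xy E; case: (eqVneq (f (odflt v x)) (f v)) => [xv|xv].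
  by rewrite xv; split=> // z w; apply: Nz.
case: x xy E xv => [x|]; last by rewrite eqxx.
case: y => [y|] /= xy E xv; last by move: xv; rewrite E eqxx.
have xy' : x != y by [].
have [d2 dz] := fi x y xy' E; split=> // -[z|] [w|] //= az zw.
- by rewrite (dz z w).
- by case/eqP: xy'; apply: nv => //; rewrite -zw adj_sym.
- by case/eqP: xy'; apply: nv => //; rewrite adj_sym.
Qed.

Lemma deg_ge2 (B : sgraph) (b x y : B) : x != y -> adj b x -> adj b y -> 1 < deg b.
Proof.
move=> xy bx by_; have <- : #|[set x; y]| = 2 by rewrite cards2 xy.
by apply/subset_leq_card/subsetP=> z; rewrite !inE => /orP[] /eqP ->.
Qed.

Lemma deg_ge3 (B : sgraph) (b x y z : B) : x != y -> x != z -> y != z ->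
  adj b x -> adj b y -> adj b z -> 2 < deg b.
Proof.
move=> xy xz yz bx by_ bz.
have <- : #|[set x; y; z]| = 3 by rewrite -setUA !cardsU1 cards1 !inE negb_or xy xz yz.
by apply/subset_leq_card/subsetP=> u; rewrite !inE -orbA => /or3P[] /eqP ->.
Qed.

(* A hub, [m] pairwise adjacent tips, and at least one leg joining the hub to each tip:
   blow-ups of C5 for [m = 2], of G7 for [m = 3]. *)
Record spider (m : nat) (G : sgraph) := Spider {
  hub : G;
  tip : 'I_m -> G;
  cls : G -> option 'I_m;
  cls_hub : cls hub = None;
  cls_tip : forall k, cls (tip k) = None;
  spider_cover : forall x, cls x = None -> x = hub \/ exists k, x = tip k;
  tip_inj : injective tip;
  tip_hub : forall k, tip k != hub;
  adj_hub_leg : forall s k, cls s = Some k -> adj hub s;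
  adj_hub_tip : forall k, adj hub (tip k) = false;
  adj_tip_leg : forall s k l, cls s = Some k -> adj (tip l) s = (l == k);
  adj_tip_tip : forall k l, adj (tip k) (tip l) = (k != l);
  adj_leg_leg : forall s s' k l, cls s = Some k -> cls s' = Some l -> adj s s' = false;
  cls_onto : forall k, exists s, cls s = Some k }.

Lemma spider_blowup m (B G : sgraph) (SB : spider m B) (f : G -> B) :
  (forall b, exists x, f x = b) -> (forall x y, adj x y = adj (f x) (f y)) ->
  (forall x y, cls SB (f x) = None -> f x = f y -> x = y) -> inhabited (spider m G).
Proof.
move=> fs fa f1; have [o oE] := fs (hub SB).
have [t tE] : exists t : 'I_m -> G, forall k, f (t k) = tip SB k.
  by apply: (fin_all_exists (P := fun k x => f x = tip SB k)) => k; apply: fs.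
split; apply: (@Spider m G o t (fun x => cls SB (f x))).
- by rewrite oE cls_hub.
- by move=> k; rewrite tE cls_tip.
- move=> x /[dup] x0 /spider_cover[xE|[k xE]].
    by left; apply: f1; rewrite // oE.
  by right; exists k; apply: f1; rewrite // tE.
- by move=> k l /(congr1 f); rewrite !tE => /tip_inj.
- by move=> k; apply: contraNneq (tip_hub SB k) => E; rewrite -tE E oE.
- by move=> s k h; rewrite fa oE; apply: adj_hub_leg h.
- by move=> k; rewrite fa oE tE adj_hub_tip.
- by move=> s k l h; rewrite fa tE; apply: adj_tip_leg h.
- by move=> k l; rewrite fa !tE adj_tip_tip.
- by move=> s s' k l h h'; rewrite fa; apply: adj_leg_leg h h'.
- by move=> k; have [b bk] := cls_onto SB k; have [x xb] := fs b; exists x; rewrite xb.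
Qed.

Definition rot5 (r : 'I_5) (d : nat) : 'I_5 := Ordinal (ltn_pmod (r + d) (isT : 0 < 5)).

Definition C5_cls (r x : 'I_5) : option 'I_2 :=
  if x == rot5 r 1 then Some ord0 else if x == rot5 r 4 then Some ord_max else None.

(** Every vertex [r] of the cycle can serve as hub; this freedom is needed because the choice
    depends on which vertices were duplicated. *)
Lemma C5_spider (r : C5) : { S : spider 2 C5 | cls S = C5_cls r }.
Proof.
have o5 (P : 'I_5 -> Prop) : (forall h, P (@Ordinal 5 0 h)) -> (forall h, P (@Ordinal 5 1 h)) ->
    (forall h, P (@Ordinal 5 2 h)) -> (forall h, P (@Ordinal 5 3 h)) -> (forall h, P (@Ordinal 5 4 h)) -> forall i, P i.
  by move=> ? ? ? ? ?; case=> -[|[|[|[|[|//]]]]].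
have o2 (P : 'I_2 -> Prop) : (forall h, P (@Ordinal 2 0 h)) -> (forall h, P (@Ordinal 2 1 h)) -> forall i, P i.
  by move=> ? ?; case=> -[|[|//]].
unshelve eexists (@Spider 2 C5 r (fun k => rot5 r (2 + k)) (C5_cls r) _ _ _ _ _ _ _ _ _ _ _); last by [].
- by elim/o5: r.
- by elim/o2; elim/o5: r.
- move=> x; elim/o5: r; elim/o5: x => h h' //= _;
  first [by left; apply: val_inj | by right; exists ord0; apply: val_inj | by right; exists ord_max; apply: val_inj].
- by move=> k l /(congr1 val) /= E; apply: val_inj; move: E; elim/o5: r; elim/o2: k; elim/o2: l.
- by elim/o2; elim/o5: r.
- by move=> s k; elim/o5: r; elim/o5: s.
- by elim/o2; elim/o5: r.
- by move=> s k l; elim/o5: r; elim/o5: s; elim/o2: l => //= ? ? ?; rewrite /C5_cls -!val_eqE //= => -[<-].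
- by move=> k l; elim/o5: r; elim/o2: k; elim/o2: l.
- by move=> s s' k l; elim/o5: r; elim/o5: s; elim/o5: s'.
- elim/o2 => h; [exists (rot5 r 1) | exists (rot5 r 4)]; rewrite /C5_cls; elim/o5: r => h'; rewrite -!val_eqE /=;
  congr Some; exact: val_inj.
Qed.

Lemma G7_edge (e : {e : {set K4} | e \in [set e in edges K4 | (ord0 : 'I_4) \in e]}) :
  exists k : 'I_3, val e = [set (ord0 : 'I_4); lift ord0 k].
Proof.
have := valP e; rewrite inE => /andP[/edgesP[x [y [xy ->]]]].
have lift_of (u : 'I_4) : u != ord0 -> exists k : 'I_3, u = lift ord0 k.
  by rewrite eq_sym => /unlift_some[k -> _]; exists k.
rewrite !inE => /orP[] /eqP E; subst.
  have [|k ->] := lift_of y; first by rewrite eq_sym.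
  by exists k.
have [|k ->] := lift_of x => //.
by exists k; rewrite setUC.
Qed.

Definition G7_cls (x : G7) : option 'I_3 :=
  match x with inl _ => None | inr e => [pick k : 'I_3 | (lift ord0 k : 'I_4) \in val e] end.

Lemma G7_clsE e k : G7_cls (inr e) = Some k <-> val e = [set (ord0 : 'I_4); lift ord0 k].
Proof.
have [l El] := G7_edge e; rewrite /G7_cls El.
have memE j : ((lift ord0 j : 'I_4) \in [set (ord0 : 'I_4); lift ord0 l]) = (j == l).
  by rewrite !inE (inj_eq lift_inj) eq_sym (negbTE (neq_lift _ _)).
case: pickP => [j|/(_ l)]; last by rewrite memE eqxx.
rewrite memE => /eqP ->; split=> [[->] //|/setP/(_ (lift ord0 l))].
by rewrite !inE eqxx orbT (inj_eq lift_inj) [_ == ord0]eq_sym (negbTE (neq_lift _ _)) /= => /esym/eqP ->.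
Qed.

Lemma G7_adj_inl (a b : K4) : @adj G7 (inl a) (inl b) =
  adj a b && ([set a; b] \notin [set e in edges K4 | (ord0 : 'I_4) \in e]).
Proof. by []. Qed.

Lemma G7_spider : spider 3 G7.
Proof.
apply: (@Spider 3 G7 (inl (ord0 : 'I_4)) (fun k => inl (lift ord0 k : 'I_4)) G7_cls) => //.
- case=> [i _|e]; last by have [k /G7_clsE ->] := G7_edge e.
  case: (unliftP ord0 i) => [k ->|->]; last by left.
  by right; exists k.
- by move=> k l /(congr1 (fun x : G7 => if x is inl i then i else ord0)) /lift_inj.
- case=> [//|e] k /G7_clsE E; rewrite /adj /= E !inE eqxx //.
- move=> k; rewrite G7_adj_inl; apply/negbTE; rewrite negb_and negbK; apply/orP; right.
  by rewrite inE mem_edges //= !inE eqxx.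
- case=> [//|e] k l /G7_clsE E; rewrite /adj /= E !inE (inj_eq lift_inj).
  by rewrite eq_sym (negbTE (neq_lift _ _)).
- move=> k l; rewrite G7_adj_inl [X in X && _](_ : _ = (k != l)).
    case: eqP => //= kl; rewrite inE negb_and; apply/orP; right.
    by rewrite !inE negb_or !neq_lift.
  by rewrite -(inj_eq (@lift_inj 4 ord0)).
- by case=> [//|e] [//|e'].
- move=> k; have h : [set (ord0 : K4); lift ord0 k] \in [set e in edges K4 | (ord0 : 'I_4) \in e].
    by rewrite inE mem_edges //= !inE eqxx.
  pose e : {e : {set K4} | e \in [set e in edges K4 | (ord0 : 'I_4) \in e]} :=
    exist (fun e : {set K4} => is_true (e \in [set e in edges K4 | (ord0 : 'I_4) \in e])) _ h.
  by exists (inr e); apply/G7_clsE.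
Qed.

Lemma C5_deg2 (b : C5) : 1 < deg b.
Proof.
by apply: (@deg_ge2 C5 b (rot5 b 1) (rot5 b 4)); case: b => -[|[|[|[|[|//]]]]].
Qed.

Lemma leg_neq m G (S : spider m G) s s' k l : cls S s = Some k -> cls S s' = Some l -> k != l -> s != s'.
Proof. by move=> sk sl; apply: contraNneq => E; move: sl; rewrite -E sk => -[->]. Qed.

(** The degree bound for hub and tips is the reason why only legs of [G7] are ever duplicated. *)
Lemma spider3_deg (B : sgraph) (SB : spider 3 B) b : 1 < deg b /\ (cls SB b = None -> 2 < deg b).
Proof.
have legs k := cls_onto SB k.
have tipleg k s l : cls SB s = Some l -> tip SB k != s.
  by apply: contra_eqN => /eqP <-; rewrite cls_tip.
have h3 : cls SB b = None -> 2 < deg b.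
  case/spider_cover=> [->|[k ->]].
    have [s0 h0] := legs ord0; have [s1 h1] := legs (lift ord0 ord0); have [s2 h2] := legs ord_max.
    apply: (deg_ge3 (x := s0) (y := s1) (z := s2)); rewrite ?(adj_hub_leg h0) ?(adj_hub_leg h1) ?(adj_hub_leg h2) //.
    - exact: leg_neq h0 h1 _.
    - exact: leg_neq h0 h2 _.
    - exact: leg_neq h1 h2 _.
  have [i [j [ki kj ij]]] : exists i j : 'I_3, [/\ k != i, k != j & i != j].
    have [|i _ ki] := @pick_notin1 _ [set: 'I_3] k; first by rewrite cardsT card_ord.
    have [|j _ /andP[kj ij]] := @pick_notin2 _ [set: 'I_3] k i; first by rewrite cardsT card_ord.
    by exists i, j; rewrite eq_sym ki eq_sym kj eq_sym ij.
  have [s sk] := legs k.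
  apply: (deg_ge3 (x := tip SB i) (y := tip SB j) (z := s)); rewrite ?adj_tip_tip //.
  - by rewrite (inj_eq (@tip_inj _ _ SB)).
  - exact: tipleg sk.
  - exact: tipleg sk.
  - by rewrite (adj_tip_leg _ sk) eqxx.
split=> //; case E: (cls SB b) => [k|]; last by apply: ltnW; apply: h3.
apply: (deg_ge2 (x := hub SB) (y := tip SB k)).
- by rewrite eq_sym tip_hub.
- by rewrite adj_sym (adj_hub_leg E).
- by rewrite adj_sym (adj_tip_leg _ E) eqxx.
Qed.

Lemma blowup_G7_spider G : blowup G7 G -> inhabited (spider 3 G).
Proof.
case=> f [fs fa fi]; apply: (spider_blowup (SB := G7_spider) fs fa) => x y c0 E.
apply/eqP; apply: contraT => /fi/(_ E)[d2 _].
by have [_ /(_ c0)] := spider3_deg G7_spider (f x); rewrite d2.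
Qed.

(** The duplicated vertices are pairwise non-adjacent in the cycle, so all of them are neighbours of
    some vertex [r] that is itself not duplicated; this [r] becomes the hub. *)
Lemma blowup_C5_spider G : blowup C5 G -> inhabited (spider 2 G).
Proof.
case=> f [fs fa fi].
pose X (b : 'I_5) := [exists x, exists y, [&& x != y, f x == b & f y == b]].
have Xadj b b' : X b -> X b' -> C5_adj b b' = false.
  case/existsP=> x /existsP[y /and3P[xy /eqP xb /eqP yb]].
  case/existsP=> z /existsP[w /and3P[zw /eqP zb /eqP wb]]; apply/negP=> bb.
  have [|_ h] := fi x y xy; first by rewrite xb yb.
  by case/eqP: zw; apply: h; rewrite ?xb ?zb ?wb.
have [r [r0 r2 r3]] : exists r : 'I_5, [/\ ~~ X r, ~~ X (rot5 r 2) & ~~ X (rot5 r 3)].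
  pose n (k : nat) : 'I_5 := inord k.
  have nE k : k < 5 -> val (n k) = k by move=> k5; rewrite /= inordK.
  have A k : X (n k) -> X (n (k.+1 %% 5)) -> k < 5 -> False.
    move=> h1 h2 k5; have := Xadj _ _ h1 h2; rewrite /C5_adj /= -!val_eqE /= !inordK ?ltn_pmod //.
    by rewrite eqxx.
  have R k d : k < 5 -> rot5 (n k) d = n ((k + d) %% 5).
    by move=> k5; apply: val_inj; rewrite /= !inordK ?ltn_pmod.
  have := (A 0, A 1, A 2, A 3, A 4); rewrite ![_ %% 5]/= => -[[[[a0 a1] a2] a3] a4].
  have use k : k < 5 -> ~~ X (n k) -> ~~ X (n ((k + 2) %% 5)) -> ~~ X (n ((k + 3) %% 5)) ->
      exists r : 'I_5, [/\ ~~ X r, ~~ X (rot5 r 2) & ~~ X (rot5 r 3)].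
    by move=> k5 h1 h2 h3; exists (n k); rewrite !R.
  have := (use 0 isT, use 1 isT, use 2 isT, use 3 isT, use 4 isT).
  rewrite ![_ %% 5]/= => -[[[[u0 u1] u2] u3] u4].
  case e0: (X (n 0)) a0 a4 u0 u1 u2 u3 u4; case e1: (X (n 1)) a1; case e2: (X (n 2)) a2;
  case e3: (X (n 3)) a3; case e4: (X (n 4)) => a3 a2 a1 a0 a4 u0 u1 u2 u3 u4;
  first [exact: u0 | exact: u1 | exact: u2 | exact: u3 | exact: u4
        | by case: a0 | by case: a1 | by case: a2 | by case: a3 | by case: a4].
have [SB cE] := C5_spider r; apply: (spider_blowup (SB := SB) fs fa) => x y c0 E.
apply/eqP; apply: contraT => xy.
have Xf : X (f x) by apply/existsP; exists x; apply/existsP; exists y; rewrite xy E eqxx.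
move: c0; rewrite cE /C5_cls; case: eqP => // /eqP n1; case: eqP => // /eqP n4 _.
have : [|| f x == r, f x == rot5 r 2 | f x == rot5 r 3].
  move: n1 n4; rewrite -!val_eqE /=.
  by case: (f x : 'I_5) => -[|[|[|[|[|//]]]]] ?; case: (r) => -[|[|[|[|[|//]]]]].
by case/or3P=> /eqP fE; move: Xf; rewrite fE ?(negbTE r0) ?(negbTE r2) ?(negbTE r3).
Qed.

(** * Spiders *)

Section Paths.
Variables (G : sgraph) (c : {set G} -> nat).
Let e x y := c [set x; y].

Definition joined x y := exists p, rainbow_path c x y p.

Lemma joined_sym x y : joined x y -> joined y x.
Proof. exact: rainbow_sym. Qed.

Lemma adj_neq (x y : G) : adj x y -> x != y.
Proof. by apply: contraTneq => ->; rewrite adj_irr. Qed.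

Lemma joined1 x y : adj x y -> joined x y.
Proof. by move=> xy; exists [:: y]; split; rewrite /= ?xy // inE (adj_neq xy). Qed.

Lemma joined2 x u y : x != y -> adj x u -> adj u y -> e x u != e u y -> joined x y.
Proof.
move=> xy xu uy euy; exists [:: u; y]; split=> //=; first by rewrite xu uy.
  by rewrite !inE negb_or (adj_neq xu) xy (adj_neq uy).
by rewrite inE euy.
Qed.

Lemma joined3 x u v y : x != y -> x != v -> u != y -> adj x u -> adj u v -> adj v y ->
  [&& e x u != e u v, e x u != e v y & e u v != e v y] -> joined x y.
Proof.
move=> xy xv uy_ xu uv vy /and3P[h1 h2 h3]; exists [:: u; v; y]; split=> //=.
- by rewrite xu uv vy.
- by rewrite !inE !negb_or (adj_neq xu) xv xy (adj_neq uv) uy_ (adj_neq vy).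
- by rewrite !inE !negb_or -/(e x u) h1 h2 h3.
Qed.

Lemma joined4 x u v w y : uniq [:: x; u; v; w; y] -> adj x u -> adj u v -> adj v w -> adj w y ->
  uniq [:: e x u; e u v; e v w; e w y] -> joined x y.
Proof. by move=> un xu uv vw wy ue; exists [:: u; v; w; y]; split=> //=; rewrite xu uv vw wy. Qed.
End Paths.

Section SpiderColouring.
Variables (m : nat) (G : sgraph) (S : spider m G).
Local Notation o := (hub S).
Local Notation t := (tip S).
Local Notation cl := (cls S).

Lemma leg_hub s k : cl s = Some k -> s != o.
Proof. by apply: contra_eqN => /eqP ->; rewrite cls_hub. Qed.

Lemma leg_tip s k l : cl s = Some k -> s != t l.
Proof. by apply: contra_eqN => /eqP ->; rewrite cls_tip. Qed.

Lemma leg_adj s k u : cl s = Some k -> adj s u -> u = o \/ u = t k.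
Proof.
move=> sk su; case E: (cl u) => [l|].
  by move: su; rewrite (adj_leg_leg sk E).
case/spider_cover: E su => [->|[l ->]]; first by left.
by rewrite adj_sym (adj_tip_leg _ sk) => /eqP ->; right.
Qed.

Lemma adj_leg_hub s k : cl s = Some k -> adj s o.
Proof. by move=> sk; rewrite adj_sym (adj_hub_leg sk). Qed.

Lemma adj_leg_tip s k : cl s = Some k -> adj s (t k).
Proof. by move=> sk; rewrite adj_sym (adj_tip_leg _ sk) eqxx. Qed.

Lemma adj_tip_leg1 s k : cl s = Some k -> adj (t k) s.
Proof. by move=> sk; rewrite (adj_tip_leg _ sk) eqxx. Qed.

Section Colour.
Variables (N : nat) (K : {set G} -> {set 'I_N}) (L : {set G} -> nat -> Prop).
Hypothesis KL : forall e, e \in edges G -> forall x, x \in K e -> L e x.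
Variables (a b : G -> 'I_N) (tau : 'I_m -> 'I_m -> 'I_N).
Hypothesis aK : forall s k, cl s = Some k -> a s \in K [set o; s].
Hypothesis bK : forall s k, cl s = Some k -> b s \in K [set t k; s].
Hypothesis tK : forall k l, k != l -> tau k l \in K [set t k; t l].
Hypothesis tS : forall k l, tau k l = tau l k.

Lemma spider_colouring : exists c : {set G} -> nat,
  [/\ list_edge_colouring L c,
      forall s k, cl s = Some k -> c [set o; s] = a s /\ c [set s; o] = a s,
      forall s k, cl s = Some k -> c [set t k; s] = b s /\ c [set s; t k] = b s &
      forall k l, c [set t k; t l] = tau k l].
Proof.
pose ix x := [pick k | t k == x].
have ixE k : ix (t k) = Some k.
  by rewrite /ix; case: pickP => [l /eqP/tip_inj -> //|/(_ k)]; rewrite eqxx.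
pose g (x y : G) : 'I_N := match cl x, cl y with
  | Some _, None => if y == o then a x else b x
  | None, Some _ => if x == o then a y else b y
  | None, None => if (ix x, ix y) is (Some k, Some l) then tau k l else a o
  | Some _, Some _ => a o end.
have gs x y : g x y = g y x.
  rewrite /g; case: (cl x) => [k|]; case: (cl y) => [l|] //.
  by case: (ix x) => [k|]; case: (ix y) => [l|].
have g1 s k : cl s = Some k -> g o s = a s by move=> sk; rewrite /g sk cls_hub eqxx.
have g2 s k : cl s = Some k -> g (t k) s = b s.
  by move=> sk; rewrite /g sk cls_tip (negbTE (tip_hub S k)).
have g3 k l : g (t k) (t l) = tau k l by rewrite /g !cls_tip !ixE.
have [|c [cL cE]] := @lift_list_colouring G N K L g KL gs.
  have leg x k y : cl x = Some k -> adj x y -> g x y \in K [set x; y].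
    move=> xk xy; have [->|->] := leg_adj xk xy.
      by rewrite gs (g1 _ _ xk) setUC (aK xk).
    by rewrite gs (g2 _ _ xk) setUC (bK xk).
  move=> x y xy; case Ex: (cl x) => [k|]; first exact: leg Ex xy.
  case Ey: (cl y) => [l|]; first by rewrite gs setUC; apply: leg Ey _; rewrite adj_sym.
  case/spider_cover: Ex xy => [->|[k ->]]; case/spider_cover: Ey => [->|[l ->]].
  - by rewrite adj_irr.
  - by rewrite adj_hub_tip.
  - by rewrite adj_sym adj_hub_tip.
  - by rewrite adj_tip_tip g3 => /tK.
exists c; split=> // [s k sk|s k sk|k l].
- by rewrite [[set s; o]]setUC cE (g1 _ _ sk).
- by rewrite [[set s; t k]]setUC cE (g2 _ _ sk).
- by rewrite cE g3.
Qed.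
End Colour.

Lemma spider_connected (c : {set G} -> nat) :
  (forall k, joined c o (t k)) ->
  (forall s s' k l, cl s = Some k -> cl s' = Some l -> s != s' -> joined c s s') ->
  (forall s k l, cl s = Some k -> k != l -> joined c s (t l)) -> rainbow_connected c.
Proof.
move=> h1 h2 h3 x y; change (joined c x y).
have refl z : joined c z z by exists [::]; split.
have leg z w k : cl z = Some k -> joined c z w.
  move=> zk; case Ew: (cl w) => [l|].
    case: (eqVneq z w) => [->|zw]; [exact: refl | exact: h2 zk Ew zw].
  case/spider_cover: Ew => [->|[l ->]]; first exact/joined1/(adj_leg_hub zk).
  case: (eqVneq k l) => [<-|kl]; [exact/joined1/(adj_leg_tip zk) | exact: h3 zk kl].
case Ex: (cl x) => [k|]; first exact: leg Ex.
case Ey: (cl y) => [k|]; first by apply: joined_sym; apply: leg Ey.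
case/spider_cover: Ex => [->|[k ->]]; case/spider_cover: Ey => [->|[l ->]].
- exact: refl.
- exact: h1.
- exact/joined_sym/h1.
- case: (eqVneq k l) => [->|kl]; [exact: refl | by apply: joined1; rewrite adj_tip_tip].
Qed.

(** * Spiders with lists of size four *)

Section FourColours.
Variables (c : {set G} -> nat) (a b : G -> nat) (tau : 'I_m -> 'I_m -> nat) (sp : 'I_m -> G).
Hypothesis cA : forall s k, cl s = Some k -> c [set o; s] = a s /\ c [set s; o] = a s.
Hypothesis cB : forall s k, cl s = Some k -> c [set t k; s] = b s /\ c [set s; t k] = b s.
Hypothesis cT : forall k l, c [set t k; t l] = tau k l.
Hypothesis spc : forall k, cl (sp k) = Some k.
Hypothesis spa : forall k l, k != l -> a (sp k) != a (sp l).
Hypothesis spb : forall k, a (sp k) != b (sp k).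
Hypothesis spt : forall k l, k != l ->
  [&& tau k l != a (sp k), tau k l != b (sp k), tau k l != a (sp l) & tau k l != b (sp l)].
Hypothesis gen : forall s k, cl s = Some k -> s != sp k ->
  [&& a s != a (sp k), a s != b (sp k), b s != a (sp k), b s != b (sp k) & a s != b s].

(** No other leg of class [k] uses a colour of [sp k], so when a short route fails because two
    colours agree, the detour along [sp k] between hub and tip has four different colours. *)
Lemma connected4 : rainbow_connected c.
Proof.
have cA1 s k (h : cl s = Some k) := (cA h).1; have cA2 s k (h : cl s = Some k) := (cA h).2.
have cB1 s k (h : cl s = Some k) := (cB h).1; have cB2 s k (h : cl s = Some k) := (cB h).2.
apply: spider_connected.
- move=> k; apply: (joined2 (u := sp k)); rewrite ?(cA1 _ _ (spc k)) ?(cB2 _ _ (spc k)) //.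
  + by rewrite eq_sym tip_hub.
  + exact: adj_hub_leg (spc k).
  + exact: adj_leg_tip (spc k).
- have cross s s' k l : cl s = Some k -> cl s' = Some l -> k != l -> s != sp k -> joined c s s'.
    move=> sk sl kl ssp; have ss' := leg_neq sk sl kl.
    case: (eqVneq (a s) (a s')) => [aE|an]; last first.
      by apply: (joined2 (u := o)) => //; rewrite ?(adj_leg_hub sk) ?(adj_hub_leg sl) ?(cA2 _ _ sk) ?(cA1 _ _ sl).
    have /and5P[h1 h2 h3 h4 h5] := gen sk ssp.
    apply: (joined4 (u := t k) (v := sp k) (w := o)).
    + rewrite /= !inE !negb_or ssp ss' (leg_tip _ sk) (leg_hub sk) tip_hub (leg_hub (spc k)).
      by rewrite ![t k == _]eq_sym !(leg_tip _ (spc k)) (leg_tip _ sl) (leg_neq (spc k) sl kl) eq_sym (leg_hub sl).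
    + exact: adj_leg_tip sk.
    + exact: adj_tip_leg1 (spc k).
    + exact: adj_leg_hub (spc k).
    + exact: adj_hub_leg sl.
    rewrite (cB2 _ _ sk) (cB1 _ _ (spc k)) (cA2 _ _ (spc k)) (cA1 _ _ sl) -aE.
    by rewrite /= !inE !negb_or h4 h3 [b s == _]eq_sym h5 [b (sp k) == a (sp k)]eq_sym spb [b (sp k) == _]eq_sym h2 eq_sym h1.
  move=> s s' k l sk sl ss'; case: (eqVneq k l) => [kl|kl]; last first.
    case: (eqVneq s (sp k)) => [sE|/(cross _ _ _ _ sk sl kl) //].
    case: (eqVneq s' (sp l)) => [s'E|ns']; last first.
      by apply: joined_sym; apply: (cross _ _ _ _ sl sk) => //; rewrite eq_sym.
    apply: (joined2 (u := o)) => //; rewrite ?(adj_leg_hub sk) ?(adj_hub_leg sl) ?(cA2 _ _ sk) ?(cA1 _ _ sl) //.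
    by rewrite sE s'E spa.
  subst l; case: (eqVneq (a s) (a s')) => [aE|an]; last first.
    by apply: (joined2 (u := o)) => //; rewrite ?(adj_leg_hub sk) ?(adj_hub_leg sl) ?(cA2 _ _ sk) ?(cA1 _ _ sl).
  case: (eqVneq (b s) (b s')) => [bE|bn]; last first.
    by apply: (joined2 (u := t k)) => //; rewrite ?(adj_leg_tip sk) ?(adj_tip_leg1 sl) ?(cB2 _ _ sk) ?(cB1 _ _ sl).
  case: (eqVneq s (sp k)) => [sE|n1].
    have s'n : s' != sp k by rewrite -sE eq_sym.
    by have /and5P[h1 _ _ _ _] := gen sl s'n; move: h1; rewrite -aE sE eqxx.
  have /and5P[h1 h2 h3 h4 h5] := gen sk n1.
  case: (eqVneq s' (sp k)) => [s'E|n2]; first by move: h1; rewrite aE s'E eqxx.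
  apply: (joined4 (u := o) (v := sp k) (w := t k)).
  + rewrite /= !inE !negb_or n1 ss' (leg_tip _ sk) (leg_hub sk) (leg_tip _ (spc k)).
    rewrite ![o == _]eq_sym (leg_hub (spc k)) tip_hub (leg_hub sl).
    by rewrite [sp k == s']eq_sym n2 eq_sym (leg_tip _ sl).
  + exact: adj_leg_hub sk.
  + exact: adj_hub_leg (spc k).
  + exact: adj_leg_tip (spc k).
  + exact: adj_tip_leg1 sl.
  rewrite (cA2 _ _ sk) (cA1 _ _ (spc k)) (cB2 _ _ (spc k)) (cB1 _ _ sl) -bE.
  by rewrite /= !inE !negb_or h1 h2 h5 spb ![_ == b s]eq_sym h3 h4.
- move=> s k l sk kl.
  case: (eqVneq (b s) (tau k l)) => [bE|bn]; last first.
    apply: (joined2 (u := t k)); rewrite ?(cB2 _ _ sk) ?cT ?adj_tip_tip //.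
    - exact: leg_tip sk.
    - exact: adj_leg_tip sk.
  have /and4P[k1 k2 _ _] := spt kl.
  case: (eqVneq s (sp k)) => [sE|n1]; first by move: k2; rewrite -bE sE eqxx.
  have /and5P[h1 h2 h3 h4 h5] := gen sk n1.
  apply: (joined4 (u := o) (v := sp k) (w := t k)).
  + rewrite /= !inE !negb_or n1 !(leg_tip _ sk) (leg_hub sk) !(leg_tip _ (spc k)).
    by rewrite ![o == _]eq_sym (leg_hub (spc k)) !tip_hub (inj_eq (@tip_inj _ _ S)) kl.
  + exact: adj_leg_hub sk.
  + exact: adj_hub_leg (spc k).
  + exact: adj_leg_tip (spc k).
  + by rewrite adj_tip_tip.
  rewrite (cA2 _ _ sk) (cA1 _ _ (spc k)) (cB2 _ _ (spc k)) cT -bE.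
  by rewrite /= !inE !negb_or h1 h2 h5 spb ![_ == b s]eq_sym h3 h4.
Qed.
End FourColours.
End SpiderColouring.

Lemma short_rainbow (G : sgraph) (c : {set G} -> nat) (x y : G) p : rainbow_path c x y p -> size p <= 3 ->
  [\/ x = y, adj x y, exists u, [/\ adj x u, adj u y & c [set x; u] <> c [set u; y]] |
      size p = 3 /\ exists u v, [/\ adj x u, adj u v, adj v y & [/\ c [set x; u] <> c [set u; v],
        c [set x; u] <> c [set v; y] & c [set u; v] <> c [set v; y]]]].
Proof.
case: p => [|u [|v [|w [|z q]]]] [] /= => [_ E _ _ _|h E _ _ _|h E _ h' _|h E _ h' _|//].
- exact: Or41.
- by apply: Or42; rewrite -E; case/andP: h.
- case/and3P: h => xu uv _; subst v; apply: Or43; exists u; split=> //.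
  by move: h'; rewrite inE andbT => /eqP.
- case/and4P: h => xu uv vw _; subst w; apply: Or44; split=> //; exists u, v; split=> //.
  by move: h'; rewrite !inE negb_or andbT => /andP[/andP[/eqP ? /eqP ?] /eqP ?].
Qed.

Section SpiderBounds.
Variables (m : nat) (G : sgraph) (S : spider m G).
Local Notation o := (hub S).
Local Notation t := (tip S).
Local Notation cl := (cls S).

Theorem spider_four_lists : 0 < m <= 3 -> forall L : {set G} -> nat -> Prop,
  edge_list_assignment 4 L -> exists c, list_edge_colouring L c /\ rainbow_connected c.
Proof.
case/andP=> m0 m3 L /finite_lists[N [K [K4 KL]]].
have pos e : 0 < #|K e| by rewrite K4.
have [z _] := card_gt0P (pos set0).
have [sp spc] : exists sp : 'I_m -> G, forall k, cl (sp k) = Some k.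
  by apply: (fin_all_exists (P := fun k s => cl s = Some k)) => k; apply: cls_onto.
have [al [ali alK]] : exists al : 'I_m -> 'I_N, injective al /\ forall k, al k \in K [set o; sp k].
  apply: (hall z) => J; have [->|/set0Pn[k kJ]] := eqVneq J set0; first by rewrite cards0.
  apply: leq_trans (_ : 4 <= _); last by rewrite -(K4 [set o; sp k]); apply/subset_leq_card/(bigcup_sup k).
  by apply: leq_trans (max_card _) _; rewrite card_ord (leq_trans m3).
have [T TP] : exists T : {set G} -> 'I_N, forall e k l, k != l -> e = [set t k; t l] ->
    [/\ T e \in K e, T e != al k & T e != al l].
  apply: (fin_all_exists (P := fun e x => forall k l, k != l -> e = [set t k; t l] ->
    [/\ x \in K e, x != al k & x != al l])) => e.
  case: (boolP [exists k, exists l, (k != l) && (e == [set t k; t l])]).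
    case/existsP=> k /existsP[l /andP[kl /eqP eE]].
    have [|x xK /andP[xk xl]] := @pick_notin2 _ (K e) (al k) (al l); first by rewrite K4.
    exists x => k' l' kl' eE'; move: eE'; rewrite eE => /set2_eq[[]|[]] /tip_inj E /tip_inj E'; subst;
    by split; rewrite -?eE.
  move=> h; exists z => k l kl eE; case/negP: h; apply/existsP; exists k; apply/existsP; exists l.
  by rewrite kl eE eqxx.
pose tau k l := T [set t k; t l].
have tauS k l : tau k l = tau l k by rewrite /tau setUC.
have tauP k l (kl : k != l) := TP _ k l kl erefl.
(* One colour [al k] and the colours of at most two edges between tips are to be avoided, which a
   list of size 4 permits. *)
have [be beP] : exists be : 'I_m -> 'I_N, forall k,
    [/\ be k \in K [set t k; sp k], be k != al k & forall l, k != l -> be k != tau k l].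
  apply: (fin_all_exists (P := fun k x => [/\ x \in K [set t k; sp k], x != al k & forall l, k != l -> x != tau k l])) => k.
  have [|x xK xn] := @set_pick _ (K [set t k; sp k]) (al k |: [set tau k l | l in [set~ k]]).
    rewrite K4 ltnS cardsU1 (leq_trans (leq_add (leq_b1 _) (leq_imset_card _ _))) //.
    by rewrite cardsC1 card_ord; move: m0 m3; clear; lia.
  move: xn; rewrite !inE negb_or => /andP[xa xt]; exists x; split=> // l kl.
  by apply: contraNneq xt => ->; apply: imset_f; rewrite !inE eq_sym.
have [a aP] : exists a : G -> 'I_N, forall s k, cl s = Some k ->
    [/\ a s \in K [set o; s], s = sp k -> a s = al k & s != sp k -> (a s != al k) && (a s != be k)].
  apply: (fin_all_exists (P := fun s x => forall k, cl s = Some k -> [/\ x \in K [set o; s],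
    s = sp k -> x = al k & s != sp k -> (x != al k) && (x != be k)])) => s.
  case E: (cl s) => [k|]; last by exists z.
  case: (eqVneq s (sp k)) => [sE|sn].
    by exists (al k) => l [<-]; split=> //; [rewrite sE | rewrite -sE eqxx].
  have [|x xK xn] := @pick_notin2 _ (K [set o; s]) (al k) (be k); first by rewrite K4.
  by exists x => l [<-]; split=> // sE; move: sn; rewrite sE eqxx.
have [b bP] : exists b : G -> 'I_N, forall s k, cl s = Some k ->
    [/\ b s \in K [set t k; s], s = sp k -> b s = be k &
        s != sp k -> [&& b s != al k, b s != be k & b s != a s]].
  apply: (fin_all_exists (P := fun s x => forall k, cl s = Some k -> [/\ x \in K [set t k; s],
    s = sp k -> x = be k & s != sp k -> [&& x != al k, x != be k & x != a s]])) => s.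
  case E: (cl s) => [k|]; last by exists z.
  case: (eqVneq s (sp k)) => [sE|sn].
    by exists (be k) => l [<-]; split=> //; [rewrite sE; case: (beP k) | rewrite -sE eqxx].
  have [|x xK xn] := @set_pick _ (K [set t k; s]) [set al k; be k; a s].
    by rewrite K4 ltnS card_set3_le.
  exists x => l [<-]; split=> // [sE|_]; first by move: sn; rewrite sE eqxx.
  by move: xn; rewrite !inE !negb_or -andbA.
have [|||c [cL cA cB cT]] := @spider_colouring m G S N K L KL a b tau _ _ _ tauS.
- by move=> s k /aP[].
- by move=> s k /bP[].
- by move=> k l /tauP[].
have aE k : a (sp k) = al k by have [_ ->] := aP _ _ (spc k).
have bE k : b (sp k) = be k by have [_ ->] := bP _ _ (spc k).
exists c; split=> //.
apply: (@connected4 m G S c (fun s => a s) (fun s => b s) (fun k l => tau k l) sp) => //.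
- by move=> k l kl; rewrite !aE (inj_eq val_inj) (inj_eq ali).
- by move=> k; rewrite aE bE (inj_eq val_inj) eq_sym; case: (beP k).
- move=> k l kl; rewrite !aE !bE !(inj_eq val_inj); have [_ -> ->] := tauP k l kl.
  have [_ _ /(_ l kl) h1] := beP k; have [_ _ /(_ k) h2] := beP l.
  by rewrite eq_sym h1 tauS eq_sym h2 // eq_sym.
- move=> s k sk sn; rewrite !aE !bE !(inj_eq val_inj).
  have [_ _ /(_ sn) /andP[-> ->]] := aP s k sk; have [_ _ /(_ sn) /and3P[-> -> h]] := bP s k sk.
  by rewrite eq_sym.
Qed.

Variable c : {set G} -> nat.
Hypothesis rc : rainbow_connected c.

Lemma mem_colour x y : adj x y -> c [set x; y] \in undup [seq c e | e <- enum (edges G)].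
Proof. by move=> xy; rewrite mem_undup; apply: map_f; rewrite mem_enum mem_edges. Qed.

(** With two colours, non-adjacent vertices need a rainbow path of length 2. For a suitable leg in
    each class, the hub edge and the edge between the tips both differ from the tip edge, so they
    agree. Two legs of different classes then have equal hub colours, although the hub is their only
    common neighbour. *)
Lemma spider_ge3 (k l : 'I_m) : k != l -> 3 <= num_colours c.
Proof.
move=> kl; rewrite leqNgt; apply/negP; rewrite ltnS => n2.
have short x y : [\/ x = y, adj x y | exists u, [/\ adj x u, adj u y & c [set x; u] <> c [set u; y]]].
  have [p pP] := rc x y; have p2 := leq_trans (size_le_num_colours pP) n2.
  have [|?|?|?|[p3 _]] := short_rainbow pP; first exact: leqW.
  - exact: Or31.
  - exact: Or32.
  - exact: Or33.
  - by rewrite p3 in p2.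
have leg_tip2 s i j : cl s = Some i -> i != j -> c [set t i; s] != c [set t i; t j].
  move=> si ij; case: (short s (t j)) => [E|st|[u [su ut /eqP h]]].
  - by move: (leg_tip j si); rewrite E eqxx.
  - by move: st; rewrite adj_sym (adj_tip_leg _ si) eq_sym (negbTE ij).
  - have [uE|uE] := leg_adj si su; subst u; first by move: ut; rewrite adj_hub_tip.
    by rewrite [[set t i; s]]setUC.
have hub_tip2 i : exists s, cl s = Some i /\ c [set o; s] != c [set t i; s].
  case: (short o (t i)) => [E|st|[u [su ut /eqP h]]].
  - by move: (tip_hub S i); rewrite E eqxx.
  - by move: st; rewrite adj_hub_tip.
  - case Eu: (cl u) => [j|].
      move: ut; rewrite adj_sym (adj_tip_leg _ Eu) => /eqP ij; subst j.
      by exists u; split=> //; rewrite [[set t i; u]]setUC.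
    case/spider_cover: Eu su => [->|[j ->]]; first by rewrite adj_irr.
    by rewrite adj_hub_tip.
have legs2 s s' i j : cl s = Some i -> cl s' = Some j -> i != j -> c [set o; s] != c [set o; s'].
  move=> si sj ij; case: (short s s') => [E|st|[u [su ut /eqP h]]].
  - by move: (leg_neq si sj ij); rewrite E eqxx.
  - by move: st; rewrite (adj_leg_leg si sj).
  - have [uE|uE] := leg_adj si su; subst u; first by rewrite [[set o; s]]setUC.
    by move: ut; rewrite (adj_tip_leg _ sj) (negbTE ij).
have [s [sk hs]] := hub_tip2 k; have [s' [sl hs']] := hub_tip2 l.
have t1 := leg_tip2 _ _ _ sk kl; have t2 := leg_tip2 s' l k sl; rewrite eq_sym kl in t2; have {}t2 := t2 isT.
rewrite [[set t l; t k]]setUC in t2.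
have a3 (x y z : nat) : x \in undup [seq c e | e <- enum (edges G)] -> y \in undup [seq c e | e <- enum (edges G)] ->
    z \in undup [seq c e | e <- enum (edges G)] -> x != y -> y != z -> x = z.
  move=> hx hy hz xy yz; apply/eqP; apply: contraT => xz.
  have : size [:: x; y; z] <= num_colours c.
    apply: uniq_leq_size; first by rewrite /= !inE negb_or xy xz yz.
    by move=> w; rewrite !inE => /or3P[] /eqP ->.
  by move: n2; clear => /=; lia.
have mt : c [set t k; t l] \in undup [seq c e | e <- enum (edges G)] by apply: mem_colour; rewrite adj_tip_tip.
have e1 := a3 _ _ _ (mem_colour (adj_hub_leg sk)) (mem_colour (adj_tip_leg1 sk)) mt hs t1.
have e2 := a3 _ _ _ (mem_colour (adj_hub_leg sl)) (mem_colour (adj_tip_leg1 sl)) mt hs' t2.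
by have := legs2 s s' k l sk sl kl; rewrite e1 e2 eqxx.
Qed.

Hypothesis c3 : num_colours c <= 3.

Lemma short3 x y :
  [\/ x = y, adj x y, exists u, [/\ adj x u, adj u y & c [set x; u] <> c [set u; y]] |
      exists u v, [/\ adj x u, adj u v, adj v y & [/\ c [set x; u] <> c [set u; v],
        c [set x; u] <> c [set v; y] & c [set u; v] <> c [set v; y]]]].
Proof.
have [p pP] := rc x y; have p3 := leq_trans (size_le_num_colours pP) c3.
have [?|?|?|[_ ?]] := short_rainbow pP p3; [exact: Or41|exact: Or42|exact: Or43|exact: Or44].
Qed.

Lemma leg_leg_same s s' k : cl s = Some k -> cl s' = Some k -> s != s' ->
  c [set o; s] <> c [set o; s'] \/ c [set t k; s] <> c [set t k; s'].
Proof.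
move=> sk sl ss'; case: (short3 s s') => [E|st|[u [su us h]]|[u [v [su uv vs _]]]].
- by move: ss'; rewrite E eqxx.
- by move: st; rewrite (adj_leg_leg sk sl).
- have [uE|uE] := leg_adj sk su; subst u; [left | right]; move=> h'; apply: h; by rewrite [[set s; _]]setUC.
- rewrite adj_sym in vs; have [uE|uE] := leg_adj sk su; have [vE|vE] := leg_adj sl vs;
  by move: uv; rewrite uE vE ?adj_irr ?adj_hub_tip // adj_sym adj_hub_tip.
Qed.

Lemma leg_leg_cross s s' k l : cl s = Some k -> cl s' = Some l -> k != l ->
  c [set o; s] = c [set o; s'] -> [/\ c [set t k; s] <> c [set t l; s'],
    c [set t k; s] <> c [set t k; t l] & c [set t k; t l] <> c [set t l; s']].
Proof.
move=> sk sl kl cE; case: (short3 s s') => [E|st|[u [su us h]]|[u [v [su uv vs [h1 h2 h3]]]]].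
- by move: (leg_neq sk sl kl); rewrite E eqxx.
- by move: st; rewrite (adj_leg_leg sk sl).
- have [uE|uE] := leg_adj sk su; subst u; first by case: h; rewrite [[set s; _]]setUC.
  by move: us; rewrite (adj_tip_leg _ sl) (negbTE kl).
- rewrite adj_sym in vs; have [uE|uE] := leg_adj sk su; have [vE|vE] := leg_adj sl vs; subst u v.
  + by move: uv; rewrite adj_irr.
  + by move: uv; rewrite adj_hub_tip.
  + by move: uv; rewrite adj_sym adj_hub_tip.
  + by rewrite [[set t k; s]]setUC; split.
Qed.

(** With exactly two tips there is no route through a third one, so a path of length 3 must pass the
    hub and a leg of the other class. *)
Lemma leg_tip_other s k l : cl s = Some k -> k != l -> (forall j, (j == k) || (j == l)) ->
  c [set t k; s] <> c [set t k; t l] \/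
  exists s', [/\ cl s' = Some l, c [set o; s] <> c [set o; s'], c [set o; s] <> c [set t l; s'] &
    c [set o; s'] <> c [set t l; s']].
Proof.
move=> sk kl two; case: (short3 s (t l)) => [E|st|[u [su ut h]]|[u [v [su uv vt [h1 h2 h3]]]]].
- by move: (leg_tip l sk); rewrite E eqxx.
- by move: st; rewrite adj_sym (adj_tip_leg _ sk) eq_sym (negbTE kl).
- left; have [uE|uE] := leg_adj sk su; subst u; first by move: ut; rewrite adj_hub_tip.
  by rewrite [[set t k; s]]setUC.
right; case Ev: (cl v) => [j|].
  have jl : j = l by move: vt; rewrite adj_sym (adj_tip_leg _ Ev) => /eqP ->.
  subst j; exists v; have [uE|uE] := leg_adj sk su; subst u; last first.
    by move: uv; rewrite (adj_tip_leg _ Ev) (negbTE kl).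
  by rewrite [[set o; s]]setUC [[set t l; v]]setUC; split.
case/spider_cover: Ev => [vE|[j vE]]; subst v; first by move: vt; rewrite adj_hub_tip.
case/orP: (two j) => /eqP jE; subst j; last by move: vt; rewrite adj_irr.
have [uE|uE] := leg_adj sk su; subst u; first by move: uv; rewrite adj_hub_tip.
by move: uv; rewrite adj_irr.
Qed.

Lemma colour_map : exists col : {set G} -> 'I_3, forall e e', e \in edges G -> e' \in edges G ->
  col e = col e' <-> c e = c e'.
Proof.
pose U := undup [seq c e | e <- enum (edges G)].
have mU e : e \in edges G -> c e \in U by move=> eG; rewrite mem_undup map_f // mem_enum.
have lt e : e \in edges G -> index (c e) U < 3.
  by move=> /mU eU; apply: leq_trans c3; rewrite index_mem.
exists (fun e => inord (index (c e) U)) => e e' eG e'G; split=> [|-> //].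
move/(congr1 val); rewrite /= !inordK ?lt // => E.
by rewrite -(nth_index 0 (mU _ eG)) E nth_index ?mU.
Qed.
End SpiderBounds.

(** * Spiders with lists of size three *)

Section Connected.
Variables (m : nat) (G : sgraph) (S : spider m G).
Local Notation o := (hub S).
Local Notation t := (tip S).
Local Notation cl := (cls S).
Variables (c : {set G} -> nat) (a b : G -> nat).
Hypothesis cA : forall s k, cl s = Some k -> c [set o; s] = a s /\ c [set s; o] = a s.
Hypothesis cB : forall s k, cl s = Some k -> c [set t k; s] = b s /\ c [set s; t k] = b s.
Hypothesis same : forall s s' k, cl s = Some k -> cl s' = Some k -> a s = a s' -> b s = b s' -> s = s'.

Let cA1 s k (h : cl s = Some k) := (cA h).1.
Let cA2 s k (h : cl s = Some k) := (cA h).2.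
Let cB1 s k (h : cl s = Some k) := (cB h).1.
Let cB2 s k (h : cl s = Some k) := (cB h).2.

Lemma joined_legs s s' k l : cl s = Some k -> cl s' = Some l -> s != s' ->
  (k != l -> a s = a s' -> [&& b s != c [set t k; t l], b s != b s' & c [set t k; t l] != b s']) ->
  joined c s s'.
Proof.
move=> sk sl ss' h; case: (eqVneq (a s) (a s')) => [aE|an]; last first.
  by apply: (joined2 (u := o)) => //; rewrite ?(adj_leg_hub sk) ?(adj_hub_leg sl) ?(cA2 sk) ?(cA1 sl).
case: (eqVneq k l) => [kl|kl].
  subst l; have bn : b s != b s' by apply: contraNneq ss' => /(same sk sl aE) ->.
  by apply: (joined2 (u := t k)) => //; rewrite ?(adj_leg_tip sk) ?(adj_tip_leg1 sl) ?(cB2 sk) ?(cB1 sl).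
apply: (joined3 (u := t k) (v := t l)) => //.
- exact: leg_tip sk.
- by rewrite eq_sym (leg_tip _ sl).
- exact: adj_leg_tip sk.
- by rewrite adj_tip_tip.
- exact: adj_tip_leg1 sl.
- by rewrite (cB2 sk) (cB1 sl) h.
Qed.

Lemma joined_leg_tip s k l : cl s = Some k -> k != l -> b s != c [set t k; t l] -> joined c s (t l).
Proof.
move=> sk kl h; apply: (joined2 (u := t k)); rewrite ?adj_tip_tip ?(cB2 sk) //.
- exact: leg_tip sk.
- exact: adj_leg_tip sk.
Qed.

Lemma joined_hub_tip s k : cl s = Some k -> a s != b s -> joined c o (t k).
Proof.
move=> sk h; apply: (joined2 (u := s)); rewrite ?(cA1 sk) ?(cB2 sk) //.
- by rewrite eq_sym tip_hub.
- exact: adj_hub_leg sk.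
- exact: adj_leg_tip sk.
Qed.

Lemma joined_hub_tip_far s k l : cl s = Some k -> k != l ->
  [&& a s != b s, a s != c [set t k; t l] & b s != c [set t k; t l]] -> joined c o (t l).
Proof.
move=> sk kl h; apply: (joined3 (u := s) (v := t k)); rewrite ?(cA1 sk) ?(cB2 sk) ?adj_tip_tip //.
- by rewrite eq_sym tip_hub.
- by rewrite eq_sym tip_hub.
- exact: leg_tip sk.
- exact: adj_hub_leg sk.
- exact: adj_leg_tip sk.
Qed.

Lemma joined_leg_hub_tip s s' k l : cl s = Some k -> cl s' = Some l -> k != l ->
  [&& a s != a s', a s != b s' & a s' != b s'] -> joined c s (t l).
Proof.
move=> sk sl kl h; apply: (joined3 (u := o) (v := s')); rewrite ?(cA2 sk) ?(cA1 sl) ?(cB2 sl) //.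
- exact: leg_tip sk.
- exact: leg_neq sk sl kl.
- by rewrite eq_sym tip_hub.
- exact: adj_leg_hub sk.
- exact: adj_hub_leg sl.
- exact: adj_leg_tip sl.
Qed.
End Connected.

Section ThreeTips.
Variables (G : sgraph) (S : spider 3 G).
Local Notation o := (hub S).
Local Notation t := (tip S).
Local Notation cl := (cls S).

Lemma connected3 (c : {set G} -> nat) (a b : G -> nat) (tau : 'I_3 -> nat) :
  (forall s k, cl s = Some k -> c [set o; s] = a s /\ c [set s; o] = a s) ->
  (forall s k, cl s = Some k -> c [set t k; s] = b s /\ c [set s; t k] = b s) ->
  (forall i j k, i != j -> k != i -> k != j -> c [set t i; t j] = tau k) -> injective tau ->
  (forall s s' k, cl s = Some k -> cl s' = Some k -> a s = a s' -> b s = b s' -> s = s') ->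
  (forall s s' i j k, cl s = Some i -> cl s' = Some j -> i != j -> k != i -> k != j ->
     a s = a s' -> b s != b s' /\ b s != tau k) ->
  (forall k, exists s, cl s = Some k /\
     (a s != b s \/ exists s' l, [/\ cl s' = Some l, l != k & a s' = a s])) ->
  rainbow_connected c.
Proof.
move=> cA cB cT ti same cross far.
have third (i j : 'I_3) : exists k, k != i /\ k != j.
  have [|k _ /andP[]] := @pick_notin2 _ [set: 'I_3] i j; first by rewrite cardsT card_ord.
  by exists k.
apply: (spider_connected (S := S)).
- move=> k; have [s [sk [h|[s' [l [sl lk aE]]]]]] := far k; first exact: (joined_hub_tip cA cB sk h).
  (* If the hub and tip colours of [s] agree, the leg [s'] with the same hub colour leads to tip [l]
     and from there to tip [k]; the conditions on the shared pair make this path rainbow. *)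
  case: (eqVneq (a s) (b s)) => [ab|h]; last exact: (joined_hub_tip cA cB sk h).
  have [j [jk jl]] := third k l.
  have [h1 h2] := cross s' s l k j sl sk lk jl jk aE.
  have [h3 h4] : b s != b s' /\ b s != tau j by apply: (cross s s' k l j) => //; rewrite eq_sym.
  apply: (joined_hub_tip_far cA cB sl lk); rewrite (cT l k j) // h2 aE ab h4.
  by rewrite eq_sym h1.
- move=> s s' k l sk sl ss'; apply: (joined_legs cA cB same sk sl ss') => kl aE.
  have [j [jk jl]] := third k l; rewrite (cT k l j) //.
  have [-> ->] := cross s s' k l j sk sl kl jk jl aE.
  have lk : l != k by rewrite eq_sym.
  by have [_ h] := cross s' s l k j sl sk lk jl jk (esym aE); rewrite eq_sym.
- move=> s k l sk kl; have [j [jk jl]] := third k l.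
  (* If the direct route fails, the one through all three tips has the colours [tau j], [tau l],
     [tau k], which differ by injectivity. *)
  case: (eqVneq (b s) (tau j)) => [bE|bn]; last by apply: (joined_leg_tip cB sk kl); rewrite (cT k l j).
  have kj : k != j by rewrite eq_sym.
  have lk : l != k by rewrite eq_sym.
  have lj : l != j by rewrite eq_sym.
  have e1 : c [set t k; t j] = tau l by apply: cT.
  have e2 : c [set t j; t l] = tau k by apply: cT.
  have [cb1 cb2] := cB s k sk.
  apply: (joined3 (u := t k) (v := t j)); rewrite ?adj_tip_tip ?e1 ?e2 ?cb2 ?bE ?(inj_eq ti) //.
  + exact: leg_tip sk.
  + exact: leg_tip sk.
  + by rewrite (inj_eq (@tip_inj _ _ S)).
  + exact: adj_leg_tip sk.
  + by rewrite jl jk lk.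
Qed.

Let leg : finType := {x : G | cl x != None}.
Let lc (s : leg) : 'I_3 := odflt ord0 (cl (val s)).
Let lcE (s : leg) : cl (val s) = Some (lc s).
Proof. by rewrite /lc; have := valP s; case: (cl (val s)). Qed.

Let opp (k : 'I_3) : {set G} := t @: [set~ k].
Let oppE i j k : i != j -> k != i -> k != j -> opp k = [set t i; t j].
Proof.
move=> ij ki kj; apply/setP=> x; rewrite !inE; apply/imsetP/orP.
  case=> l; rewrite !inE => lk ->; case: (eqVneq l i) => [->|li]; first by left.
  by right; rewrite (@third_ord k i j l) // eq_sym.
by case=> /eqP ->; [exists i | exists j]; rewrite // !inE eq_sym.
Qed.

Theorem spider3_three_lists (c0 : {set G} -> nat) : rainbow_connected c0 -> num_colours c0 <= 3 ->
  forall L : {set G} -> nat -> Prop, edge_list_assignment 3 L ->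
  exists c, list_edge_colouring L c /\ rainbow_connected c.
Proof.
move=> rc c3 L /finite_lists[N [K [K3 KL]]].
have [col colE] := colour_map c3.
have third (i j : 'I_3) : exists k, k != i /\ k != j.
  have [|k _ /andP[]] := @pick_notin2 _ [set: 'I_3] i j; first by rewrite cardsT card_ord.
  by exists k.
have eA (s : leg) : [set o; val s] \in edges G by apply/mem_edges/adj_hub_leg/lcE.
have eB (s : leg) : [set t (lc s); val s] \in edges G by apply/mem_edges/adj_tip_leg1/lcE.
have sol : solvable3 lc.
  apply: (@solvable3_of_three_colours leg lc (fun s => col [set o; val s])
    (fun s => col [set t (lc s); val s]) (fun k => col (opp k))).
  - move=> k; have [x xk] := cls_onto S k; have h : cl x != None by rewrite xk.
    exists (Sub x h : leg); have := lcE (Sub x h : leg); rewrite SubK xk; by case.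
  - move=> s s' lE /(colE _ _ (eA s) (eA s')) h1 h2; apply: val_inj; apply/eqP; apply: contraT => ss'.
    have [] := leg_leg_same rc c3 (lcE s) (etrans (lcE s') (congr1 Some (esym lE))) ss'; first by [].
    by case; rewrite {2}lE; apply/(colE _ _ (eB s) (eB s')).
  - move=> s s' k lE /(colE _ _ (eA s) (eA s')) h1 ks ks'.
    have [h2 h3 _] := leg_leg_cross rc c3 (lcE s) (lcE s') lE h1.
    split; first by apply/eqP=> /(colE _ _ (eB s) (eB s')).
    rewrite (oppE lE ks ks'); apply/eqP=> /colE h; apply: h3; apply: h => //.
    by apply: mem_edges; rewrite adj_tip_tip.
have [a [b [tau [aL bL tL [ti g1 g2]]]]] := sol _ (fun s => K [set o; val s])
  (fun s => K [set t (lc s); val s]) (fun k => K (opp k)) (fun s => K3 _) (fun s => K3 _) (fun k => K3 _).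
pose bad k := [forall s, (lc s == k) ==> (a s == b s) && [forall s', (a s' == a s) ==> (lc s' == k)]].
(* A class without a leg witnessing that hub and tip are joined has pairwise distinct, unshared
   hub colours, so its tip colours can be changed freely. *)
have [b' b'P] : exists b' : leg -> 'I_N, forall s, [/\ b' s \in K [set t (lc s); val s],
    ~~ bad (lc s) -> b' s = b s & bad (lc s) -> a s != b' s].
  apply: (fin_all_exists (P := fun s x => [/\ x \in K [set t (lc s); val s],
    ~~ bad (lc s) -> x = b s & bad (lc s) -> a s != x])) => s.
  case: (boolP (bad (lc s))) => hb; last by exists (b s).
  have [|x xK xa] := @pick_notin1 _ (K [set t (lc s); val s]) (a s); first by rewrite K3.
  by exists x; rewrite eq_sym.
have g1' s s' : lc s = lc s' -> a s = a s' -> b' s = b' s' -> s = s'.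
  move=> lE aE; have [_ n1 _] := b'P s; have [_ n2 _] := b'P s'.
  case: (boolP (bad (lc s))) => hb; last by rewrite n1 // n2 -?lE // => /(g1 _ _ lE aE).
  move=> _; apply: g1 => //; move/forallP: hb => hb.
  have := hb s; rewrite eqxx => /andP[/eqP <- _].
  by have := hb s'; rewrite -lE eqxx => /andP[/eqP <- _].
have g2' s s' k : lc s != lc s' -> a s = a s' -> k != lc s -> k != lc s' -> b' s != b' s' /\ b' s != tau k.
  move=> lE aE ks ks'; have nb u u' : lc u != lc u' -> a u = a u' -> ~~ bad (lc u).
    move=> lu au; apply/negP=> /forallP/(_ u); rewrite eqxx => /andP[_ /forallP/(_ u')].
    by rewrite au eqxx /= eq_sym (negbTE lu).
  have lE' : lc s' != lc s by rewrite eq_sym.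
  have [_ n1 _] := b'P s; have [_ n2 _] := b'P s'.
  by rewrite (n1 (nb _ _ lE aE)) (n2 (nb _ _ lE' (esym aE))); apply: g2.
have z := tau ord0.
pose A x := if insub x is Some s then a s else z.
pose B x := if insub x is Some s then b' s else z.
pose TT i j := if [pick k | (k != i) && (k != j)] is Some k then tau k else z.
have TTE i j k : i != j -> k != i -> k != j -> TT i j = tau k.
  move=> ij ki kj; rewrite /TT; case: pickP => [l /andP[li lj]|/(_ k)]; last by rewrite ki kj.
  by rewrite (@third_ord i j k l).
have asleg x k : cl x = Some k -> exists s : leg, [/\ x = val s, lc s = k, A x = a s & B x = b' s].
  move=> xk; have h : cl x != None by rewrite xk.
  pose s : leg := Sub x h; exists s; split; first by rewrite SubK.
  - by have := lcE s; rewrite SubK xk => -[].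
  - by rewrite /A insubT.
  - by rewrite /B insubT.
have [||||c [cL cA cB cT]] := @spider_colouring 3 G S N K L KL A B TT.
- by move=> x k /asleg[s [-> _ -> _]].
- by move=> x k /asleg[s [-> <- _ ->]]; case: (b'P s).
- by move=> i j ij; have [k [ki kj]] := third i j; rewrite (TTE i j k) // -(oppE ij ki kj).
- by move=> i j; rewrite /TT; congr (if _ is Some k then _ else _); apply: eq_pick => k; rewrite andbC.
exists c; split=> //.
apply: (@connected3 c (fun x => A x) (fun x => B x) (fun k => tau k)) => //.
- by move=> i j k ij ki kj; rewrite cT (TTE i j k).
- by move=> i j /val_inj/ti.
- move=> x y k /asleg[s [-> sk -> ->]] /asleg[s' [-> s'k -> ->]] /val_inj aE /val_inj bE.
  by congr val; apply: g1'; rewrite ?sk.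
- move=> x y i j k /asleg[s [-> si -> ->]] /asleg[s' [-> s'j -> ->]] ij ki kj /val_inj aE.
  by rewrite !(inj_eq val_inj); apply: g2'; rewrite ?si ?s'j.
move=> k; have [x xk] := cls_onto S k.
have [s [xs sk As Bs]] := asleg x k xk.
have AvalE (u : leg) : A (val u) = a u by rewrite /A valK.
have BvalE (u : leg) : B (val u) = b' u by rewrite /B valK.
case: (boolP (bad k)) => hb.
  exists x; split=> //; left; rewrite As Bs (inj_eq val_inj).
  by have [_ _ ->] := b'P s; rewrite ?sk.
have := hb; rewrite negb_forall => /existsP[u]; rewrite negb_imply negb_and => /andP[/eqP uk /orP[h|]].
  exists (val u); rewrite lcE uk AvalE BvalE (inj_eq val_inj); split=> //; left.
  by have [_ n1 _] := b'P u; rewrite n1 ?uk.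
rewrite negb_forall => /existsP[u']; rewrite negb_imply => /andP[/eqP au lu].
exists (val u); rewrite lcE uk; split=> //; right; exists (val u'), (lc u').
by rewrite lcE !AvalE au.
Qed.
End ThreeTips.

Section TwoTips.
Variables (G : sgraph) (S : spider 2 G).
Local Notation o := (hub S).
Local Notation t := (tip S).
Local Notation cl := (cls S).

Lemma connected2 (c : {set G} -> nat) (a b : G -> nat) (q : nat) :
  (forall s k, cl s = Some k -> c [set o; s] = a s /\ c [set s; o] = a s) ->
  (forall s k, cl s = Some k -> c [set t k; s] = b s /\ c [set s; t k] = b s) ->
  (forall k l, k != l -> c [set t k; t l] = q) ->
  (forall s s' k, cl s = Some k -> cl s' = Some k -> a s = a s' -> b s = b s' -> s = s') ->
  (forall s s' k l, cl s = Some k -> cl s' = Some l -> k != l -> a s = a s' ->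
     [&& b s != q, b s != b s' & q != b s']) ->
  (forall s k l, cl s = Some k -> k != l ->
     b s != q \/ exists s', cl s' = Some l /\ [&& a s != a s', a s != b s' & a s' != b s']) ->
  (forall k l, k != l -> (exists s, cl s = Some k /\ a s != b s) \/
     exists s, cl s = Some l /\ [&& a s != b s, a s != q & b s != q]) ->
  rainbow_connected c.
Proof.
move=> cA cB cT same cross legtip hubtip.
apply: (spider_connected (S := S)).
- move=> k; have [l kl] : exists l : 'I_2, k != l.
    by case: (eqVneq k ord0) => [->|]; [exists ord_max | exists ord0].
  have lk : l != k by rewrite eq_sym.
  have [[s [sk h]]|[s [sl h]]] := hubtip k l kl; first exact: (joined_hub_tip cA cB sk h).
  by apply: (joined_hub_tip_far cA cB sl lk); rewrite cT.
- move=> s s' k l sk sl ss'; apply: (joined_legs cA cB same sk sl ss') => kl aE.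
  by rewrite cT //; apply: cross sk sl kl aE.
- move=> s k l sk kl; have [h|[s' [sl h]]] := legtip s k l sk kl.
    by apply: (joined_leg_tip cB sk kl); rewrite cT.
  exact: (joined_leg_hub_tip cA cB sk sl kl h).
Qed.

Let A : finType := {x : G | cl x == Some ord0}.
Let B : finType := {x : G | cl x == Some ord_max}.
Let clA (i : A) : cl (val i) = Some ord0 := eqP (valP i).
Let clB (j : B) : cl (val j) = Some ord_max := eqP (valP j).

Let ord2 (k : 'I_2) : k = ord0 \/ k = ord_max.
Proof. by case: k => -[|[|//]] h; [left | right]; apply: val_inj. Qed.

Theorem spider2_three_lists (c0 : {set G} -> nat) : rainbow_connected c0 -> num_colours c0 <= 3 ->
  forall L : {set G} -> nat -> Prop, edge_list_assignment 3 L ->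
  exists c, list_edge_colouring L c /\ rainbow_connected c.
Proof.
move=> rc c3 L /finite_lists[N [K [K3 KL]]].
have [col colE] := colour_map c3.
have i01 : (ord0 : 'I_2) != ord_max by [].
have i10 : (ord_max : 'I_2) != ord0 by [].
have two0 (j : 'I_2) : (j == ord0) || (j == ord_max) by case: (ord2 j) => ->.
have two1 (j : 'I_2) : (j == ord_max) || (j == ord0) by rewrite orbC.
have eA (i : A) : [set o; val i] \in edges G by apply/mem_edges/adj_hub_leg/clA.
have eA' (i : A) : [set t ord0; val i] \in edges G by apply/mem_edges/adj_tip_leg1/clA.
have eB (j : B) : [set o; val j] \in edges G by apply/mem_edges/adj_hub_leg/clB.
have eB' (j : B) : [set t ord_max; val j] \in edges G by apply/mem_edges/adj_tip_leg1/clB.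
have eT : [set t ord0; t ord_max] \in edges G by apply: mem_edges; rewrite adj_tip_tip.
have subA x : cl x = Some ord0 -> exists i : A, val i = x.
  by move=> /eqP h; exists (Sub x h : A); rewrite SubK.
have subB x : cl x = Some ord_max -> exists j : B, val j = x.
  by move=> /eqP h; exists (Sub x h : B); rewrite SubK.
have [xA /subA[iA _]] := cls_onto S ord0; have [xB /subB[jB _]] := cls_onto S ord_max.
have ne e e' : e \in edges G -> e' \in edges G -> c0 e <> c0 e' -> col e != col e'.
  by move=> h h' n; apply/eqP=> /(colE _ _ h h').
have sol : solvable2 A B.
  apply: (@solvable2_of_three_colours A B (fun i => col [set o; val i]) (fun i => col [set t ord0; val i])
    (fun j => col [set o; val j]) (fun j => col [set t ord_max; val j]) (col [set t ord0; t ord_max])).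
  - by apply/card_gt0P; exists iA.
  - by apply/card_gt0P; exists jB.
  - move=> i i' /(colE _ _ (eA i) (eA i')) h1 /(colE _ _ (eA' i) (eA' i')) h2.
    by apply: val_inj; apply/eqP; apply: contraT => /(leg_leg_same rc c3 (clA i) (clA i'))[].
  - move=> i i' /(colE _ _ (eB i) (eB i')) h1 /(colE _ _ (eB' i) (eB' i')) h2.
    by apply: val_inj; apply/eqP; apply: contraT => /(leg_leg_same rc c3 (clB i) (clB i'))[].
  - move=> i j /(colE _ _ (eA i) (eB j)) h1.
    have [h2 h3 h4] := leg_leg_cross rc c3 (clA i) (clB j) i01 h1.
    by split; apply: ne => //; apply: nesym.
  - move=> i; have [h|[s' [/subB[j <-] h1 h2 h3]]] := leg_tip_other rc c3 (clA i) i01 two0.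
      by left; apply: ne.
    by right; exists j; rewrite !ne.
  - move=> j; have [h|[s' [/subA[i <-] h1 h2 h3]]] := leg_tip_other rc c3 (clB j) i10 two1.
      by left; apply: ne => //; rewrite [[set t ord0; t ord_max]]setUC.
    by right; exists i; rewrite !ne.
have [a [b [g [d [q [aL bL gL dL [qL [[s1 s2] s3 s4 s5 [s6 s7]]]]]]]]] := sol _
  (fun i => K [set o; val i]) (fun i => K [set t ord0; val i]) (fun j => K [set o; val j])
  (fun j => K [set t ord_max; val j]) (K [set t ord0; t ord_max])
  (fun s => K3 _) (fun s => K3 _) (fun s => K3 _) (fun s => K3 _) (K3 _).
pose AA x := if (insub x : option A) is Some i then a i else if (insub x : option B) is Some j then g j else q.
pose BB x := if (insub x : option A) is Some i then b i else if (insub x : option B) is Some j then d j else q.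
have AAa i : AA (val i) = a i by rewrite /AA valK.
have BBa i : BB (val i) = b i by rewrite /BB valK.
have noA (j : B) : (insub (val j) : option A) = None by apply: insubN; rewrite clB.
have AAb j : AA (val j) = g j by rewrite /AA noA valK.
have BBb j : BB (val j) = d j by rewrite /BB noA valK.
have [||||c [cL cA cB cT]] := @spider_colouring 2 G S N K L KL AA BB (fun _ _ => q).
- move=> x k; case: (ord2 k) => -> h; first by have [i <-] := subA x h; rewrite AAa.
  by have [j <-] := subB x h; rewrite AAb.
- move=> x k; case: (ord2 k) => -> h; first by have [i <-] := subA x h; rewrite BBa.
  by have [j <-] := subB x h; rewrite BBb.
- move=> k l; case: (ord2 k) => ->; case: (ord2 l) => -> //; by rewrite setUC.
- by [].
exists c; split=> //.
apply: (@connected2 c (fun x => AA x) (fun x => BB x) q) => //.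
- move=> x y k; case: (ord2 k) => -> hx hy.
    have [i <-] := subA x hx; have [i' <-] := subA y hy; rewrite !AAa !BBa => /val_inj h1 /val_inj h2.
    by rewrite (s1 i i').
  have [i <-] := subB x hx; have [i' <-] := subB y hy; rewrite !AAb !BBb => /val_inj h1 /val_inj h2.
  by rewrite (s2 i i').
- move=> x y k l; case: (ord2 k) => ->; case: (ord2 l) => -> hx hy // _.
    have [i <-] := subA x hx; have [j <-] := subB y hy; rewrite AAa AAb BBa BBb !(inj_eq val_inj).
    by move=> /val_inj /s3[-> -> h]; rewrite eq_sym h.
  have [i <-] := subA y hy; have [j <-] := subB x hx; rewrite AAa AAb BBa BBb !(inj_eq val_inj).
  by move=> /val_inj/esym /s3[h1 h2 ->]; rewrite eq_sym h1 eq_sym h2.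
- move=> x k l; case: (ord2 k) => ->; case: (ord2 l) => -> hx // _.
    have [i <-] := subA x hx; rewrite BBa (inj_eq val_inj); have [h|[j hj]] := s4 i; [by left | right].
    by exists (val j); rewrite AAa AAb BBb !(inj_eq val_inj) clB.
  have [j <-] := subB x hx; rewrite BBb (inj_eq val_inj); have [h|[i hi]] := s5 j; [by left | right].
  by exists (val i); rewrite AAa AAb BBa !(inj_eq val_inj) clA.
- move=> k l; case: (ord2 k) => ->; case: (ord2 l) => -> // _.
    case: s6 => [[i h]|[j h]]; [left; exists (val i) | right; exists (val j)].
      by rewrite AAa BBa (inj_eq val_inj) clA.
    by rewrite AAb BBb !(inj_eq val_inj) clB.
  case: s7 => [[j h]|[i h]]; [left; exists (val j) | right; exists (val i)].
    by rewrite AAb BBb (inj_eq val_inj) clB.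
  by rewrite AAa BBa !(inj_eq val_inj) clA.
Qed.
End TwoTips.

(** * The Petersen graph *)

Definition pairs5 : seq (nat * nat) :=
  [:: (0, 1); (0, 2); (0, 3); (0, 4); (1, 2); (1, 3); (1, 4); (2, 3); (2, 4); (3, 4)].

Definition padj (n m : nat) : bool :=
  let p := nth (0, 0) pairs5 n in let q := nth (0, 0) pairs5 m in
  [&& p.1 != q.1, p.1 != q.2, p.2 != q.1 & p.2 != q.2].

(** A numbering of the vertices turns adjacency questions into finite checks on [padj] that can be
    evaluated. *)
Definition tabulated (G : sgraph) (h : nat -> G) : Prop :=
  (forall x, exists2 n, n < 10 & h n = x) /\
  forall n m, n < 10 -> m < 10 -> adj (h n) (h m) = padj n m.

Lemma petersen_tabulated : exists h : nat -> petersen, tabulated h.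
Proof.
have p5 n : n < 10 -> let p := nth (0, 0) pairs5 n in [&& p.1 < 5, p.2 < 5 & p.1 != p.2].
  by do 10?[case: n => [|n] //].
have c2 : #|[set inord 0; inord 1 : 'I_5]| == 2 by rewrite cards2 -val_eqE /= !inordK.
pose S n : {set 'I_5} := [set inord (nth (0, 0) pairs5 n).1; inord (nth (0, 0) pairs5 n).2].
pose h n : petersen := insubd (exist (fun A : {set 'I_5} => #|A| == 2) _ c2) (S n).
have hE n : n < 10 -> val (h n) = S n.
  move=> /p5/and3P[a b ab]; apply: insubdK; rewrite /S -topredE /= cards2 -val_eqE /= !inordK //.
  by rewrite ab.
exists h; split=> [A|n m n10 m10].
  have [i [j [ij AE]]] := cards2P _ (valP A).
  have mem : (minn i j, maxn i j) \in pairs5.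
    have H : all (fun a => all (fun b => (a != b) ==> ((minn a b, maxn a b) \in pairs5)) (iota 0 5)) (iota 0 5).
      by vm_compute.
    have lt5 (k : 'I_5) : (k : nat) \in iota 0 5 by rewrite mem_iota ltn_ord.
    by have /implyP := allP (allP H _ (lt5 i)) _ (lt5 j); apply.
  have n10 : index (minn i j, maxn i j) pairs5 < 10 by rewrite -[10]/(size pairs5) index_mem.
  exists (index (minn i j, maxn i j) pairs5) => //; apply: val_inj.
  rewrite hE // /S nth_index //= AE; case: (leqP i j) => _ /=; rewrite !inord_val //.
  by rewrite setUC.
rewrite /adj /= /petersen_adj !hE // /S /padj.
case/and3P: (p5 n n10) => a b _; case/and3P: (p5 m m10) => a' b' _.
rewrite disjoints_subset subUset !sub1set !inE !negb_or -!val_eqE /= !inordK //.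
by rewrite -andbA.
Qed.

Section Tabulated.
Variables (G : sgraph) (h : nat -> G).
Hypothesis tab : tabulated h.

Let below (n : nat) : n < 10 -> n \in iota 0 10.
Proof. by rewrite mem_iota. Qed.

(** Different vertices of the Petersen graph have different neighbourhoods, so the adjacency table
    alone makes the numbering injective. *)
Lemma tabulated_inj n m : n < 10 -> m < 10 -> (h n == h m) = (n == m).
Proof.
move=> n10 m10; apply/eqP/eqP => [E|-> //].
have H : all (fun a => all (fun b => all (fun k => padj a k == padj b k) (iota 0 10) ==> (a == b))
  (iota 0 10)) (iota 0 10) by vm_compute.
have /implyP K := allP (allP H n (below n10)) m (below m10).
apply/eqP/K/allP=> k; rewrite mem_iota => /= k10; have [_ ta] := tab.
by rewrite -!ta // E.
Qed.

Lemma tabulated_claw n : n < 10 -> exists a b d,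
  [/\ [&& a < 10, b < 10 & d < 10], uniq [:: a; b; d] & [&& padj n a, padj n b & padj n d]].
Proof.
move=> n10.
have H : all (fun a => size [seq k <- iota 0 10 | padj a k] == 3) (iota 0 10) by vm_compute.
move: (allP H n (below n10)) (filter_uniq (padj n) (iota_uniq 0 10)).
have nP k : k \in [seq k <- iota 0 10 | padj n k] -> (k < 10) && padj n k.
  by rewrite mem_filter mem_iota andbC.
case: [seq _ <- _ | _] nP => [|a [|b [|d [|]]]] // nP _ un; exists a, b, d.
have /andP[-> ->] := nP a (mem_head _ _).
have /andP[-> ->] : (b < 10) && padj n b by apply: nP; rewrite !inE eqxx orbT.
by have /andP[-> ->] : (d < 10) && padj n d by apply: nP; rewrite !inE eqxx !orbT.
Qed.

Lemma tabulated_deg (x : G) : 2 < deg x.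
Proof.
have [hs ta] := tab; have [n n10 <-] := hs x.
have [a [b [d [/and3P[a10 b10 d10] un /and3P[na nb nd]]]]] := tabulated_claw n10.
move: un; rewrite /= !inE negb_or andbT => /andP[/andP[ab ad] bd].
by apply: (@deg_ge3 _ _ (h a) (h b) (h d)); rewrite ?ta ?tabulated_inj.
Qed.

(** Two neighbours of a vertex are non-adjacent and have no further common neighbour. With two
    colours, any two edges at a vertex would therefore differ, but three edges meet there. *)
Lemma tabulated_ge3 (c : {set G} -> nat) : rainbow_connected c -> 3 <= num_colours c.
Proof.
move=> rc; rewrite leqNgt; apply/negP; rewrite ltnS => n2; have [hs ta] := tab.
have differ n a b : n < 10 -> a < 10 -> b < 10 -> a != b -> padj n a -> padj n b ->
    c [set h n; h a] != c [set h n; h b].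
  move=> n10 a10 b10 ab na nb.
  have H : all (fun n => all (fun a => all (fun b => [&& a != b, padj n a & padj n b] ==>
      (~~ padj a b && all (fun k => padj a k && padj k b ==> (k == n)) (iota 0 10)))
      (iota 0 10)) (iota 0 10)) (iota 0 10) by vm_compute.
  have /allP Hn := allP H n (below n10).
  have := allP (Hn a (below a10)) b (below b10).
  rewrite ab na nb => /implyP/(_ isT)/andP[nab /allP U].
  have [p pP] := rc (h a) (h b); have p2 := leq_trans (size_le_num_colours pP) n2.
  case: (short_rainbow pP (leqW p2)) => [/eqP||[u [au ub cu]]|[p3 _]].
  - by rewrite tabulated_inj // (negbTE ab).
  - by rewrite ta // (negbTE nab).
  - have [k k10 ku] := hs u; move: au ub cu; rewrite -ku !ta // => ak kb.
    have := U k (below k10); rewrite ak kb /= => /eqP -> cu.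
    by apply/eqP; rewrite setUC.
  - by move: p2; rewrite p3.
have [a [b [d [/and3P[a10 b10 d10] un /and3P[na nb nd]]]]] := tabulated_claw (isT : 0 < 10).
move: un; rewrite /= !inE negb_or andbT => /andP[/andP[ab ad] bd].
suff: 3 <= num_colours c by rewrite leqNgt ltnS n2.
rewrite -[3]/(size [:: c [set h 0; h a]; c [set h 0; h b]; c [set h 0; h d]]).
apply: uniq_leq_size => [|k].
  by rewrite /= !inE negb_or !differ.
by rewrite !inE => /or3P[] /eqP ->; apply: mem_colour; rewrite ta.
Qed.

Definition pedges : seq (nat * nat) :=
  [:: (0, 7); (0, 8); (0, 9); (1, 5); (1, 6); (1, 9); (2, 4); (2, 6); (2, 8); (3, 4);
      (3, 5); (3, 7); (4, 9); (5, 8); (6, 7)].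

Definition pindex (n m : nat) : nat := index (minn n m, maxn n m) pedges.

(* Twenty-seven of the thirty pairs of adjacent edges, and for each of the three missing
   ones the end edges of a path of length 3 joining the same two vertices; with all thirty
   adjacent pairs, i.e. for proper colourings, the signed count vanishes. *)
Definition pconstraints : seq (nat * nat) :=
  [:: (9, 13); (1, 13); (8, 13); (10, 13); (3, 13); (1, 8); (7, 8); (3, 10); (9, 10);
      (10, 12); (10, 11); (9, 11); (9, 12); (0, 9); (6, 9); (0, 1); (0, 11); (1, 2);
      (0, 2); (0, 14); (11, 14); (7, 14); (6, 7); (6, 12); (4, 14); (4, 7); (3, 4);
      (5, 12); (4, 5); (2, 5)].

(** Thirty inequalities on fifteen edges have the degree [15 * 2] that [alon_tarsi_nat] demands.
    That they make the colouring rainbow connected is a finite check over all pairs of vertices. *)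
Lemma tabulated_three_lists (L : {set G} -> nat -> Prop) : edge_list_assignment 3 L ->
  exists c, list_edge_colouring L c /\ rainbow_connected c.
Proof.
move=> hL; have [hs ta] := tab.
have [l lP] : exists l : 'I_15 -> 'I_3 -> nat, forall k, injective (l k) /\
    forall i, L [set h (nth (0, 0) pedges k).1; h (nth (0, 0) pedges k).2] (l k i).
  apply: (fin_all_exists (P := fun (k : 'I_15) (f : 'I_3 -> nat) => injective f /\
    forall i, L [set h (nth (0, 0) pedges k).1; h (nth (0, 0) pedges k).2] (f i))) => k.
  apply/hL/mem_edges.
  have H : all (fun k => let e := nth (0, 0) pedges k in
    [&& e.1 < 10, e.2 < 10 & padj e.1 e.2]) (iota 0 15) by vm_compute.
  have k15 : (k : nat) \in iota 0 15 by rewrite mem_iota ltn_ord.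
  by have /and3P[a b ab] := allP H _ k15; rewrite ta.
have [f fD] := @alon_tarsi_nat 14 l pconstraints (fun k => (lP k).1) ltac:(by vm_compute).
have [ix ixP] : exists ix : G -> nat, forall x, ix x < 10 /\ h (ix x) = x.
  apply: (fin_all_exists (P := fun x (n : nat) => n < 10 /\ h n = x)) => x.
  by have [n n10 nx] := hs x; exists n.
have ixh n : n < 10 -> ix (h n) = n.
  by move=> n10; apply/eqP; rewrite -tabulated_inj ?(ixP _).2 //; case: (ixP (h n)).
pose col n m : nat := l (inord (pindex n m)) (f (inord (pindex n m))).
have colC n m : col n m = col m n by rewrite /col /pindex minnC maxnC.
have [c cE] := @lift_sym G nat 0 (fun x y => col (ix x) (ix y)) (fun x y => colC _ _).
have chE n m : n < 10 -> m < 10 -> c [set h n; h m] = col n m by move=> n10 m10; rewrite cE !ixh.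
exists c; split=> [e /edgesP[x [y [xy ->]]]|x y].
  have [n n10 nx] := hs x; have [m m10 my] := hs y; subst x y.
  move: xy; rewrite ta // => nm; rewrite chE //.
  have H : all (fun n => all (fun m => padj n m ==> ((minn n m, maxn n m) \in pedges))
    (iota 0 10)) (iota 0 10) by vm_compute.
  have := allP (allP H n (below n10)) m (below m10); rewrite nm => /implyP/(_ isT) me.
  have := (lP (inord (pindex n m))).2 (f (inord (pindex n m))).
  rewrite -/(col n m) inordK; last by rewrite -[15]/(size pedges) index_mem.
  rewrite nth_index //; case: (leqP n m) => _ //=.
  by rewrite setUC.
change (joined c x y).
have [n n10 <-] := hs x; have [m m10 <-] := hs y.
pose ok n m n' m' := ((pindex n m, pindex n' m') \in pconstraints) ||
  ((pindex n' m', pindex n m) \in pconstraints).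
have okP a b a' b' : ok a b a' b' -> col a b != col a' b'.
  by case/orP=> /fD E; apply/eqP=> // /esym.
have H : all (fun n => all (fun m => [|| n == m, padj n m,
    has (fun u => [&& padj n u, padj u m & ok n u u m]) (iota 0 10) |
    has (fun u => has (fun v => [&& n != v, u != m & [&& padj n u, padj u v, padj v m,
      ok n u u v, ok n u v m & ok u v v m]]) (iota 0 10)) (iota 0 10)]) (iota 0 10)) (iota 0 10).
  by vm_compute.
have := allP (allP H n (below n10)) m (below m10).
case: (eqVneq n m) => [-> _|nm]; first by exists [::]; split.
case/or4P=> [//|nm'|/hasP[u]|/hasP[u ub /hasP[v]]]; first by apply: joined1; rewrite ta.
  rewrite mem_iota => /= u10 /and3P[nu um ou]; apply: (joined2 (u := h u)).
  - by rewrite tabulated_inj.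
  - by rewrite ta.
  - by rewrite ta.
  - by rewrite !chE // okP.
move: ub; rewrite !mem_iota => /= u10 v10.
case/and3P=> nv um' /and5P[nu uv vm o1 /andP[o2 o3]].
apply: (joined3 (u := h u) (v := h v)); rewrite ?tabulated_inj ?ta //.
by rewrite !chE // !okP.
Qed.
End Tabulated.

(** All degrees exceed 2, so every fibre of [f] is a singleton and the numbering can be pulled
    back. *)
Lemma blowup_tabulated G : blowup petersen G -> exists h : nat -> G, tabulated h.
Proof.
case=> f [fs fa fi]; have [h th] := petersen_tabulated; have [hs ta] := th.
have finj x y : f x = f y -> x = y.
  move=> E; apply/eqP; apply: contraT => xy; have [d2 _] := fi x y xy E.
  by have := tabulated_deg th (f x); rewrite d2.
have [g gP] : exists g : petersen -> G, forall b, f (g b) = b.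
  by apply: (fin_all_exists (P := fun b x => f x = b)).
exists (g \o h); split=> [x|n m n10 m10] /=.
  by have [n n10 nx] := hs (f x); exists n => //; apply: finj; rewrite gP.
by rewrite fa !gP ta.
Qed.

(** * Comparing the rainbow connection number with its list version *)

Definition list_connected (r : nat) (G : sgraph) : Prop :=
  forall L : {set G} -> nat -> Prop, edge_list_assignment r L ->
  exists c, list_edge_colouring L c /\ rainbow_connected c.

Lemma list_connectedW r s G : r <= s -> list_connected r G -> list_connected s G.
Proof.
move=> rs h L hL; apply: h => e /hL[f [fi fL]].
by exists (f \o widen_ord rs); split=> [i j /fi /(congr1 val) /= ?|i]; [apply: val_inj | apply: fL].
Qed.

Lemma list_connected_colours r G : list_connected r G ->
  exists c : {set G} -> nat, rainbow_connected c /\ num_colours c <= r.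
Proof.
move=> h; have [|c [cL rc]] := h (fun _ n => n < r).
  by move=> e _; exists val; split; [apply: val_inj | move=> i; apply: ltn_ord].
exists c; split=> //; rewrite -[r](size_iota 0); apply: uniq_leq_size; first exact: undup_uniq.
move=> k; rewrite mem_undup mem_iota => /mapP[e]; rewrite mem_enum => eG ->.
exact: cL.
Qed.

(** Constant lists turn a bound for lists into one for colourings, so both numbers agree once lists
    of the least possible size suffice: size 3 if some rainbow connected colouring uses at most
    three colours, size 4 otherwise. *)
Lemma rc_rcl_34 (G : sgraph) : (forall c : {set G} -> nat, rainbow_connected c -> 3 <= num_colours c) ->
  list_connected 4 G ->
  (forall c : {set G} -> nat, rainbow_connected c -> num_colours c <= 3 -> list_connected 3 G) ->
  exists k : nat, [/\ is_rc G k, is_rcl G k & k = 3 \/ k = 4].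
Proof.
move=> lb l4 l3.
have min_ge k r : (forall c : {set G} -> nat, rainbow_connected c -> k <= num_colours c) ->
    list_connected r G -> k <= r.
  by move=> lk /list_connected_colours[c [rc /(leq_trans (lk c rc))]].
have conclude k : list_connected k G -> (forall c : {set G} -> nat, rainbow_connected c -> k <= num_colours c) ->
    is_rc G k /\ is_rcl G k.
  move=> lk ge; split; split=> //.
  - have [c [rc ck]] := list_connected_colours lk; exists c; split=> //.
    by apply/eqP; rewrite eqn_leq ck ge.
  - by move=> m [c [rc <-]]; apply: ge.
  - by move=> r; apply: min_ge.
case: (classic (exists c : {set G} -> nat, rainbow_connected c /\ num_colours c <= 3)).
  by case=> c [rc c3]; exists 3; have [] := conclude 3 (l3 c rc c3) lb; split=> //; left.
move=> n3; exists 4; have [|] := conclude 4 l4; last by split=> //; right.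
move=> c rc; rewrite leqNgt; apply/negP; rewrite ltnS => c3; apply: n3; by exists c.
Qed.

Lemma calG_blowup G : calG G -> [\/ blowup C5 G, blowup G7 G | blowup petersen G].
Proof.
have [h th] := petersen_tabulated.
elim=> {G} [||| G v _ IH v2 | G H _ IH GH].
- by apply: Or31; apply: blowup_refl.
- by apply: Or32; apply: blowup_refl.
- by apply: Or33; apply: blowup_refl.
- case: IH => bG; [apply: Or31 | apply: Or32 | apply: Or33]; apply: blowup_dup v2 => // b.
  + exact: C5_deg2.
  + by case: (spider3_deg G7_spider b).
  + exact: ltnW (tabulated_deg th b).
- by case: IH => bG; [apply: Or31 | apply: Or32 | apply: Or33]; apply: blowup_iso bG GH.
Qed.

Theorem theorem4p9 (G : sgraph) (hG : calG G) :
  exists k : nat, [/\ is_rc G k, is_rcl G k & k = 3 \/ k = 4].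
Proof.
case: (calG_blowup hG) => [/blowup_C5_spider[S]|/blowup_G7_spider[S]|/blowup_tabulated[h th]];
  apply: rc_rcl_34.
- by move=> c rc; apply: (spider_ge3 S rc (k := ord0) (l := ord_max)).
- exact: (spider_four_lists S).
- exact: (spider2_three_lists S).
- by move=> c rc; apply: (spider_ge3 S rc (k := ord0) (l := ord_max)).
- exact: (spider_four_lists S).
- exact: (spider3_three_lists S).
- exact: (tabulated_ge3 th).
- by apply: (@list_connectedW 3 4) => // L; apply: (tabulated_three_lists th).
- by move=> c _ _ L; apply: (tabulated_three_lists th).
Qed.
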